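(* Let $\Omega\subset\mathbb{R}^d$ be a smooth bounded domain, $\eta(w)=\eta_0w^\alpha$ and $\kappa(w)=\kappa_0w^\beta$ with $\alpha,\beta,\eta_0,\kappa_0>0$, and $Q_T=[0,T]\times\Omega$. Then for all $\delta\in\,]0,1[$ there exists a constant $C_*>0$ such that all smooth solutions $(v,w)$ on $Q_T$ of $$\dot v=\operatorname{div}(\eta(w)\nabla v),\qquad \dot w=\operatorname{div}(\kappa(w)\nabla w)+\eta(w)|\nabla v|^2,\qquad \eta(w)\nabla v\cdot\mathrm n=0=\kappa(w)\nabla w\cdot\mathrm n\ \text{ on }\partial\Omega,$$ with initial data $(v^0,w^0)$ and with $w(t,x)\ge\underline w>0$ (for some constant $\underline w$) satisfy, with $\mathcal E_0:=\int_\Omega(\frac12(v^0)^2+w^0)\,dx$: (a) for $\beta>0$: $\displaystyle\iint_{Q_T}\frac1{1+w}\Big|\nabla\big(w^{1+(\beta-\delta)/2}\big)\Big|^2dx\,dt\le C_*\,\mathcal E_0$; (b) for $\beta>0$: $\displaystyle\iint_{Q_T}\Big|\nabla\big(w^{(\beta+\delta)/2}\big)\Big|^2dx\,dt\le C_*\big(|\Omega|+\mathcal E_0\big)$; (c) if $\alpha\in\,]0,1[$: $\displaystyle\iint_{Q_T}|\nabla v|^2dx\,dt\le C_*\big(|\Omega|+\mathcal E_0\big)$. If we additionally have $\kappa\equiv\eta$ (i.e. $\alpha=\beta$ and $\kappa_0=\eta_0$) and $|v^0(x)|\le M_*w^0(x)$ on $\Omega$, then, for $C_*$ now depending on $\delta$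 and $M_*$ only (apart from the given coefficients $\alpha,\eta_0$), we further have (d) $\displaystyle\iint_{Q_T}\Big|\nabla\big(\{v\}^{1+\alpha/2}\big)\Big|^2dx\,dt\le C_*\,\mathcal E_0$; (e) if $\alpha=\beta\ge1-\delta$: $\displaystyle\iint_{Q_T}\Big|\nabla\big(\{v\}^{(1+\alpha+\delta)/2}\big)\Big|^2dx\,dt\le C_*\big(|\Omega|+\mathcal E_0\big)$. Throughout, the constant $C_*$ is independent of the lower bound $\underline w$.
   Context: For $a\in\mathbb{R}$ and $\gamma>0$, $\{a\}^\gamma:=\operatorname{sign}(a)|a|^\gamma$. $|\Omega|$ is the Lebesgue measure of $\Omega$, $\mathrm n$ is the outer unit normal, and smooth solutions means classical solutions, regular up to the boundary and up to $t=0$. The constant $C_*$ does not depend on the particular solution. *)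

(* Defs.v *)
From HB Require Import structures.
From mathcomp Require Import all_boot all_order all_algebra.
From mathcomp Require Import all_classical all_reals all_analysis.

Set Implicit Arguments.
Unset Strict Implicit.
Unset Printing Implicit Defensive.

Import Order.TTheory GRing.Theory Num.Theory.
Import numFieldNormedType.Exports.

Local Open Scope classical_set_scope.
Local Open Scope ring_scope.

(* The sigma-algebra on 'rV[R]_n is generated by the coordinates, as the
   library does for n.-tuple; it is the Borel sigma-algebra of R^n. *)
Definition measure_rV_display : measure_display -> measure_display.
Proof. exact. Qed.

Section measurable_rV.
Context (R : realType) (n : nat).

Let coor (i : 'I_n) (x : 'rV[R]_n) : R := x 0 i.

Let rV_set0 : g_sigma_preimage coor set0.
Proof. exact: sigma_algebra0. Qed.

Let rV_setC A : g_sigma_preimage coor A -> g_sigma_preimage coor (~` A).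
Proof. exact: sigma_algebraC. Qed.

Let rV_bigcup (F : _^nat) : (forall i, g_sigma_preimage coor (F i)) ->
  g_sigma_preimage coor (\bigcup_i (F i)).
Proof. exact: sigma_algebra_bigcup. Qed.

HB.instance Definition _ :=
  @isMeasurable.Build (measure_rV_display default_measure_display)
  'rV[R]_n (g_sigma_preimage coor) rV_set0 rV_setC rV_bigcup.

End measurable_rV.

Lemma measurable_coord (R : realType) n (i : 'I_n) :
  measurable_fun [set: 'rV[R]_n] (fun x : 'rV[R]_n => x 0 i).
Proof.
move=> _ Y mY; rewrite setTI; apply: sub_sigma_algebra => /=.
rewrite -bigcup_seq/=; exists i => /=; first by rewrite mem_index_enum.
by exists Y => //; rewrite setTI.
Qed.

Lemma measurable_fun_rVP d (T : measurableType d) (R : realType) n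
    (f : T -> 'rV[R]_n) :
  (forall i, measurable_fun [set: T] (fun x => f x 0 i)) ->
  measurable_fun [set: T] f.
Proof.
move=> mf _ A mA; rewrite setTI; move: A mA.
have /smallest_sub : sigma_algebra setT [set A | measurable (f @^-1` A)].
  split => /=; first by rewrite preimage_set0.
    by move=> A mA; rewrite setTD preimage_setC; exact: measurableC.
  by move=> F mF; rewrite preimage_bigcup; exact: bigcup_measurable.
apply.
rewrite -bigcup_seq => A [i _] [B mB <-] /=.
by rewrite setTI -comp_preimage -[X in measurable X]setTI; exact: mf.
Qed.

Section cons_rV.
Context (R : realType) (n : nat).

Definition cons_rV (p : measurableTypeR R * 'rV[R]_n) : 'rV[R]_n.+1 :=
  \row_i (if unlift 0 i is Some j then p.2 0 j else p.1).

Definition uncons_rV (x : 'rV[R]_n.+1) : measurableTypeR R * 'rV[R]_n :=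
  (x 0 0, \row_i x 0 (lift 0 i)).

Lemma cons_rVK : cancel cons_rV uncons_rV.
Proof.
move=> [x y]; rewrite /uncons_rV /cons_rV /=; congr pair.
  by rewrite mxE unlift_none.
by apply/rowP => i; rewrite !mxE liftK.
Qed.

Lemma measurable_cons_rV : measurable_fun setT cons_rV.
Proof.
apply: measurable_fun_rVP => i.
under eq_fun do rewrite mxE.
case: (unlift 0 i) => [j|]; last exact: measurable_fst.
exact: (measurableT_comp (measurable_coord _) measurable_snd).
Qed.

Lemma measurable_uncons_rV : measurable_fun setT uncons_rV.
Proof.
apply/measurable_fun_pairP; split; first exact: measurable_coord.
apply: measurable_fun_rVP => i /=.
under eq_fun do rewrite /= mxE.
exact: measurable_coord.
Qed.

End cons_rV.

Section lebesgue_cons.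
Local Open Scope ereal_scope.
Context (R : realType) (n : nat).
Variable mu : {sigma_finite_measure set 'rV[R]_n -> \bar R}.

Definition lebesgue_cons : set 'rV[R]_n.+1 -> \bar R :=
  pushforward (@lebesgue_measure R \x mu) (@cons_rV R n).

Let cons0 : lebesgue_cons set0 = 0.
Proof. by rewrite /lebesgue_cons /pushforward preimage_set0 measure0. Qed.

Let cons_ge0 A : 0 <= lebesgue_cons A.
Proof. exact: (measure_ge0 (@lebesgue_measure R \x mu)). Qed.

Let cons_sigma_additive : semi_sigma_additive lebesgue_cons.
Proof.
have mcons A : measurable A -> measurable (@cons_rV R n @^-1` A).
  by move=> mA; rewrite -[X in measurable X]setTI; exact: measurable_cons_rV.
move=> F mF tF mUF; rewrite /lebesgue_cons /pushforward preimage_bigcup.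
apply: (measure_semi_sigma_additive (s := @lebesgue_measure R \x mu)).
- by move=> k; exact: mcons.
- apply/trivIsetP => /= i j _ _ ij; rewrite -preimage_setI.
  by move/trivIsetP : tF => /(_ _ _ _ _ ij) ->//; rewrite preimage_set0.
- by rewrite -preimage_bigcup; exact: mcons.
Qed.

HB.instance Definition _ := isMeasure.Build _ _ _ lebesgue_cons
  cons0 cons_ge0 cons_sigma_additive.

Let cons_sigma_finite : sigma_finite setT lebesgue_cons.
Proof.
have /sigma_finiteP[F [TF ndF Foo]] := sigma_finiteT (@lebesgue_measure R).
have /sigma_finiteP[G [TG ndG Goo]] := sigma_finiteT mu.
exists (fun k => @uncons_rV R n @^-1` (F k `*` G k)) => [|k].
  apply/esym/seteqP; split => // z _; set p := uncons_rV z.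
  have : [set: measurableTypeR R] p.1 by [].
  have : [set: 'rV[R]_n] p.2 by [].
  rewrite TF TG => -[k _ Gk] [l _ Fl]; exists (maxn k l) => //; split.
    by move: Fl; exact/subsetPset/ndF/leq_maxr.
  by move: Gk; exact/subsetPset/ndG/leq_maxl.
have [mFk Fkoo] := Foo k; have [mGk Gkoo] := Goo k; split.
  rewrite -[X in measurable X]setTI; apply: measurable_uncons_rV => //.
  exact: measurableX.
rewrite /lebesgue_cons /pushforward -comp_preimage.
rewrite (_ : _ \o _ = id); last by apply/funext => p /=; rewrite cons_rVK.
by rewrite preimage_id product_measure1E// lte_mul_pinfty// ge0_fin_numE.
Qed.

HB.instance Definition _ := Measure_isSigmaFinite.Build _ _ _ lebesgue_cons
  cons_sigma_finite.

End lebesgue_cons.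

Fixpoint lebesgue_rV (R : realType) (n : nat) :
    {sigma_finite_measure set 'rV[R]_n -> \bar R} :=
  match n with
  | 0 => [the {sigma_finite_measure set _ -> \bar R} of \d_ (0 : 'rV[R]_0)]
  | m.+1 => [the {sigma_finite_measure set _ -> \bar R}
               of lebesgue_cons (lebesgue_rV R m)]
  end.

Section calculus.
Context (R : realType) (d : nat).
Implicit Types (f rho : 'rV[R]_d -> R) (F : 'rV[R]_d -> 'rV[R]_d).
Implicit Types (Omega U : set 'rV[R]_d) (x n : 'rV[R]_d).

Definition partial (i : 'I_d) f : 'rV[R]_d -> R := 'D_(delta_mx 0 i) f.

Definition grad f x : 'rV[R]_d := \row_i partial i f x.

Definition div F x : R := \sum_i partial i (fun y => F y 0 i) x.

Definition dot (a b : 'rV[R]_d) : R := \sum_i a 0 i * b 0 i.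

(* Euclidean; the library's `| _ | on 'rV[R]_d is the sup norm. *)
Definition norm2 (a : 'rV[R]_d) : R := Num.sqrt (dot a a).

(* C^oo on an open set: all iterated partial derivatives are differentiable. *)
Definition smooth_on U f : Prop :=
  forall (s : seq 'I_d) x, U x -> differentiable (foldr partial f s) x.

Definition boundary Omega : set 'rV[R]_d := closure Omega `\` Omega°.

Definition defining_function Omega U rho : Prop :=
  [/\ open U, smooth_on U rho,
      forall x, U x -> grad rho x != 0 &
      forall x, U x -> (Omega x <-> rho x < 0)].

Definition smooth_bounded_domain Omega : Prop :=
  [/\ Omega !=set0, open Omega, connected Omega, bounded_set Omega &
      forall x, boundary Omega x ->
        exists U rho, U x /\ defining_function Omega U rho].

Definition outer_unit_normal Omega x n : Prop :=
  exists U rho, [/\ U x, defining_function Omega U rho &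
    n = (norm2 (grad rho x))^-1 *: grad rho x].

End calculus.

Section parabolic_system.
Context (R : realType) (d : nat).
Implicit Types (Omega : set 'rV[R]_d) (T : R) (u v w : R -> 'rV[R]_d -> R).

(* Q_T = [0,T] x Omega; the time variable has type measurableTypeR R so that
   the product measure with lebesgue_measure makes sense on it. *)
Definition cylinder T Omega : set (measurableTypeR R * 'rV[R]_d) :=
  `[0, T]%classic `*` Omega.

Definition dt u (t : R) (x : 'rV[R]_d) : R := derive1 (u ^~ x) t.

Definition extends_continuously (A B : set (R * 'rV[R]_d))
    (u : R -> 'rV[R]_d -> R) : Prop :=
  exists g : R * 'rV[R]_d -> R, {within B, continuous g} /\
    forall t x, A (t, x) -> g (t, x) = u t x.

(* C^{1,2} up to the boundary: u is continuous on the closed cylinder, and its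
   first time derivative and first and second space derivatives exist inside
   and extend continuously to the closed cylinder. *)
Definition regular_upto_boundary T Omega u : Prop :=
  let closedQ := `[0, T]%classic `*` closure Omega in
  [/\ {within closedQ, continuous (fun p : R * 'rV[R]_d => u p.1 p.2)},
      (forall t x, 0 < t < T -> Omega x -> derivable (u ^~ x) t 1) /\
        extends_continuously (`]0, T[%classic `*` Omega) closedQ (dt u),
      (forall i,
        (forall t x, 0 <= t <= T -> Omega x ->
           derivable (u t) x (delta_mx 0 i)) /\
        extends_continuously (`[0, T]%classic `*` Omega) closedQ
          (fun t => partial i (u t))) &
      (forall i j,
        (forall t x, 0 <= t <= T -> Omega x ->
           derivable (partial i (u t)) x (delta_mx 0 j)) /\
        extends_continuously (`[0, T]%classic `*` Omega) closedQ
          (fun t => partial j (partial i (u t))))].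

(* a grad(u) . n = 0 on [0,T] x boundary Omega; the values of the gradient on
   the boundary are its limits from inside Q_T. *)
Definition no_flux T Omega (a : R -> 'rV[R]_d -> R) u : Prop :=
  forall t x n, 0 <= t <= T -> boundary Omega x -> outer_unit_normal Omega x n ->
    (fun p : R * 'rV[R]_d => a p.1 p.2 * dot (grad (u p.1) p.2) n)
      @ within (`[0, T]%classic `*` Omega) (nbhs (t, x)) --> (0 : R).

Definition smooth_solution (eta kappa : R -> R) T Omega v w
    (v0 w0 : 'rV[R]_d -> R) : Prop :=
  [/\ regular_upto_boundary T Omega v /\ regular_upto_boundary T Omega w,
      (forall t x, 0 < t < T -> Omega x ->
         dt v t x = div (fun y => eta (w t y) *: grad (v t) y) x),
      (forall t x, 0 < t < T -> Omega x ->
         dt w t x = div (fun y => kappa (w t y) *: grad (w t) y) x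
                    + eta (w t x) * norm2 (grad (v t) x) ^+ 2),
      no_flux T Omega (fun t x => eta (w t x)) v /\
      no_flux T Omega (fun t x => kappa (w t x)) w &
      forall x, Omega x -> v 0 x = v0 x /\ w 0 x = w0 x].

Definition space_integral Omega (f : 'rV[R]_d -> R) : \bar R :=
  (\int[lebesgue_rV R d]_(x in Omega) (f x)%:E)%E.

Definition spacetime_integral T Omega u : \bar R :=
  (\int[@lebesgue_measure R \x lebesgue_rV R d]_(p in cylinder T Omega)
     (u p.1 p.2)%:E)%E.

Definition energy Omega (v0 w0 : 'rV[R]_d -> R) : \bar R :=
  space_integral Omega (fun x => 2^-1 * v0 x ^+ 2 + w0 x).

End parabolic_system.

Definition power_law (R : realType) (c gamma : R) : R -> R :=
  fun s => c * s `^ gamma.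

(* {a}^gamma = sign(a) |a|^gamma *)
Definition signed_power (R : realType) (a gamma : R) : R :=
  Num.sg a * `|a| `^ gamma.

(* Main.v *)
Require Import Defs.
From mathcomp Require Import all_boot all_order all_algebra.
From mathcomp Require Import all_classical all_reals all_analysis.
From mathcomp Require Import measurable_realfun ring lra.
From mathcomp Require finmap.

Set Implicit Arguments.
Unset Strict Implicit.
Unset Printing Implicit Defensive.

Import Order.TTheory GRing.Theory Num.Theory.
Import numFieldNormedType.Exports.

Local Open Scope classical_set_scope.
Local Open Scope ring_scope.

(** Entropy method. For z = a w + b v and a scalar test function phi, multiply
the corresponding combination of the two equations by phi'(z) and integrate:
the flux A = a kappa(w) grad w + b eta(w) grad v has no normal component, so
  d/dt int phi(z) = int (a phi'(z) eta(w) |grad v|^2 - phi''(z) grad z . A).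
[entropy_balance] is this identity integrated in time, against an affine weight
p + q t.

The choice phi(v) = v^2/2 together with phi(w) = w gives conservation of
int (v^2/2 + w). Hence both the space-time integral of eta(w) |grad v|^2 and
int w(T) are at most the initial energy E, and for every concave increasing phi
with 0 <= phi(s) <= c1 + c2 s the space-time integral of the nonnegative
quantity
  phi'(w) eta(w) |grad v|^2 - phi''(w) kappa(w) |grad w|^2
is at most c1 |Omega| + c2 E ([production_le]). Each estimate is a choice of
phi:
- the weighted bound on grad w uses s (1 + s^a)^(1 - 1/a) with a = 1 - delta,
  which stays below s, so that |Omega| does not enter, while its second
  derivative is comparable to - s^(- delta) / (1 + s);
- the unweighted bound on grad w uses phi = s^delta;
- the bound on grad v for alpha < 1 uses phi = s^(1 - alpha), because then
  phi'(w) eta(w) is constant.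
When kappa = eta, M w + v and M w - v are supersolutions of one and the same
linear diffusion equation, so |v| <= M w persists from the initial time
([defect_int_le0]). A gradient of a signed power of v is then bounded by
|grad v| times a power of w ([signed_power_le]), and the last two estimates
reduce to the bound on eta(w) |grad v|^2 and to phi = s^delta.

The analytic core is that the divergence of a C^1 field with zero normal
component on the boundary has integral zero ([divergence_theorem]). No surface
measure is involved. Multiply the field F by a cutoff chi of the boundary layer
{ - rho < 2/(n+1) }; the product has compact support and its divergence has
integral zero by Fubini and the fundamental theorem of calculus
([integral_partial_eq0]). What remains is the integral of F . grad chi, where
grad chi is a multiple of grad rho: by compactness F . grad rho is uniformly
small on the layer ([flux_layer]), and the total variation of chi is bounded
because one partial derivative of chi has constant sign and can be integrated
by parts against a plateau function ([divergence_cutoff_bound]). Plateau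
functions also serve to split a field among the balls of a finite cover of the
closure of Omega. *)

(** * Measurability of continuous functions on the space of row vectors *)

Section measurable_continuous.
Context (R : realType).

(** The sigma-algebra is generated by coordinates, so an open set has to be written
as a countable union of boxes: those with rational centre and radius 1/(k+1). *)
Lemma open_measurable_rV n (U : set 'rV[R]_n) : open U -> measurable U.
Proof.
move=> oU.
pose box (p : 'rV[rat]_n * nat) : set 'rV[R]_n :=
  ball (map_mx (@ratr R) p.1) p.2.+1%:R^-1.
have -> : U = \bigcup_(p : 'rV[rat]_n * nat)
    (if pselect (box p `<=` U) then box p else set0).
  apply/seteqP; split => [x Ux|x [p _]]; last by case: pselect => [bU /bU|].
  have : nbhs x U by exact: open_nbhs_nbhs.
  move=> /nbhs_ballP[e /= e0 xeU].
  have [k ke] : exists k : nat, k.+1%:R^-1 < e / 2.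
    have e20 : (0 < e / 2) by rewrite divr_gt0.
    by have [k] := ltr_add_invr e20; rewrite add0r => ke; exists k.
  have /choice[q qx] (i : 'I_n) : exists q : rat, ball (x 0 i) k.+1%:R^-1 (ratr q).
    have xne : ball (x 0 i) k.+1%:R^-1 !=set0.
      by exists (x 0 i); apply: ballxx; rewrite invr_gt0.
    have [y [xq [q _ qE]]] := @dense_rat R _ xne (ball_open _ _).
    by exists q; rewrite qE.
  have bx : box (\row_i q i, k) x.
    split; first by rewrite invr_gt0.
    by move=> i j; rewrite !mxE (ord1 i); exact/ball_sym/qx.
  exists (\row_i q i, k) => //; case: pselect => // nbox; exfalso; apply: nbox => z /= bxz; apply: xeU.
  rewrite [e]splitr; apply: (ball_triangle (y := map_mx (@ratr R) (\row_i q i : 'rV_n))).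
    by apply: (le_ball (ltW ke)); exact: ball_sym.
  by apply: (le_ball (ltW ke)).
apply: countable_bigcupT_measurable => // p.
case: pselect => [pU|pNU]; last exact: measurable0.
rewrite [X in measurable X]/= {pU}.
rewrite (_ : box p = \bigcap_(i in [set: 'I_n])
   ((fun x : 'rV[R]_n => x 0 i) @^-1` ball (ratr (p.1 0 i) : R) p.2.+1%:R^-1)).
  apply: fin_bigcap_measurable => // i _.
  rewrite -[X in measurable X]setTI; apply: measurable_coord => //.
  by apply: open_measurable; exact: ball_open.
apply/seteqP; split => [x [_ bx] i _ /=|x bx].
  by have := bx 0 i; rewrite mxE.
split; first by rewrite invr_gt0.
by move=> i j; rewrite mxE (ord1 i); exact: bx.
Qed.

Lemma continuous_rVP (T : topologicalType) n (f : T -> 'rV[R]_n) (x : T) :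
  (forall i, (fun y => f y 0 i) @ x --> f x 0 i) -> f @ x --> f x.
Proof.
move=> cf; apply/cvg_ballP => e e0.
have : \forall y \near x, forall i, ball (f x 0 i) e (f y 0 i).
  by apply: filter_forall => i; have /cvg_ballP := cf i; exact.
by apply: filterS => y fy; split => // i j; rewrite (ord1 i); exact: fy.
Qed.

Lemma continuous_uncons_rV n :
  continuous (fun x : 'rV[R]_n.+1 => @uncons_rV R n x : R * 'rV[R]_n).
Proof.
move=> x.
have h1 : (fun y : 'rV[R]_n.+1 => y 0 0) @ x --> x 0 0 by exact: coord_continuous.
have h2 : (fun y : 'rV[R]_n.+1 => \row_i y 0 (lift 0 i)) @ x --> \row_i x 0 (lift 0 i).
  apply: (continuous_rVP (f := fun x : 'rV[R]_n.+1 => \row_i x 0 (lift 0 i))) => i.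
  by rewrite mxE; under eq_fun do rewrite mxE; exact: coord_continuous.
exact: (cvg_pair h1 h2).
Qed.

Lemma open_measurable_RrV n (U : set (R * 'rV[R]_n)) :
  open U -> measurable (U : set (measurableTypeR R * 'rV[R]_n)).
Proof.
move=> oU.
rewrite (_ : U = @cons_rV R n @^-1` (@uncons_rV R n @^-1` U)); last first.
  by apply/seteqP; split => p /=; rewrite cons_rVK.
rewrite -[X in measurable X]setTI; apply: measurable_cons_rV => //.
apply: open_measurable_rV; apply: open_comp => // x _.
exact: continuous_uncons_rV.
Qed.

Lemma continuous_measurable_rV n (D : set 'rV[R]_n) (f : 'rV[R]_n -> R) :
  open D -> (forall x, D x -> {for x, continuous f}) -> measurable_fun D f.
Proof.
move=> oD cf; apply: (measurability _ (RGenOpens.measurableE R)).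
move=> _ [_ [a [b ->] <-]]; apply: open_measurable_rV.
have : {in D, continuous f} by move=> x; rewrite inE; exact: cf.
move=> /continuous_inP -/(_ oD); apply; exact: interval_open.
Qed.

(** A function continuous on the closed cylinder is measurable on the smaller one:
continuity relative to B gives preimages that are traces on B of open sets. *)
Lemma within_continuous_measurable_RrV n (A B : set (R * 'rV[R]_n))
    (f : R * 'rV[R]_n -> R) : A `<=` B ->
  measurable (A : set (measurableTypeR R * 'rV[R]_n)) ->
  {within B, continuous f} ->
  measurable_fun (A : set (measurableTypeR R * 'rV[R]_n)) f.
Proof.
move=> AB mA; rewrite continuousP => cf.
apply: (measurability _ (RGenOpens.measurableE R)).
move=> _ [_ [a [b ->] <-]].
have /(iffLR (open_subspaceP _ _)) : @open (subspace B) (f @^-1` `]a, b[) by exact/cf/interval_open.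
move=> [V oV VB].
rewrite (_ : A `&` _ = A `&` V).
  by apply: measurableI => //; exact: open_measurable_RrV.
apply/seteqP; split => x [Ax fx]; split => //.
  by have : (V `&` B) x by [rewrite VB; split => //; exact: AB]; case.
by have : (f @^-1` `]a, b[ `&` B) x by [rewrite -VB; split => //; exact: AB]; case.
Qed.

End measurable_continuous.

(** * Integrals of derivatives of compactly supported functions *)

(** Derivatives along a line are difference quotients, so an affine change of
variables transports them without any differentiability assumption. *)
Lemma is_derive_affine (R : numFieldType) (V W Z : normedModType R)
    (phi : V -> W) (f : W -> Z) (a u : V) (w : W) (l : Z) :
  (forall h : R, phi (h *: u + a) = h *: w + phi a) ->
  is_derive (phi a) w f l -> is_derive a u (f \o phi) l.
Proof.
move=> phiE [df fl].
have E : (fun h : R => h^-1 *: (((f \o phi) \o shift a) (h *: u) - (f \o phi) a))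
  = (fun h : R => h^-1 *: ((f \o shift (phi a)) (h *: w) - f (phi a))).
  by apply/funext => h; rewrite /= phiE.
by split; [rewrite /derivable E|rewrite /derive E].
Qed.

Section compact_support.
Context (R : realType).

Definition cube n (L : R) : set 'rV[R]_n := [set x | forall i, `|x 0 i| <= L].
Arguments cube : clear implicits.

Lemma cubeE n L : cube n L =
  \bigcap_(i in [set: 'I_n]) ((fun x : 'rV[R]_n => x 0 i) @^-1` `[-L, L]).
Proof.
apply/seteqP; split => [x cx i _|x cx i]; first by rewrite /= in_itv/= -ler_norml.
by have := cx i I; rewrite /= in_itv/= -ler_norml.
Qed.

Lemma measurable_cube n L : measurable (cube n L).
Proof.
rewrite cubeE; apply: fin_bigcap_measurable => // i _.
by rewrite -[X in measurable X]setTI; exact: measurable_coord.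
Qed.

Lemma closed_cube n L : closed (cube n L).
Proof.
rewrite cubeE; apply: closed_bigI => i _.
apply: preimage_closed; last exact: itv_closed.
by move=> x _; exact: coord_continuous.
Qed.

Lemma compact_cube n L : compact (cube n L).
Proof.
have -> : cube n L = [set v | forall i, `[-L, L]%classic (v ord0 i)].
  by rewrite cubeE; apply/seteqP; split => x /= cx i => [|_]; exact: cx.
by apply: (@rV_compact _ _ (fun=> `[-L, L]%classic)) => i; exact: segment_compact.
Qed.

Lemma lebesgue_rVS n (A : set 'rV[R]_n.+1) :
  lebesgue_rV R n.+1 A =
  (@lebesgue_measure R \x lebesgue_rV R n)%E (@cons_rV R n @^-1` A).
Proof. by []. Qed.

Lemma preimage_cons_cube n L :
  @cons_rV R n @^-1` cube n.+1 L = `[-L, L]%classic `*` cube n L.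
Proof.
apply/seteqP; split => [[t y] /= ty|[t y] /= [tL yL] i].
  split => [|j /=]; first by have := ty 0; rewrite mxE unlift_none /= in_itv/= -ler_norml.
  by have := ty (lift 0 j); rewrite mxE liftK.
rewrite mxE; case: (unlift 0 i) => [j|]; first exact: yL.
by move: tL; rewrite in_itv/= -ler_norml.
Qed.

Lemma lebesgue_cube_lty n L : (lebesgue_rV R n (cube n L) < +oo)%E.
Proof.
elim: n => [|n IH].
  rewrite /= /dirac indicE; case: (_ \in _) => /=; exact: ltry.
rewrite lebesgue_rVS preimage_cons_cube product_measure1E//; last exact: measurable_cube.
rewrite lte_mul_pinfty// ge0_fin_numE//.
have := @lebesgue_measure_itv R `[-L, L].
by move=> /= ->; case: ifP => _; exact: ltry.
Qed.

Lemma integral_rVS n (f : 'rV[R]_n.+1 -> R) :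
  measurable_fun setT f ->
  (@lebesgue_measure R \x lebesgue_rV R n)%E.-integrable setT
    (EFin \o f \o @cons_rV R n) ->
  (\int[lebesgue_rV R n.+1]_x (f x)%:E =
   \int[@lebesgue_measure R \x lebesgue_rV R n]_p (f (cons_rV p))%:E)%E.
Proof.
move=> mf intf.
have := @integral_pushforward _ _ _ _ R _ (@measurable_cons_rV R n)
   (@lebesgue_measure R \x lebesgue_rV R n)%E setT (EFin \o f).
rewrite preimage_setT; apply => //.
exact/measurable_EFinP.
Qed.

(** The measure is only known to be sigma-finite; boundedness is what makes it
finite on the domain. *)
Lemma measurable_bounded_lty n L (D : set 'rV[R]_n) :
  measurable D -> D `<=` cube n L -> (lebesgue_rV R n D < +oo)%E.
Proof.
move=> mD DL; apply: le_lt_trans (lebesgue_cube_lty n L).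
by apply: le_measure; rewrite ?inE//; exact: measurable_cube.
Qed.

Lemma bounded_cube_continuous n L (g : 'rV[R]_n -> R) :
  continuous g -> exists K, forall x, cube n L x -> `|g x| <= K.
Proof.
move=> cg; have : compact (g @` cube n L).
  by apply: continuous_compact (@compact_cube n L); exact: continuous_subspaceT.
move=> /compact_bounded[K [_ gK]]; exists (K + 1) => x Lx.
by apply: (gK (K + 1)); [rewrite ltrDl|exists x].
Qed.

Lemma integrable_cube_continuous n L (g : 'rV[R]_n -> R) :
  continuous g -> (forall x, ~ cube n L x -> g x = 0) ->
  (lebesgue_rV R n).-integrable setT (EFin \o g).
Proof.
move=> cg g0.
have -> : EFin \o g = (EFin \o g) \_ (cube n L).
  apply/funext => x; rewrite patchE; case: ifPn => // /negP; rewrite inE /=.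
  by move=> /g0 ->.
apply: (iffLR (integrable_mkcond _ (@measurable_cube n L))).
apply: measurable_bounded_integrable; [exact: measurable_cube|exact: lebesgue_cube_lty| |].
  apply: (measurable_funS measurableT) => //.
  by apply: continuous_measurable_rV => [|x _]; [exact: openT|exact: cg].
have [K gK] := bounded_cube_continuous L cg.
exists K; split; first exact: num_real.
by move=> M KM x Lx; exact: le_trans (gK _ Lx) (ltW KM).
Qed.

(** The complement of the cube is open, so f vanishes around each of its points. *)
Lemma derivative_eq0 n i L (f g : 'rV[R]_n -> R) :
  (forall x, is_derive x (delta_mx 0 i) f (g x)) ->
  (forall x, ~ cube n L x -> f x = 0) ->
  forall x, ~ cube n L x -> g x = 0.
Proof.
move=> df f0 x Lx; have [_ <-] := df x.
rewrite (near_eq_derive (g := cst 0)) ?derive_cst//.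
have /(_ _ Lx) : open (~` cube n L) by exact/closed_openC/closed_cube.
by apply: filterS => y; exact: f0.
Qed.

(** The integrand is supported in [-L, L], hence the integral is a difference of
two values of f at points where f vanishes. *)
Lemma integral_derivative_eq0 (f g : R -> R) (L : R) :
  continuous g -> (forall t : R, is_derive t (1 : R) f (g t)) ->
  (forall t : R, ~ (`|t| <= L) -> f t = 0) ->
  (\int[@lebesgue_measure R]_t (g t)%:E = 0)%E.
Proof.
move=> cg df f0; pose L' : R := `|L| + 1.
have LL' : L < L' by rewrite (le_lt_trans (ler_norm L)) ?ltrDl.
have L'0 : 0 < L' by rewrite (le_lt_trans (normr_ge0 L)) ?ltrDl.
have g0 t : ~ (`|t| <= L) -> g t = 0.
  move=> Lt; have [_ <-] := df t.
  rewrite (near_eq_derive (g := cst 0)) ?derive_cst//.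
  have : \forall s \near t, L < `|s|.
    have /cvgr_gt : `|s| @[s --> t] --> `|t| by exact: norm_continuous.
    by apply; rewrite ltNge; exact/negP.
  by apply: filterS => s Ls; apply: f0; apply/negP; rewrite -ltNge.
transitivity (\int[@lebesgue_measure R]_(t in `[(- L')%R, L'%R]) (g t)%:E)%E.
  rewrite [RHS]integral_mkcond; apply: eq_integral => t _.
  rewrite patchE; case: ifPn => // /negP; rewrite inE /= in_itv/= -ler_norml => Lt.
  by rewrite g0// => Lt'; apply: Lt; rewrite (le_trans Lt')// ltW.
have cf : continuous f.
  move=> t; apply: differentiable_continuous; apply/derivable1_diffP.
  exact: ex_derive.
rewrite (@continuous_FTC2 _ g f).
- rewrite !f0 ?subee//; apply/negP; rewrite -ltNge ?normrN gtr0_norm//.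
- by rewrite (lt_trans _ L'0)// oppr_lt0.
- exact: continuous_subspaceT.
- split => [t _||]; [exact: ex_derive| |].
  + by apply: cvg_at_right_filter; exact: cf.
  + by apply: cvg_at_left_filter; exact: cf.
- by move=> t _; rewrite derive1E; have [_] := df t.
Qed.

(** Induction on the dimension, peeling off the first coordinate: if i is that
coordinate the inner integral is one-dimensional and vanishes by the fundamental
theorem of calculus, otherwise it vanishes by the induction hypothesis. *)
Lemma integral_partial_eq0 n (i : 'I_n) L (f g : 'rV[R]_n -> R) :
  continuous g ->
  (forall x, is_derive x (delta_mx 0 i) f (g x)) ->
  (forall x, ~ cube n L x -> f x = 0) ->
  (\int[lebesgue_rV R n]_x (g x)%:E = 0)%E.
Proof.
elim: n i f g => [[]//|n IH i f g cg df f0].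
have g0 := derivative_eq0 df f0.
have ig := integrable_cube_continuous cg g0.
have mg : measurable_fun setT g.
  by apply: continuous_measurable_rV => [|x _]; [exact: openT|exact: cg].
have igc : (@lebesgue_measure R \x lebesgue_rV R n)%E.-integrable setT
    (EFin \o g \o @cons_rV R n).
  have mQ : measurable (`[- L, L]%classic `*` cube n L : set (measurableTypeR R * 'rV[R]_n)).
    by apply: measurableX => //; exact: measurable_cube.
  have -> : EFin \o g \o @cons_rV R n =
      (EFin \o (g \o @cons_rV R n)) \_ (`[- L, L]%classic `*` cube n L).
    apply/funext => p; rewrite patchE; case: ifPn => // /negP; rewrite inE => Lp.
    by rewrite /= g0//; move: Lp; rewrite -preimage_cons_cube.
  apply: (iffLR (integrable_mkcond _ mQ)).
  apply: measurable_bounded_integrable => //.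
  - by rewrite -preimage_cons_cube; exact: (lebesgue_cube_lty n.+1 L).
  - apply: (measurable_funS measurableT) => //.
    exact: measurableT_comp (@measurable_cons_rV R n).
  - have [K gK] := bounded_cube_continuous L cg.
    exists K; split; first exact: num_real.
    move=> M KM p; rewrite -preimage_cons_cube => Lp.
    exact: le_trans (gK _ Lp) (ltW KM).
rewrite integral_rVS//.
have shift_cons p u (h : R) :
    cons_rV (h *: p + u) = h *: cons_rV p + cons_rV u :> 'rV[R]_n.+1.
  by apply/rowP => k; rewrite !mxE; case: (unlift 0 k) => [k'|//]; rewrite !mxE.
(* The cases are a later coordinate, then the first one. *)
case: (unliftP 0 i) df => [j|] -> df.
  rewrite -(integral12_prod_meas1 igc) /fubini_F.
  rewrite (eq_integral (cst 0%E)) ?integral_cst ?mul0e// => t _.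
  apply: (IH j (fun y => f (cons_rV (t, y)))) => [y|y|y Ly].
  - apply: (@continuous_comp _ _ _ (fun y => @cons_rV R n (t, y)) g); last exact: cg.
    apply: continuous_rVP => k; rewrite mxE; under eq_fun do rewrite mxE.
    by case: (unlift 0 k) => [k'|] /=; [exact: (@coord_continuous R 1 n 0 k' y)|apply: (@cvg_cst R (t : R) _ (nbhs y))].
  - apply: (is_derive_affine (phi := fun y => @cons_rV R n (t, y))) (df _).
    move=> h; rewrite -[t in LHS]add0r -[0 in LHS](mulr0 h).
    rewrite (shift_cons (0, delta_mx 0 j) (t, y)); congr (h *: _ + _).
    apply/rowP => k; rewrite !mxE /=.
    case: unliftP => [k' ->|->]; rewrite ?mxE ?(inj_eq lift_inj)//.
  - by apply: f0 => /(_ (lift 0 _)) cy; apply: Ly => k; have := cy k; rewrite mxE liftK.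
rewrite -(integral21_prod_meas1 igc) /fubini_G.
rewrite (eq_integral (cst 0%E)) ?integral_cst ?mul0e// => y _.
apply: (integral_derivative_eq0 (f := fun t => f (cons_rV (t, y))) (L := L)) => [t|t|t Lt].
- apply: (@continuous_comp _ _ _ (fun t => @cons_rV R n (t, y)) g); last exact: cg.
  apply: continuous_rVP => k; rewrite mxE; under eq_fun do rewrite mxE.
  by case: (unlift 0 k) => [k'|] /=; [exact: cvg_cst|exact: cvg_id].
- apply: (is_derive_affine (phi := fun t => @cons_rV R n (t, y))) (df _).
  move=> h; rewrite -[y in LHS]add0r -[0 in LHS](scaler0 _ h).
  rewrite (shift_cons (1, 0) (t, y)); congr (h *: _ + _).
  apply/rowP => k; rewrite !mxE /=.
  by case: unliftP => [k' ->|->]; rewrite ?mxE//.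
- by apply: f0 => /(_ 0); rewrite mxE unlift_none.
Qed.

End compact_support.
Arguments cube {R} n L _.

(** * Functions of class C^1 on an open set *)

(** Chain rule for a directional derivative: along the line h |-> h v + x it is the
one-variable chain rule, so f need not be differentiable at x. *)
Lemma is_derive_comp_dir (R : realType) (V : normedModType R) (x v : V)
    (f : V -> R) (phi : R -> R) (a b : R) :
  is_derive x v f a -> is_derive (f x) (1 : R) phi b ->
  is_derive x v (phi \o f) (b * a).
Proof.
move=> df dphi; pose l (h : R) := h *: v + x.
have lE (h : R) : l (h *: (1 : R) + 0) = h *: v + l 0.
  by rewrite /l scale0r !add0r addr0 scaler1.
have l0 : l 0 = x by rewrite /l scale0r add0r.
have dfl : is_derive (0 : R) (1 : R) (f \o l) a.
  by apply: (is_derive_affine lE); rewrite l0.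
have := @is_derive1_comp R phi (f \o l) 0 b a.
rewrite /= l0 => /(_ dphi dfl) [dpl pl].
have E : (fun h : R => h^-1 *: (((phi \o (f \o l)) \o shift 0) (h *: (1 : R)) - (phi \o (f \o l)) 0))
  = (fun h : R => h^-1 *: (((phi \o f) \o shift x) (h *: v) - (phi \o f) x)).
  by apply/funext => h; rewrite /= /l !scale0r !add0r addr0 scaler1.
by split; [move: dpl; rewrite /derivable E|move: pl; rewrite /derive E].
Qed.

Lemma is_derive_coord (R : realType) n (i : 'I_n) (x v : 'rV[R]_n) :
  is_derive x v (fun y : 'rV[R]_n => y 0 i) (v 0 i).
Proof.
have L : (fun h : R => h^-1 *: (((fun y : 'rV[R]_n => y 0 i) \o shift x) (h *: v)
    - x 0 i)) @ 0^' --> v 0 i.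
  apply: cvg_near_cst; near=> h; rewrite /= !mxE addrK.
  have h0 : h != 0 by near: h; exact: nbhs_dnbhs_neq.
  by rewrite /GRing.scale /= mulrA mulVf// mul1r.
by split; [apply: cvgP L|apply: (cvg_lim _ L)].
Unshelve. all: by end_near. Qed.

Lemma near_eq_continuous (T U : topologicalType) (f g : T -> U) (x : T) :
  (\forall y \near x, f y = g y) -> {for x, continuous f} -> {for x, continuous g}.
Proof.
move=> fg cf; rewrite /prop_for /continuous_at -(nbhs_singleton fg).
exact: cvg_trans (near_eq_cvg fg) cf.
Qed.

Lemma continuous_atD (R : realType) (T : topologicalType) (f g : T -> R) (x : T) :
  {for x, continuous f} -> {for x, continuous g} ->
  {for x, continuous (fun y => f y + g y)}.
Proof. by move=> cf cg; exact: continuousD. Qed.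

Lemma continuous_atM (R : realType) (T : topologicalType) (f g : T -> R) (x : T) :
  {for x, continuous f} -> {for x, continuous g} ->
  {for x, continuous (fun y => f y * g y)}.
Proof. by move=> cf cg; exact: continuousM. Qed.

Section C1.
Context (R : realType) (d : nat).
Implicit Types (D : set 'rV[R]_d) (f g : 'rV[R]_d -> R).

(** Only derivatives along the basis vectors are required: this is what the
regularity of a solution provides, and all that integration by parts uses. *)
Definition C1 D f := forall x, D x -> {for x, continuous f} /\
  forall i, derivable f x (delta_mx 0 i) /\ {for x, continuous (partial i f)}.

Lemma C1_continuous D f x : C1 D f -> D x -> {for x, continuous f}.
Proof. by move=> cf /cf[]. Qed.

Lemma C1_partial D f i x : C1 D f -> D x -> is_derive x (delta_mx 0 i) f (partial i f x).
Proof. by move=> cf /cf[_ /(_ i)[]]. Qed.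

Lemma C1_continuous_partial D f i x : C1 D f -> D x ->
  {for x, continuous (partial i f)}.
Proof. by move=> cf /cf[_ /(_ i)[]]. Qed.

Lemma C1S D E f : D `<=` E -> C1 E f -> C1 D f.
Proof. by move=> DE cf x /DE; exact: cf. Qed.

Lemma C1_intro D f (df : 'I_d -> 'rV[R]_d -> R) : open D ->
  (forall x, D x -> {for x, continuous f}) ->
  (forall i x, D x -> is_derive x (delta_mx 0 i) f (df i x)) ->
  (forall i x, D x -> {for x, continuous (df i)}) -> C1 D f.
Proof.
move=> oD cf dfE cdf x Dx; split => [|i]; first exact: cf.
have pE y : D y -> partial i f y = df i y by move=> /(dfE i)[].
split; first by have [] := dfE i x Dx.
apply: near_eq_continuous (cdf i x Dx).
by have := open_nbhs_nbhs (conj oD Dx); apply: filterS => y /pE.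
Qed.

Lemma C1_cst D (c : R) : open D -> C1 D (cst c).
Proof.
move=> oD; apply: (@C1_intro _ _ (fun _ _ => 0)) => // [x _|i x _];
exact: cst_continuous.
Qed.

Lemma partial_add D f g i x : C1 D f -> C1 D g -> D x ->
  is_derive x (delta_mx 0 i) (fun y => f y + g y) (partial i f x + partial i g x).
Proof.
by move=> cf cg Dx; have h1 := C1_partial i cf Dx; have h2 := C1_partial i cg Dx;
   exact: is_deriveD.
Qed.

Lemma partial_mul D f g i x : C1 D f -> C1 D g -> D x ->
  is_derive x (delta_mx 0 i) (fun y => f y * g y)
    (f x * partial i g x + g x * partial i f x).
Proof.
by move=> cf cg Dx; have h1 := C1_partial i cf Dx; have h2 := C1_partial i cg Dx;
   exact: is_deriveM.
Qed.

Lemma partial_comp D f (phi dphi : R -> R) i x : C1 D f -> D x ->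
  is_derive (f x) (1 : R) phi (dphi (f x)) ->
  is_derive x (delta_mx 0 i) (fun y => phi (f y)) (dphi (f x) * partial i f x).
Proof.
by move=> cf Dx dp; apply: is_derive_comp_dir dp; exact: C1_partial Dx.
Qed.

Lemma C1_add D f g : open D -> C1 D f -> C1 D g -> C1 D (fun x => f x + g x).
Proof.
move=> oD cf cg; apply: (@C1_intro _ _ (fun i x => partial i f x + partial i g x)) => //.
- by move=> x Dx; apply: continuous_atD; apply: C1_continuous Dx.
- by move=> i x Dx; apply: partial_add Dx.
- by move=> i x Dx; apply: continuous_atD; apply: C1_continuous_partial Dx.
Qed.

Lemma C1_mul D f g : open D -> C1 D f -> C1 D g -> C1 D (fun x => f x * g x).
Proof.
move=> oD cf cg.
apply: (@C1_intro _ _ (fun i x => f x * partial i g x + g x * partial i f x)) => //.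
- by move=> x Dx; apply: continuous_atM; apply: C1_continuous Dx.
- by move=> i x Dx; apply: partial_mul Dx.
- move=> i x Dx; apply: continuous_atD; apply: continuous_atM.
  + exact: (C1_continuous cf Dx).
  + exact: (C1_continuous_partial cg Dx).
  + exact: (C1_continuous cg Dx).
  + exact: (C1_continuous_partial cf Dx).
Qed.

Lemma C1_comp D f (phi dphi : R -> R) : open D -> C1 D f ->
  (forall x, D x -> is_derive (f x) (1 : R) phi (dphi (f x))) ->
  (forall x, D x -> {for f x, continuous dphi}) -> C1 D (fun x => phi (f x)).
Proof.
move=> oD cf dp cdp.
apply: (@C1_intro _ _ (fun i x => dphi (f x) * partial i f x)) => //.
- move=> x Dx; apply: (@continuous_comp _ _ _ f phi); first exact: C1_continuous Dx.
  apply: differentiable_continuous; apply/derivable1_diffP.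
  by have [] := dp x Dx.
- by move=> i x Dx; exact: (partial_comp i cf Dx (dp x Dx)).
- move=> i x Dx; apply: continuous_atM; last exact: C1_continuous_partial Dx.
  by apply: (@continuous_comp _ _ _ f dphi); [exact: C1_continuous Dx|exact: cdp].
Qed.

Lemma C1_coord (i : 'I_d) : C1 setT (fun x : 'rV[R]_d => x 0 i).
Proof.
apply: (@C1_intro _ _ (fun j x => delta_mx 0 j 0 i)) => [|x _|j x _|j x _].
- exact: openT.
- exact: coord_continuous.
- exact: is_derive_coord.
- exact: cst_continuous.
Qed.

Lemma C1_prod (I : Type) (s : seq I) (F : I -> 'rV[R]_d -> R) D : open D ->
  (forall k, C1 D (F k)) -> C1 D (fun x => \prod_(k <- s) F k x).
Proof.
move=> oD cF; elim: s => [|k s IH].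
  by under eq_fun do rewrite big_nil; exact: C1_cst.
by under eq_fun do rewrite big_cons; exact: C1_mul.
Qed.

Lemma smooth_on_C1 U rho : smooth_on U rho -> C1 U rho.
Proof.
move=> srho x Ux; split => [|i].
  exact: differentiable_continuous (srho [::] x Ux).
split; first exact: diff_derivable (srho [::] x Ux).
exact: differentiable_continuous (srho [:: i] x Ux).
Qed.

(** Extension by zero. The hypothesis asks f to vanish on D near every point
outside D, including those of the boundary of D, so that both f and its
derivatives extend continuously. *)
Lemma C1_patch0 D f : open D -> C1 D f ->
  (forall x, ~ D x -> \forall y \near x, D y -> f y = 0) ->
  C1 setT (f \_ D) /\ forall i, partial i (f \_ D) = (partial i f) \_ D.
Proof.
move=> oD cf f0.
have inD x : D x -> (f \_ D) x = f x by move=> Dx; rewrite patchE mem_set.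
have near_inD x : D x -> \near x, f x = (f \_ D) x.
  by move=> Dx; have := open_nbhs_nbhs (conj oD Dx); apply: filterS => y /inD.
have near_out x : ~ D x -> \near x, 0 = (f \_ D) x.
  move=> Dx; have := f0 _ Dx; apply: filterS => y yD; rewrite patchE.
  by case: ifPn => // /set_mem /yD.
have dfD i x : is_derive x (delta_mx 0 i) (f \_ D) ((partial i f \_ D) x).
  rewrite patchE; case: ifPn => [/set_mem Dx|/negP Dx].
    by apply: near_eq_is_derive (C1_partial i cf Dx); exact: near_inD.
  apply: (@near_eq_is_derive _ _ _ (cst 0)).
  by apply: near_out; move: Dx; rewrite inE.
have pfD i : partial i (f \_ D) = partial i f \_ D.
  by apply/funext => x; have [] := dfD i x.
split; last exact: pfD.
have cD g : (forall x, D x -> {for x, continuous g}) ->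
    (forall x, ~ D x -> \near x, 0 = (g \_ D) x) -> continuous (g \_ D).
  move=> cg g0 x; have [Dx|Dx] := pselect (D x).
    apply: near_eq_continuous (cg x Dx).
    have := open_nbhs_nbhs (conj oD Dx); apply: filterS => y Dy.
    by rewrite patchE mem_set.
  by apply: near_eq_continuous (g0 _ Dx) _; exact: cst_continuous.
apply: (@C1_intro _ _ (fun i => partial i f \_ D)) => //.
- exact: openT.
- by move=> x _; apply: cD => // y; exact: C1_continuous.
- move=> i x _; apply: cD => [y|y Dy]; first exact: C1_continuous_partial.
  have := nbhs_interior (near_out _ Dy); apply: filterS => z z0.
  have [_ <-] := dfD i z.
  by rewrite -(near_eq_derive (f := cst 0)) ?derive_cst.
Qed.

End C1.

(** * Positive parts and smooth steps *)

Section cutoff.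
Context (R : realType).
Implicit Types (s t : R).

(** The difference quotient of s g(s) at 0 is g itself. This handles the functions
below that change formula at 0. *)
Lemma is_derive0_mul_id (g : R -> R) : {for 0, continuous g} ->
  is_derive (0 : R) (1 : R) (fun s => s * g s) (g 0).
Proof.
move=> cg.
have L : (fun h : R => h^-1 *: (((fun s => s * g s) \o shift 0) (h *: (1 : R))
    - 0 * g 0)) @ 0^' --> g 0.
  apply: cvg_trans (cvg_trans (cvg_app g (@nbhs_dnbhs R 0)) cg).
  apply: near_eq_cvg; near=> h; rewrite /= addr0 mul0r subr0 /GRing.scale /= mulr1.
  by rewrite mulKf//; near: h; exact: nbhs_dnbhs_neq.
by split; [apply: cvgP L|apply: (cvg_lim _ L)].
Unshelve. all: by end_near. Qed.

Definition pos s : R := Num.max s 0.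

Lemma pos_ge0 s : 0 <= pos s. Proof. by rewrite /pos le_max lexx orbT. Qed.

Lemma pos_id s : 0 <= s -> pos s = s. Proof. by move=> s0; rewrite /pos max_l. Qed.

Lemma pos_eq0 s : s <= 0 -> pos s = 0. Proof. by move=> s0; rewrite /pos max_r. Qed.

Lemma continuous_pos : continuous pos.
Proof. by move=> s; apply: continuous_max; [exact: cvg_id|exact: cvg_cst]. Qed.

Lemma is_derive_posX n s :
  is_derive s (1 : R) (fun t => pos t ^+ n.+2) (n.+2%:R * pos s ^+ n.+1).
Proof.
have [s0|s0|->] := ltgtP s 0.
- rewrite pos_eq0 1?ltW// expr0n /= mulr0.
  apply: (@near_eq_is_derive _ _ _ (cst 0)).
  have := lt_nbhsl s0; apply: filterS => t /= t0.
  by rewrite pos_eq0 1?ltW// expr0n.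
- rewrite pos_id 1?ltW//.
  apply: (@near_eq_is_derive _ _ _ (fun t => t ^+ n.+2)).
    have := lt_nbhsr s0; apply: filterS => t /= t0.
    by rewrite pos_id 1?ltW.
  have := @is_deriveX _ _ (id : R -> R) n.+2 s 1 1 (is_derive_id _ _).
  by rewrite exprfctE /GRing.scale /= mulr1.
- have := @is_derive0_mul_id (fun t => pos t ^+ n.+1).
  rewrite pos_eq0// expr0n /= mulr0 => h.
  apply: (@near_eq_is_derive _ _ _ (fun s => s * pos s ^+ n.+1)).
    near=> t; rewrite [RHS]exprS; have [t0|t0] := leP 0 t; first by rewrite pos_id.
    by rewrite pos_eq0 1?ltW// expr0n /= !mulr0.
  apply: h; apply: (@continuous_comp _ _ _ pos (fun x : R => x ^+ n.+1)).
    exact: continuous_pos.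
  exact: exprn_continuous.
Unshelve. all: by end_near. Qed.

(** A C^1 transition from 0 on s <= 0 to 1 on s >= 1, made of two parabolas; its
derivative is a tent, hence nonnegative. *)
Definition step s : R :=
  2 * pos s ^+ 2 - 4 * pos (s - 2^-1) ^+ 2 + 2 * pos (s - 1) ^+ 2.

Definition dstep s : R :=
  4 * pos s - 8 * pos (s - 2^-1) + 4 * pos (s - 1).

Lemma posP s : (0 <= s /\ pos s = s) \/ (s <= 0 /\ pos s = 0).
Proof.
have [s0|s0] := leP 0 s; first by left; rewrite pos_id.
by right; rewrite pos_eq0// ltW.
Qed.

Lemma step_eq0 s : s <= 0 -> step s = 0.
Proof.
move=> s0; rewrite /step; case: (posP s) => -[h1 ->];
case: (posP (s - 2^-1)) => -[h2 ->]; case: (posP (s - 1)) => -[h3 ->]; nra.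
Qed.

Lemma step_eq1 s : 1 <= s -> step s = 1.
Proof.
move=> s0; rewrite /step; case: (posP s) => -[h1 ->];
case: (posP (s - 2^-1)) => -[h2 ->]; case: (posP (s - 1)) => -[h3 ->]; nra.
Qed.

Lemma step_ge0 s : 0 <= step s.
Proof.
rewrite /step; case: (posP s) => -[h1 ->];
case: (posP (s - 2^-1)) => -[h2 ->]; case: (posP (s - 1)) => -[h3 ->]; nra.
Qed.

Lemma step_le1 s : step s <= 1.
Proof.
rewrite /step; case: (posP s) => -[h1 ->];
case: (posP (s - 2^-1)) => -[h2 ->]; case: (posP (s - 1)) => -[h3 ->]; nra.
Qed.

Lemma dstep_ge0 s : 0 <= dstep s.
Proof.
rewrite /dstep; case: (posP s) => -[h1 ->];
case: (posP (s - 2^-1)) => -[h2 ->]; case: (posP (s - 1)) => -[h3 ->]; lra.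
Qed.

Lemma dstep_eq0 s : 1 <= s -> dstep s = 0.
Proof.
move=> s0; rewrite /dstep; case: (posP s) => -[h1 ->];
case: (posP (s - 2^-1)) => -[h2 ->]; case: (posP (s - 1)) => -[h3 ->]; lra.
Qed.

Lemma continuous_pos_shift a : continuous (fun s => pos (s - a)).
Proof.
move=> s; apply: (@continuous_comp _ _ _ (fun s => s - a) pos).
  by apply: cvgB; [exact: cvg_id|exact: cvg_cst].
exact: continuous_pos.
Qed.

Lemma continuous_dstep : continuous dstep.
Proof.
move=> s; apply: cvgD; first apply: cvgB.
- by apply: cvgMr; exact: continuous_pos.
- by apply: cvgMr; exact: continuous_pos_shift.
- by apply: cvgMr; exact: continuous_pos_shift.
Qed.

Lemma is_derive_affine_comp (f : R -> R) (c a l s : R) :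
  is_derive (c * s + a) (1 : R) f l -> is_derive s (1 : R) (fun t => f (c * t + a)) (l * c).
Proof.
move=> df; apply: (@is_derive1_comp _ f (fun t => c * t + a)).
have := is_deriveD (is_deriveZ c (is_derive_id s (1 : R))) (is_derive_cst a s (1 : R)).
by rewrite addr0 /GRing.scale /= mulr1.
Qed.

Lemma is_derive_step s : is_derive s (1 : R) step (dstep s).
Proof.
have h a : is_derive s (1 : R) (fun t => pos (t - a) ^+ 2) (2 * pos (s - a)).
  have := @is_derive_affine_comp (fun t => pos t ^+ 2) 1 (- a) (2 * pos (s - a)) s.
  rewrite mulr1 mul1r => /(_ (is_derive_posX 0 _)).
  by under eq_fun do rewrite mul1r.
have h0 := h 0; rewrite subr0 in h0.
have h1 : is_derive s (1 : R) (fun t => pos t ^+ 2) (2 * pos s).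
  exact: is_derive_posX.
have h2 := h 2^-1; have h3 := h 1.
have := is_deriveD (is_deriveB (is_deriveZ 2 h1) (is_deriveZ 4 h2)) (is_deriveZ 2 h3).
rewrite /GRing.scale /=.
set u := (X in is_derive _ _ _ X); suff -> : u = dstep s by [].
by rewrite /u /dstep; ring.
Qed.

End cutoff.

(** * Plateau functions *)

Lemma patch_EFin (R : realType) (T : Type) (D : set T) (f : T -> R) :
  EFin \o (f \_ D) = (EFin \o f) \_ D.
Proof. by apply/funext => x; rewrite /= !patchE; case: ifP. Qed.

Section plateau.
Context (R : realType) (d : nat).
Implicit Types (D : set 'rV[R]_d) (f g : 'rV[R]_d -> R).

(** Functions vanishing near the boundary of D reduce to compactly supported ones
by extension by zero. *)
Lemma C1_integral_eq0 D (L : R) f : open D -> D `<=` cube d L -> C1 D f ->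
  (forall x, ~ D x -> \forall y \near x, D y -> f y = 0) ->
  forall i, (lebesgue_rV R d).-integrable D (EFin \o partial i f) /\
    \int[lebesgue_rV R d]_(x in D) partial i f x = 0.
Proof.
move=> oD DL cf f0 i; have [cfD pfD] := C1_patch0 oD cf f0.
have mD := open_measurable_rV oD.
have fD0 x : ~ cube d L x -> (f \_ D) x = 0.
  by move=> Lx; rewrite patchE memNset// => /DL.
have dfD x : is_derive x (delta_mx 0 i) (f \_ D) (partial i (f \_ D) x).
  exact: (C1_partial i cfD).
have cpf : continuous (partial i (f \_ D)).
  by move=> x; exact: (C1_continuous_partial cfD).
split.
  apply: (iffRL (integrable_mkcond _ mD)); rewrite -patch_EFin -pfD.
  by apply: (integrable_cube_continuous cpf); exact: derivative_eq0 dfD fD0.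
rewrite /Rintegral integral_mkcond -patch_EFin -pfD.
by rewrite (integral_partial_eq0 cpf dfD fD0).
Qed.

Lemma is_derive_step_affine (c a s : R) :
  is_derive s (1 : R) (fun t => step (c * t + a)) (dstep (c * s + a) * c).
Proof. by apply: is_derive_affine_comp; exact: is_derive_step. Qed.

Lemma partial_step_affine D f (c a : R) i x : C1 D f -> D x ->
  is_derive x (delta_mx 0 i) (fun y => step (c * f y + a))
    (dstep (c * f x + a) * c * partial i f x).
Proof.
move=> cf Dx.
apply: (@partial_comp _ _ D f (fun t => step (c * t + a)) (fun t => dstep (c * t + a) * c)) => //.
exact: is_derive_step_affine.
Qed.

Lemma C1_step_affine D f (c a : R) : open D -> C1 D f ->
  C1 D (fun y => step (c * f y + a)).
Proof.
move=> oD cf.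
apply: (@C1_comp _ _ D f (fun t => step (c * t + a)) (fun t => dstep (c * t + a) * c)) => //.
  by move=> x _; exact: is_derive_step_affine.
move=> x _; apply: continuous_atM; last exact: cst_continuous.
apply: (@continuous_comp _ _ _ (fun t => c * t + a) (@dstep R)).
  by apply: continuous_atD; [apply: mulrl_continuous|exact: cst_continuous].
exact: continuous_dstep.
Qed.

(** Balls are cubes for the sup norm, so a product of one-dimensional steps equals
1 on the ball of radius r and 0 outside the ball of radius 2 r. *)
Definition plateau (x0 : 'rV[R]_d) (r : R) (x : 'rV[R]_d) : R :=
  \prod_i (step (- r^-1 * x 0 i + (2 + x0 0 i / r)) *
           step (r^-1 * x 0 i + (2 - x0 0 i / r))).

Lemma C1_plateau x0 r : C1 setT (plateau x0 r).
Proof.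
apply: C1_prod => [|i]; first exact: openT.
by apply: C1_mul; [exact: openT| |]; apply: C1_step_affine; try exact: openT;
  exact: C1_coord.
Qed.

Lemma plateau_ge0 x0 r x : 0 <= plateau x0 r x.
Proof. by apply: prodr_ge0 => i _; apply: mulr_ge0; exact: step_ge0. Qed.

Lemma plateau_le1 x0 r x : plateau x0 r x <= 1.
Proof.
apply: prodr_ile1 => i _; apply/andP; split.
  by apply: mulr_ge0; exact: step_ge0.
by apply: mulr_ile1; by [exact: step_ge0|exact: step_le1].
Qed.

Lemma plateau_eq1 x0 r x : ball x0 r x -> plateau x0 r x = 1.
Proof.
move=> [r0 x0x]; apply: big1 => i _.
have := x0x 0 i; rewrite /ball /= ltr_norml => /andP[h1 h2].
have E1 : - r^-1 * x 0 i + (2 + x0 0 i / r) = (2 * r + (x0 0 i - x 0 i)) / r.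
  by field; rewrite gt_eqF.
have E2 : r^-1 * x 0 i + (2 - x0 0 i / r) = (2 * r - (x0 0 i - x 0 i)) / r.
  by field; rewrite gt_eqF.
rewrite E1 E2 !step_eq1 ?mulr1//; rewrite ler_pdivlMr//; lra.
Qed.

Lemma plateau_eq0 x0 r x : 0 < r -> ~ ball x0 (2 * r) x -> plateau x0 r x = 0.
Proof.
move=> r0 Bx.
have /existsNP[i /negP] : ~ (forall i, `|x0 0 i - x 0 i| < 2 * r).
  move=> h; apply: Bx; split; first by rewrite mulr_gt0.
  by move=> k i; rewrite (ord1 k); exact: h.
rewrite -leNgt => xi.
rewrite /plateau (bigD1 i)//=.
have E1 : - r^-1 * x 0 i + (2 + x0 0 i / r) = (2 * r + (x0 0 i - x 0 i)) / r.
  by field; rewrite gt_eqF.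
have E2 : r^-1 * x 0 i + (2 - x0 0 i / r) = (2 * r - (x0 0 i - x 0 i)) / r.
  by field; rewrite gt_eqF.
rewrite E1 E2; move: xi; rewrite ler_normr => /orP[h|h].
  by rewrite [X in _ * X * _]step_eq0 ?mulr0 ?mul0r// ler_pdivrMr// mul0r; lra.
by rewrite step_eq0 ?mul0r// ler_pdivrMr// mul0r; lra.
Qed.

Lemma ball_sub_cube (x0 : 'rV[R]_d) (r : R) : ball x0 r `<=` cube d (`|x0| + r).
Proof.
move=> x [r0 x0x] i; have := x0x 0 i; rewrite /ball /= => h.
rewrite -[x 0 i](subKr (x0 0 i)) (le_trans (ler_normB _ _))//.
rewrite lerD//; last exact: ltW.
have -> : `|x0| = mx_norm x0 by [].
rewrite mx_normrE; apply/bigmax_geP; right => /=.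
by exists (0, i).
Qed.

(** The partial derivatives are continuous and vanish outside a cube. *)
Lemma plateau_partial_bounded x0 r : 0 < r ->
  exists K, forall i x, `|partial i (plateau x0 r) x| <= K.
Proof.
move=> r0; pose L := `|x0| + 2 * r.
have b0 x : ~ cube d L x -> plateau x0 r x = 0.
  by move=> Lx; apply: plateau_eq0 => // /ball_sub_cube.
have /choice[K bK] i : exists K, forall x, `|partial i (plateau x0 r) x| <= K.
  have [|K bK] := @bounded_cube_continuous R d L (partial i (plateau x0 r)).
    by move=> x; exact: (C1_continuous_partial (C1_plateau _ _)).
  exists (Num.max K 0) => x; rewrite le_max; have [/bK->//|Lx] := pselect (cube d L x).
  have dbE y : is_derive y (delta_mx 0 i) (plateau x0 r) (partial i (plateau x0 r) y).
    by apply: (C1_partial i (@C1_plateau x0 r)).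
  by rewrite (derivative_eq0 dbE b0 Lx) normr0 lexx orbT.
exists (\sum_i `|K i|) => i x; rewrite (le_trans (bK i x))//.
rewrite (bigD1 i)//= (le_trans (ler_norm _))// lerDl.
exact: sumr_ge0.
Qed.

End plateau.

(** * Vector fields tangent to the boundary *)

Lemma continuous_at_sum (R : realType) (T : topologicalType) (I : Type)
    (s : seq I) (f : I -> T -> R) (x : T) :
  (forall k, {for x, continuous (f k)}) ->
  {for x, continuous (fun y => \sum_(k <- s) f k y)}.
Proof.
move=> cf; elim: s => [|k s IH].
  rewrite (_ : (fun y => _) = cst 0); first exact: cst_continuous.
  by apply/funext => y; rewrite big_nil.
rewrite (_ : (fun y => _) = fun y => f k y + \sum_(k <- s) f k y).
  exact: continuous_atD.
by apply/funext => y; rewrite big_cons.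
Qed.

(** Used for boundary fluxes: the first factor is bounded but need not converge at
the boundary. *)
Lemma cvg_mul_bounded0 (R : realType) (T : Type) (F : set_system T) (FF : Filter F)
    (f u : T -> R) (K : R) :
  (\near F, `|f F| <= K) -> u @ F --> (0 : R) -> (fun y => f y * u y) @ F --> (0 : R).
Proof.
move=> fK u0; apply/norm_cvg0P.
apply: (@squeeze_cvgr _ _ _ _ (cst 0) (fun y => K * `|u y|)).
- near=> y; rewrite normr_ge0 /= normrM ler_wpM2r//.
  by near: y.
- exact: cvg_cst.
- by rewrite -[X in _ --> X](mulr0 K); apply: cvgMr; apply/norm_cvg0P.
Unshelve. all: by end_near. Qed.

Lemma cvg_sum0 (R : realType) (T I : Type) (F : set_system T) (FF : Filter F)
    (s : seq I) (f : I -> T -> R) :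
  (forall k, f k @ F --> (0 : R)) -> (fun y => \sum_(k <- s) f k y) @ F --> (0 : R).
Proof.
move=> f0; elim: s => [|k s IH].
  by under eq_fun do rewrite big_nil; exact: cvg_cst.
under eq_fun do rewrite big_cons.
by have := cvgD (f0 k) IH; rewrite addr0; exact.
Qed.

Section divergence_theorem.
Context (R : realType) (d : nat).
Implicit Types (D Omega : set 'rV[R]_d) (f : 'rV[R]_d -> R).
Implicit Types (F : 'I_d -> 'rV[R]_d -> R).

Let mu : {sigma_finite_measure set 'rV[R]_d -> \bar R} := lebesgue_rV R d.

Lemma integrable_bounded_continuous D (L K : R) f :
  open D -> D `<=` cube d L -> (forall x, D x -> {for x, continuous f}) ->
  (forall x, D x -> `|f x| <= K) -> mu.-integrable D (EFin \o f).
Proof.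
move=> oD DL cf fK; have mD := open_measurable_rV oD.
apply: measurable_bounded_integrable => //.
- exact: measurable_bounded_lty mD DL.
- exact: continuous_measurable_rV.
- exists K; split; first exact: num_real.
  by move=> M KM x Dx; exact: le_trans (fK _ Dx) (ltW KM).
Qed.

Definition divergence F x := \sum_j partial j (F j) x.

(** The fields to which the divergence theorem applies. The boundary condition is a
limit from inside because the field is not defined on the boundary; the field
itself need not have a limit there. *)
Definition tangential Omega F : Prop :=
  [/\ (forall j, C1 Omega (F j)),
      (exists K, forall j x, Omega x -> `|F j x| <= K /\ `|partial j (F j) x| <= K) &
      (forall x n, boundary Omega x -> outer_unit_normal Omega x n ->
         (fun y => \sum_j F j y * n 0 j) @ within Omega (nbhs x) --> (0 : R))].

(** Localisation: the normal component of psi F is psi times that of F. *)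
Lemma tangential_scale Omega F (psi : 'rV[R]_d -> R) (K : R) : open Omega ->
  C1 setT psi -> (forall x, `|psi x| <= K) -> (forall i x, `|partial i psi x| <= K) ->
  tangential Omega F -> tangential Omega (fun j x => psi x * F j x).
Proof.
move=> oO cpsi psiK dpsiK [cF [M FM] flux].
have cpsiO : C1 Omega psi by apply: C1S cpsi.
split.
- by move=> j; exact: C1_mul.
- have K0 : 0 <= K by rewrite (le_trans _ (psiK 0)).
  exists (K * M + M * K) => j x Ox; have [FjM dFjM] := FM j _ Ox.
  have M0 : 0 <= M by rewrite (le_trans _ FjM).
  split.
    rewrite normrM (@le_trans _ _ (K * M))//.
      by rewrite ler_pM.
    by rewrite lerDl mulr_ge0// K0.
  have [_ pE] := partial_mul j cpsiO (cF j) Ox.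
  rewrite /partial pE (le_trans (ler_normD _ _))// !normrM lerD//; by rewrite ler_pM.
- move=> x n bx nx.
  under eq_fun do (under eq_bigr do rewrite -mulrA; rewrite -mulr_sumr).
  have cpsix : psi @ within Omega (nbhs x) --> psi x.
    by apply: cvg_within_filter; exact: (C1_continuous cpsi).
  by have := cvgM cpsix (flux x n bx nx); rewrite mulr0; exact.
Qed.

Lemma continuous_divergence Omega F x : tangential Omega F -> Omega x ->
  {for x, continuous (divergence F)}.
Proof.
move=> [cF _ _] Ox; apply: continuous_at_sum => j.
exact: (C1_continuous_partial (cF j)).
Qed.

Lemma bounded_divergence Omega F : tangential Omega F ->
  exists K, forall x, Omega x -> `|divergence F x| <= K.
Proof.
move=> [_ [K FK] _]; exists (\sum_(j < d) K) => x Ox.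
rewrite (le_trans (ler_norm_sum _ _ _))//; apply: ler_sum => j _.
by have [] := FK j x Ox.
Qed.

Lemma integrable_divergence Omega L F : open Omega -> Omega `<=` cube d L ->
  tangential Omega F -> mu.-integrable Omega (EFin \o divergence F).
Proof.
move=> oO OL tF; have [K FK] := bounded_divergence tF.
apply: (@integrable_bounded_continuous _ L K) => // x Ox.
exact: continuous_divergence Ox.
Qed.

(** Where F vanishes nearby its divergence is zero. *)
Lemma divergence_localize Omega F D : open Omega ->
  (forall j x, Omega x -> ~ D x -> \forall y \near x, Omega y -> F j y = 0) ->
  \int[mu]_(x in Omega) divergence F x = \int[mu]_(x in Omega `&` D) divergence F x.
Proof.
move=> oO F0; rewrite [RHS]Rintegral_mkcondr.
apply: eq_Rintegral => x /set_mem Ox; rewrite patchE; case: ifPn => // /negP Dx.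
apply: big1 => j _; rewrite /partial (near_eq_derive (g := cst 0)) ?derive_cst//.
have Oxn := open_nbhs_nbhs (conj oO Ox).
have Fx0 : \forall y \near x, Omega y -> F j y = 0.
  by apply: F0 => //; move: Dx; rewrite inE.
by apply: filterS2 Oxn Fx0 => y Oy; exact.
Qed.

Lemma ball_far (x0 x : 'rV[R]_d) (r s : R) : 0 < r -> 0 < s ->
  ~ ball x0 (r + s) x -> \forall y \near x, ~ ball x0 r y.
Proof.
move=> r0 s0 xr; have := nbhsx_ballx x s s0; apply: filterS => y xy x0y.
by apply: xr; apply: ball_triangle x0y _; exact: ball_sym.
Qed.

Lemma norm2_eq0 (a : 'rV[R]_d) : norm2 a = 0 -> a = 0.
Proof.
move=> /eqP; rewrite sqrtr_eq0 => a0.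
have /eqP : dot a a = 0.
  by apply/eqP; rewrite eq_le a0 sumr_ge0// => i _; rewrite -expr2 sqr_ge0.
rewrite psumr_eq0 => [/allP ai0|i _]; last by rewrite -expr2 sqr_ge0.
apply/rowP => i; rewrite mxE; apply/eqP.
by have := ai0 i (mem_index_enum _); rewrite /= mulf_eq0 orbb.
Qed.

Section near_boundary.
Variables (Omega U : set 'rV[R]_d) (rho : 'rV[R]_d -> R).
Hypothesis defrho : defining_function Omega U rho.

Let C1rho : C1 U rho. Proof. by apply: smooth_on_C1; case: defrho. Qed.

(** The hypothesis concerns the normal frozen at x. Replacing it by the gradient of
rho at the moving point y costs F(y) . (grad rho(y) - grad rho(x)), a bounded
factor times one tending to zero. *)
Lemma flux_rho_cvg0 F x : tangential Omega F -> boundary Omega x -> U x ->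
  (fun y => \sum_j F j y * partial j rho y) @ within Omega (nbhs x) --> (0 : R).
Proof.
move=> [cF [K FK] flux] bx Ux.
have [oU _ grad0 _] := defrho.
pose N := norm2 (grad rho x).
have N0 : N != 0 by apply/negP => /eqP /norm2_eq0 /eqP; exact/negP/grad0.
have nx : outer_unit_normal Omega x (N^-1 *: grad rho x) by exists U, rho.
have h1 := flux x _ bx nx.
have h2 j : (fun y => F j y * (partial j rho y - partial j rho x))
    @ within Omega (nbhs x) --> (0 : R).
  apply: (@cvg_mul_bounded0 _ _ _ _ _ _ K).
    by apply: filterS (withinT Omega _) => y Oy; have [] := FK j y Oy.
  have : {for x, continuous (fun y => partial j rho y - partial j rho x)}.
    by apply: continuous_atD; [exact: (C1_continuous_partial C1rho)|exact: cst_continuous].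
  rewrite /prop_for /continuous_at.
  by rewrite subrr => h; exact: cvg_within_filter.
have h3 : (fun y => \sum_j F j y * (partial j rho y - partial j rho x))
    @ within Omega (nbhs x) --> (0 : R).
  exact: cvg_sum0.
have h4 := cvgD (cvgM (@cvg_cst _ N _ (within Omega (nbhs x)) _) h1) h3.
rewrite (_ : (fun y => _) = (cst N * (fun y => \sum_j F j y * (N^-1 *: grad rho x) 0 j))
    + (fun y => \sum_j F j y * (partial j rho y - partial j rho x))).
  by rewrite mulr0 addr0 in h4; apply: h4.
apply/funext => y; symmetry.
transitivity (\sum_j F j y * partial j rho x + \sum_j F j y * (partial j rho y - partial j rho x)).
  congr (_ + _).
  transitivity (N * \sum_j F j y * (N^-1 *: grad rho x) 0 j) => //.
  rewrite mulr_sumr; apply: eq_bigr => j _; rewrite !mxE.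
  by rewrite mulrCA mulVKf.
by rewrite -big_split/=; apply: eq_bigr => j _; rewrite mulrBr addrCA subrr addr0.
Qed.

(** The normal flux is small near each boundary point; compactness makes this
uniform on a thin layer. Interior points do not meet the layer for n large, and
points off the closure have neighbourhoods that do not meet Omega. *)
Lemma flux_layer F x0 (r delta : R) : tangential Omega F -> 0 < delta -> 0 < r ->
  ball x0 (2 * r) `<=` U ->
  \forall n \near \oo, forall x, Omega x -> ball x0 r x -> - rho x < 2 / n.+1%:R ->
    `|\sum_j F j x * partial j rho x| <= delta.
Proof.
move=> tF delta0 r0 BU.
have [oU _ _ Orho] := defrho.
pose K : set 'rV[R]_d := [set y | forall i, `[x0 0 i - r, x0 0 i + r]%classic (y ord0 i)].
have cK : compact K.
  by apply: (@rV_compact _ _ (fun i => `[x0 0 i - r, x0 0 i + r]%classic)) => i; exact: segment_compact.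
have KU : K `<=` U.
  move=> y Ky; apply: BU; split; first by rewrite mulr_gt0.
  move=> k i; rewrite (ord1 k) /ball /=; have := Ky i; rewrite /= in_itv/= => /andP[h1 h2].
  by rewrite ltr_norml; apply/andP; split; lra.
have BK : ball x0 r `<=` K.
  move=> y [_ x0y] i; have := x0y 0 i; rewrite /ball /= ltr_norml => /andP[h1 h2].
  by rewrite in_itv/=; apply/andP; split; lra.
pose P (n : nat) (x : 'rV[R]_d) := Omega x -> - rho x < 2 / n.+1%:R ->
    `|\sum_j F j x * partial j rho x| <= delta.
have : \forall n \near \oo, K `<=` P n.
  apply: (iffLR (compact_near_coveringP K) cK) => x Kx.
  have Ux := KU _ Kx.
  have [Ox|nOx] := pselect (Omega x).
    have rx0 : rho x < 0 by rewrite -Orho.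
    have nr : \forall y \near x, rho y < rho x / 2.
      have : rho x < rho x / 2 by lra.
      by have /cvgr_lt := C1_continuous C1rho Ux; apply.
    have nn : \forall n \near \oo, 2 / n.+1%:R < - rho x / 2 :> R.
      have e0 : 0 < - rho x / 4 by lra.
      have := near_infty_natSinv_lt (PosNum e0); apply: filterS => n /= ne.
      move: ne; set u := n.+1%:R^-1 => ne; lra.
    exists ([set y | rho y < rho x / 2], [set n | 2 / n.+1%:R < - rho x / 2 :> R]) => //=.
    move=> [y n] /= [h1 h2] _ h3; exfalso.
    suff : - rho y < - rho y by rewrite ltxx.
    by apply: lt_trans (lt_trans h3 h2) _; lra.
  have [cx|ncx] := pselect (closure Omega x); last first.
    have : \forall y \near x, ~ Omega y.
      have /open_nbhs_nbhs : open_nbhs x (~` closure Omega).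
        by split => //; exact/closed_openC/closed_closure.
      by apply: filterS => y ny /subset_closure.
    move=> nO; exists ([set y | ~ Omega y], setT) => //=.
      by split => //; exact: filterT.
    by move=> [y n] /= [nOy _] /nOy.
  have bx : boundary Omega x by split => // /interior_subset.
  have /cvgr0Pnorm_le /(_ _ delta0) nl := flux_rho_cvg0 tF bx Ux.
  exists ([set y | Omega y -> `|\sum_j F j y * partial j rho y| <= delta], setT) => //=.
    by split => //; exact: filterT.
  by move=> [y n] /= [h _] /h.
by apply: filterS => n KP x Ox Bx; apply: KP => //; exact: BK.
Qed.

End near_boundary.

End divergence_theorem.

(** * The divergence theorem near a point *)

Lemma Rintegral_sum_eq0 (R : realType) dT (T : measurableType dT)
    (mu : {measure set T -> \bar R}) (D : set T) (I : Type) (s : seq I)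
    (f : I -> T -> R) : measurable D ->
  (forall k, mu.-integrable D (EFin \o f k) /\ \int[mu]_(x in D) f k x = 0) ->
  mu.-integrable D (EFin \o (fun x => \sum_(k <- s) f k x)) /\
  \int[mu]_(x in D) (\sum_(k <- s) f k x) = 0.
Proof.
move=> mD f0; elim: s => [|k s [IHi IH0]].
  under eq_fun do rewrite big_nil; split.
    exact: integrable0.
  by rewrite Rintegral_cst// mul0r.
have [fki fk0] := f0 k.
under eq_fun do rewrite big_cons; split.
  by apply: eq_integrable (integrableD mD fki IHi) => // x _.
by rewrite RintegralD// fk0 IH0 addr0.
Qed.

Lemma normr_Rintegral_le (R : realType) dT (T : measurableType dT)
    (mu : {measure set T -> \bar R}) (D : set T) (f g : T -> R) : measurable D ->
  mu.-integrable D (EFin \o f) -> mu.-integrable D (EFin \o g) ->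
  (forall x, D x -> `|f x| <= g x) ->
  `|\int[mu]_(x in D) f x| <= \int[mu]_(x in D) g x.
Proof.
move=> mD fi gi fg; rewrite ler_norml; apply/andP; split; last first.
  by apply: le_Rintegral => // x /fg; rewrite ler_norml => /andP[].
rewrite lerNl -mulN1r -RintegralZl//.
apply: le_Rintegral => //.
  by apply: eq_integrable (integrableZl mD (-1) fi) => // x _.
by move=> x /fg; rewrite ler_norml mulN1r lerNl => /andP[].
Qed.

Section local.
Context (R : realType) (d : nat).
Implicit Types (D Omega : set 'rV[R]_d) (f : 'rV[R]_d -> R).
Implicit Types (F : 'I_d -> 'rV[R]_d -> R).

Let mu : {sigma_finite_measure set 'rV[R]_d -> \bar R} := lebesgue_rV R d.

(** A field supported well inside Omega has no boundary to see. The margins between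
2 r, 4 r and 8 r leave room for every point where the field need not vanish to be
away from the sphere of radius 8 r. *)
Lemma divergence_interior Omega L F x0 r : open Omega -> Omega `<=` cube d L ->
  tangential Omega F -> 0 < r -> ball x0 (8 * r) `<=` Omega ->
  (forall j x, Omega x -> ~ ball x0 (2 * r) x -> F j x = 0) ->
  \int[mu]_(x in Omega) divergence F x = 0.
Proof.
move=> oO OL tF r0 BO F0; have [cF _ _] := tF.
pose D := Omega `&` ball x0 (8 * r).
have oD : open D by apply: openI => //; exact: ball_open.
have Fout j x : ~ ball x0 (8 * r) x -> \forall y \near x, Omega y -> F j y = 0.
  have -> : 8 * r = 4 * r + 4 * r by ring.
  move=> /ball_far h; have : \forall y \near x, ~ ball x0 (4 * r) y.
    by apply: h; rewrite mulr_gt0.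
  apply: filterS => y yn Oy; apply: F0 => // yb; apply: yn.
  by apply: le_ball yb; rewrite ler_pM2r// ler_nat.
rewrite (@divergence_localize _ _ _ _ (ball x0 (8 * r)))//; last first.
  by move=> j x _ xB; exact: Fout.
have [|_ ->//] := @Rintegral_sum_eq0 R _ _ mu D 'I_d (index_enum 'I_d)
    (fun j => partial j (F j)) (open_measurable_rV oD).
move=> j; apply: (C1_integral_eq0 (L := L) oD).
- by move=> x [/OL].
- by apply: C1S (cF j) => x [].
- move=> x Dx; have nB : ~ ball x0 (8 * r) x.
    by move=> xB; apply: Dx; split => //; exact: BO.
  by have := Fout j _ nB; apply: filterS => y h [/h].
Qed.

Section boundary_chart.
Variables (Omega U : set 'rV[R]_d) (rho : 'rV[R]_d -> R) (L : R).
Variables (x0 : 'rV[R]_d) (r : R) (i : 'I_d) (s c : R).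
Hypothesis oO : open Omega.
Hypothesis OL : Omega `<=` cube d L.
Hypothesis defrho : defining_function Omega U rho.
Hypothesis r0 : 0 < r.
Hypothesis BU : ball x0 (8 * r) `<=` U.
Hypothesis c0 : 0 < c.
Hypothesis s1 : `|s| = 1.
Hypothesis crho : forall x, ball x0 (8 * r) x -> c <= s * partial i rho x.

Let D := Omega `&` ball x0 (8 * r).

Let oD : open D. Proof. by apply: openI => //; exact: ball_open. Qed.

Let mD : measurable D. Proof. exact: open_measurable_rV. Qed.

Let DL : D `<=` cube d L. Proof. by move=> x [/OL]. Qed.

Let C1rho : C1 D rho.
Proof.
have [_ srho _ _] := defrho; apply: C1S (smooth_on_C1 srho).
by move=> x [_ /BU].
Qed.

Let rho_lt0 x : D x -> rho x < 0.
Proof. by have [_ _ _ Orho] := defrho; move=> [Ox /BU Ux]; apply/Orho. Qed.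

(** Equal to 1 where - rho >= 2/(n+1) and to 0 where - rho <= 1/(n+1); the shift by
1 makes the cutoff vanish in a neighbourhood of the boundary, not merely on
it. *)
Definition cutoff (n : nat) x : R := step (- n.+1%:R * rho x + (- 1)).

Let C1cut n : C1 D (cutoff n).
Proof. exact: C1_step_affine. Qed.

Let partial_cut n j x : D x -> partial j (cutoff n) x =
  dstep (- n.+1%:R * rho x + (- 1)) * - n.+1%:R * partial j rho x.
Proof. by move=> Dx; have [_] := partial_step_affine (- n.+1%:R) (- 1) j C1rho Dx. Qed.

(** The integrand is the j-th derivative of cutoff n * f, which vanishes near the
boundary of Omega thanks to the cutoff, and near the sphere thanks to f. *)
Lemma cutoff_integral_eq0 n f : C1 D f -> (forall x, D x -> ~ ball x0 (4 * r) x -> f x = 0) ->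
  forall j, mu.-integrable D (EFin \o (fun x => cutoff n x * partial j f x + f x * partial j (cutoff n) x)) /\
   \int[mu]_(x in D) (cutoff n x * partial j f x + f x * partial j (cutoff n) x) = 0.
Proof.
move=> cf f0 j.
have near0 x : ~ D x -> \forall y \near x, D y -> cutoff n y * f y = 0.
  move=> Dx; have [xB|xB] := pselect (ball x0 (8 * r) x); last first.
    move: xB; have -> : 8 * r = 4 * r + 4 * r by ring.
    move=> /ball_far h; have : \forall y \near x, ~ ball x0 (4 * r) y.
      by apply: h; rewrite mulr_gt0.
    by apply: filterS => y yn Dy; rewrite f0 ?mulr0.
  have Ux := BU xB; have [_ srho _ Orho] := defrho.
  have rx : - n.+1%:R^-1 < rho x.
    apply: (@lt_le_trans _ _ 0); first by rewrite oppr_lt0 invr_gt0.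
    by rewrite leNgt; apply/negP => /Orho Ox; apply: Dx; split => //; exact: Ox.
  have : \forall y \near x, - n.+1%:R^-1 < rho y.
    by have /cvgr_gt := C1_continuous (smooth_on_C1 srho) Ux; apply.
  apply: filterS => y ry Dy; rewrite /cutoff step_eq0 ?mul0r//.
  move: ry; rewrite -ltrNl => /ltW; rewrite -(ler_pM2l (ltr0Sn R n)) mulfV ?pnatr_eq0//.
  by rewrite subr_le0 mulNr mulrN.
have [I1 I2] := C1_integral_eq0 oD DL (C1_mul oD (@C1cut n) cf) near0 j.
have E x : D x -> partial j (fun x => cutoff n x * f x) x =
    cutoff n x * partial j f x + f x * partial j (cutoff n) x.
  by move=> Dx; have [_] := partial_mul j (@C1cut n) cf Dx.
split; last by rewrite -I2; apply: eq_Rintegral => x /set_mem /E ->.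
by apply: eq_integrable I1 => // x /set_mem /E /= ->.
Qed.

Lemma cutoff_cvg1 x : D x -> \forall n \near \oo, cutoff n x = 1.
Proof.
move=> Dx; have rx := rho_lt0 Dx.
have e0 : 0 < - rho x / 2 by lra.
have := near_infty_natSinv_lt (PosNum e0); apply: filterS => n /= ne.
rewrite /cutoff step_eq1//; move: ne.
rewrite -(ltr_pM2l (ltr0Sn R n)) mulfV ?pnatr_eq0// => ne.
rewrite mulNr -mulrN; lra.
Qed.

(** With chi the cutoff and F supported in the ball of radius 2 r,
  int chi div F = - int F . grad chi.
On the layer |F . grad rho| <= delta, and 1 <= s (partial_i rho) / c, hence
  |F . grad chi| <= - (delta / c) s psi (partial_i chi)
with psi a plateau equal to 1 on the support of F. The right-hand side is
integrated by parts onto psi, so its integral stays bounded by (delta / c) times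
a constant, although grad chi blows up and the layer has not been measured. *)
Lemma divergence_cutoff_bound F : tangential Omega F ->
  (forall j x, Omega x -> ~ ball x0 (2 * r) x -> F j x = 0) ->
  exists C, forall delta, 0 < delta -> \forall n \near \oo,
    `|\int[mu]_(x in D) (cutoff n x * divergence F x)| <= delta * C.
Proof.
move=> tF F0; have [cF [K FK] _] := tF.
have r20 : 0 < 2 * r by rewrite mulr_gt0.
have [M psiM] := plateau_partial_bounded x0 r20.
pose psi := plateau x0 (2 * r).
have cpsi : C1 D psi by apply: C1S (@C1_plateau _ _ x0 (2 * r)).
have psi0 x : D x -> ~ ball x0 (4 * r) x -> psi x = 0.
  by move=> _ xB; apply: plateau_eq0 => //; rewrite mulrA -natrM.
have F0' j x : D x -> ~ ball x0 (4 * r) x -> F j x = 0.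
  move=> [Ox _] xB; apply: F0 => // h; apply: xB.
  by apply: le_ball h; rewrite ler_pM2r// ler_nat.
have cFD j : C1 D (F j) by apply: C1S (cF j) => x [].
have [Kd divK] := bounded_divergence tF.
have cut_ge0 n x : 0 <= cutoff n x by exact: step_ge0.
have cut_le1 n x : `|cutoff n x| <= 1 by rewrite ger0_norm ?step_le1// step_ge0.
exists (c^-1 * (M * fine (mu D))) => delta delta0.
have muD : (mu D < +oo)%E by exact: measurable_bounded_lty mD DL.
have BU2 : ball x0 (2 * (2 * r)) `<=` U.
  apply: subset_trans BU; apply: le_ball.
  by rewrite mulrA -natrM ler_pM2r// ler_nat.
have := flux_layer defrho tF delta0 r20 BU2; apply: filterS => n small.
pose H x := \sum_j F j x * partial j (cutoff n) x.
pose P x := psi x * partial i (cutoff n) x.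
have idiv : mu.-integrable D (EFin \o (fun x => cutoff n x * divergence F x)).
  apply: (@integrable_bounded_continuous _ _ D L Kd) => // x Dx.
    apply: continuous_atM; first exact: (C1_continuous (@C1cut n)).
    by case: Dx => Ox _; exact: continuous_divergence tF Ox.
  by rewrite normrM -[leRHS]mul1r ler_pM// divK//; case: Dx.
have idpsi : mu.-integrable D (EFin \o (fun x => cutoff n x * partial i psi x)).
  apply: (@integrable_bounded_continuous _ _ D L M) => // x Dx.
    apply: continuous_atM; first exact: (C1_continuous (@C1cut n)).
    exact: (C1_continuous_partial cpsi).
  by rewrite normrM -[leRHS]mul1r ler_pM// psiM.
have [iG G0] := @Rintegral_sum_eq0 R _ _ mu D 'I_d (index_enum 'I_d)
  (fun j x => cutoff n x * partial j (F j) x + F j x * partial j (cutoff n) x) mD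
  (fun j => cutoff_integral_eq0 n (cFD j) (F0' j) j).
have [iGP GP0] := cutoff_integral_eq0 n cpsi psi0 i.
have HE x : H x = \sum_j (cutoff n x * partial j (F j) x + F j x * partial j (cutoff n) x)
    - cutoff n x * divergence F x.
  by rewrite big_split/= -mulr_sumr addrAC subrr add0r.
have PE x : P x = (cutoff n x * partial i psi x + psi x * partial i (cutoff n) x)
    - cutoff n x * partial i psi x by rewrite addrAC subrr add0r.
have iH : mu.-integrable D (EFin \o H).
  by apply: eq_integrable (integrableB mD iG idiv) => // x _ /=; rewrite HE.
have iP : mu.-integrable D (EFin \o P).
  by apply: eq_integrable (integrableB mD iGP idpsi) => // x _ /=; rewrite PE.
have IH : \int[mu]_(x in D) H x = - \int[mu]_(x in D) (cutoff n x * divergence F x).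
  by under eq_Rintegral do rewrite HE; rewrite RintegralB// G0 sub0r.
have IP : \int[mu]_(x in D) P x = - \int[mu]_(x in D) (cutoff n x * partial i psi x).
  by under eq_Rintegral do rewrite PE; rewrite RintegralB// GP0 sub0r.
have HP x : D x -> `|H x| <= delta / c * - s * P x.
  move=> Dx; have [Ox xB8] := Dx.
  pose q := dstep (- n.+1%:R * rho x + (- 1)) * n.+1%:R.
  have q0 : 0 <= q by rewrite mulr_ge0// dstep_ge0.
  have -> : H x = - q * \sum_j F j x * partial j rho x.
    rewrite mulr_sumr; apply: eq_bigr => j _; rewrite partial_cut// /q; ring.
  have -> : delta / c * - s * P x = psi x * q * (delta / c * (s * partial i rho x)).
    rewrite /P partial_cut// /q; ring.
  have dc0 : 0 < delta / c by rewrite divr_gt0.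
  have crx := crho xB8.
  have [xB|xB] := pselect (ball x0 (2 * r) x); last first.
    rewrite big1 ?mulr0 ?normr0; last by move=> j _; rewrite F0 ?mul0r.
    apply: mulr_ge0; first by rewrite mulr_ge0// plateau_ge0.
    by rewrite mulr_ge0 ?(ltW dc0)// (le_trans (ltW c0) crx).
  rewrite /psi plateau_eq1// mul1r normrM normrN (ger0_norm q0).
  have [big|lt1] := leP 1 (- n.+1%:R * rho x + (- 1)).
    by rewrite /q dstep_eq0// !mul0r.
  (* Where the derivative of the cutoff is nonzero the point lies in the layer. *)
  rewrite ler_wpM2l//; apply: (@le_trans _ _ delta); last first.
    by rewrite -[leLHS](divfK (lt0r_neq0 c0)) ler_wpM2l// ltW.
  apply: small => //; rewrite ltr_pdivlMr//.
  by move: lt1; rewrite !mulNr [rho x * _]mulrC ltrBlDr.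
have -> : \int[mu]_(x in D) (cutoff n x * divergence F x) = - \int[mu]_(x in D) H x.
  by rewrite IH opprK.
rewrite normrN.
have iPs : mu.-integrable D (EFin \o (fun x => delta / c * - s * P x)).
  by apply: eq_integrable (integrableZl mD (delta / c * - s) iP) => // x _.
apply: (le_trans (normr_Rintegral_le mD iH iPs HP)).
have dc0 : 0 <= delta / c by rewrite divr_ge0// ltW.
rewrite RintegralZl// IP; apply: (le_trans (ler_norm _)).
rewrite normrM normrN normrM normrN s1 mulr1 (ger0_norm dc0) [leRHS]mulrA.
apply: (ler_wpM2l dc0).
have -> : M * fine (mu D) = \int[mu]_(x in D) M by rewrite Rintegral_cst.
apply: normr_Rintegral_le => //.
  apply: (@integrable_bounded_continuous _ _ D L `|M|) => // x Dx.
  exact: cst_continuous.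
by move=> x Dx; rewrite normrM -[leRHS]mul1r ler_pM// psiM.
Qed.

(** As n grows the cutoff tends to 1 on the domain; by dominated convergence the
integrals in the preceding bound tend to the integral of the divergence, which is
therefore at most any multiple of delta. *)
Lemma divergence_boundary F : tangential Omega F ->
  (forall j x, Omega x -> ~ ball x0 (2 * r) x -> F j x = 0) ->
  \int[mu]_(x in Omega) divergence F x = 0.
Proof.
move=> tF F0; have [C CP] := divergence_cutoff_bound tF F0.
have Fout j x : Omega x -> ~ ball x0 (8 * r) x -> \forall y \near x, Omega y -> F j y = 0.
  have -> : 8 * r = 2 * r + 6 * r by ring.
  move=> _ /ball_far h; have : \forall y \near x, ~ ball x0 (2 * r) y.
    by apply: h; rewrite mulr_gt0.
  by apply: filterS => y yn Oy; exact: F0.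
rewrite (@divergence_localize _ _ _ _ (ball x0 (8 * r)))// -/D.
pose u n := \int[mu]_(x in D) (cutoff n x * divergence F x).
have cdiv x : D x -> {for x, continuous (divergence F)}.
  by move=> [Ox _]; exact: continuous_divergence tF Ox.
have [Kd divK] := bounded_divergence tF.
have mcut n : measurable_fun D (fun x => cutoff n x * divergence F x).
  apply: continuous_measurable_rV => // x Dx.
  by apply: continuous_atM; [exact: (C1_continuous (@C1cut n))|exact: cdiv].
have cut_le1 n x : `|cutoff n x| <= 1 by rewrite ger0_norm ?step_le1// step_ge0.
have muD : (mu D < +oo)%E by exact: measurable_bounded_lty mD DL.
have [] := @dominated_convergence _ _ R mu D mD
  (fun n x => (cutoff n x * divergence F x)%:E) (fun x => (divergence F x)%:E)
  (cst Kd%:E).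
- by move=> n; exact/measurable_EFinP.
- by apply/measurable_EFinP; exact: continuous_measurable_rV.
- apply: aeW => x Dx; apply: cvg_near_cst.
  by have := cutoff_cvg1 Dx; apply: filterS => n ->; rewrite mul1r.
- apply: (@integrable_bounded_continuous _ _ D L `|Kd| (cst Kd)) => // x Dx.
  exact: cst_continuous.
- apply: aeW => x n Dx; rewrite lee_fin normrM -[leRHS]mul1r ler_pM// divK//.
  by case: Dx.
move=> idiv _ ucvg.
have u0 : u @ \oo --> (0 : R).
  apply/cvgr0Pnorm_le => e e0.
  have C0 : 0 < `|C| + 1 by rewrite ltr_wpDl.
  have := CP (e / (`|C| + 1)) (divr_gt0 e0 C0); apply: filterS => n /le_trans; apply.
  rewrite -mulrA ler_piMr ?(ltW e0)// mulrC ler_pdivrMr// mul1r.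
  by rewrite (le_trans (ler_norm _))// lerDl.
have uE : (fun n => (u n)%:E) @ \oo --> (0 : R)%:E.
  by apply: cvg_EFin; [exact: nearW|exact: u0].
have ucvg' : (fun n => (u n)%:E) @ \oo --> (\int[mu]_(x in D) (divergence F x)%:E)%E.
  rewrite (_ : (fun n => _) = fun n => (\int[mu]_(x in D) (cutoff n x * divergence F x)%:E)%E)//.
  apply/funext => n; rewrite /u /Rintegral fineK//; apply: integrable_fin_num => //.
  apply: (@integrable_bounded_continuous _ _ D L Kd) => // x Dx.
    by apply: continuous_atM; [exact: (C1_continuous (@C1cut n))|exact: cdiv].
  by rewrite normrM -[leRHS]mul1r ler_pM// divK//; case: Dx.
by rewrite /Rintegral (cvg_unique _ ucvg' uE)//; exact: ereal_hausdorff.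
Qed.

End boundary_chart.
End local.

(** * The divergence theorem for tangential fields *)

Section global.
Context (R : realType) (d : nat).
Implicit Types (Omega : set 'rV[R]_d) (F : 'I_d -> 'rV[R]_d -> R).

Let mu : {sigma_finite_measure set 'rV[R]_d -> \bar R} := lebesgue_rV R d.

Lemma bounded_sub_cube Omega : bounded_set Omega -> exists L, Omega `<=` cube d L.
Proof.
move=> [M [_ OM]]; exists (M + 1) => x Ox i.
have := OM (M + 1) _ _ Ox; rewrite ltrDl ltr01 => /(_ isT); apply: le_trans.
have -> : `|x| = mx_norm x by [].
rewrite mx_normrE; apply/bigmax_geP; right => /=.
by exists (0, i).
Qed.

(** The statement of the divergence theorem for fields supported in a fixed ball. *)
Definition local_divergence_theorem Omega x0 (r : R) := 0 < r /\
  forall F, tangential Omega F ->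
  (forall j x, Omega x -> ~ ball x0 (2 * r) x -> F j x = 0) ->
  \int[mu]_(x in Omega) divergence F x = 0.

(** At a boundary point some partial derivative of rho is nonzero, hence bounded
away from zero with constant sign on a small ball; this is the chart condition of
the preceding section. *)
Lemma local_divergence_theorem_ex Omega x : smooth_bounded_domain Omega -> closure Omega x ->
  exists r, local_divergence_theorem Omega x r.
Proof.
move=> [_ oO _ /bounded_sub_cube[L OL] charts] cx.
have [Ox|nOx] := pselect (Omega x).
  have : nbhs x Omega by exact: open_nbhs_nbhs.
  move=> /nbhs_ballP[e /= e0 xeO]; exists (e / 8); split; first by rewrite divr_gt0.
  move=> F tF F0; apply: (divergence_interior oO OL tF _ _ F0).
    by rewrite divr_gt0.
  by rewrite mulrC divfK.
have bx : boundary Omega x by split => // /interior_subset.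
have [U [rho [Ux defrho]]] := charts x bx.
have [oU srho grad0 Orho] := defrho.
have [i pi0] : exists i, partial i rho x != 0.
  apply/existsP; apply: contraNT (grad0 _ Ux); rewrite negb_exists => /forallP h.
  by apply/eqP/rowP => i; rewrite !mxE; apply/eqP; have := h i; rewrite negbK.
pose s := Num.sg (partial i rho x).
pose c := `|partial i rho x| / 2.
have c0 : 0 < c by rewrite divr_gt0// normr_gt0.
have spx : s * partial i rho x = 2 * c.
  by rewrite /s /c -normrEsg mulrC divfK.
have nearc : \forall y \near x, c < s * partial i rho y.
  have cs : {for x, continuous (fun y => s * partial i rho y)}.
    apply: continuous_atM; first exact: cst_continuous.
    exact: (C1_continuous_partial (smooth_on_C1 srho)).
  by have /cvgr_gt := cs; apply; rewrite spx; lra.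
have nearU : \near x, U x by exact: open_nbhs_nbhs.
have : \forall y \near x, U y /\ c < s * partial i rho y by exact: filterI.
move=> /nbhs_ballP[e /= e0 xe].
have e8 : 8 * (e / 8) = e by rewrite mulrC divfK.
exists (e / 8); split; first by rewrite divr_gt0.
move=> F tF F0.
apply: (@divergence_boundary R d Omega U rho L x (e / 8) i s c) => //.
- by rewrite divr_gt0.
- by rewrite e8 => y /xe[].
- by rewrite /s normr_sg pi0.
- by rewrite e8 => y /xe[_ /ltW].
Qed.

(** Induction on a finite cover of the closure: a field vanishing off p :: s is
split as psi F + (1 - psi) F with psi a plateau at p, so that the first part is
local and the second one vanishes off s. *)
Lemma divergence_theorem Omega F : smooth_bounded_domain Omega ->
  tangential Omega F -> \int[mu]_(x in Omega) divergence F x = 0.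
Proof.
move=> domO; have [_ oO _ bO _] := domO; have [L OL] := bounded_sub_cube bO.
have mO := open_measurable_rV oO.
have /choice[r rP] : forall x, exists r, closure Omega x -> local_divergence_theorem Omega x r.
  move=> x; have [/(local_divergence_theorem_ex domO)[r gr]|nx] := pselect (closure Omega x).
    by exists r.
  by exists 0.
have cO : compact (closure Omega).
  apply: (@subclosed_compact _ _ (cube d L)).
  - exact: closed_closure.
  - exact: compact_cube.
  - by rewrite closureE; apply: smallest_sub => //; exact: closed_cube.
have [s sO Os] : finite_subset_cover (closure Omega) (fun x => ball x (r x)) (closure Omega).
  move: cO; rewrite compact_cover; apply => [x _|x cx]; first exact: ball_open.
  by exists x => //; apply: ballxx; have [] := rP x cx.
suff main : forall s : seq 'rV[R]_d, (forall p, p \in s -> closure Omega p) ->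
    forall G, tangential Omega G ->
    (forall j x, Omega x -> (forall p, p \in s -> ~ ball p (r p) x) -> G j x = 0) ->
    \int[mu]_(x in Omega) divergence G x = 0.
  move=> tF; apply: (main (finmap.enum_fset s)) => //.
    by move=> p ps; have := sO p ps; rewrite inE.
  move=> j x Ox xs; have [p ps pB] := Os x (subset_closure Ox).
  by exfalso; exact: xs p ps pB.
move=> {s sO Os F} s; elim: s => [_ F tF F0|p s IH sO F tF F0].
  rewrite (@divergence_localize _ _ _ _ set0)//.
    by rewrite setI0 Rintegral_set0.
  move=> j x Ox _; have := open_nbhs_nbhs (conj oO Ox); apply: filterS => y Oy _.
  exact: F0.
have [rp0 gp] := rP p (sO p (mem_head _ _)).
pose psi := plateau p (r p).
have [M psiM] := plateau_partial_bounded p rp0.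
have [cF _ _] := tF.
have cpsi : C1 setT psi := @C1_plateau _ _ p (r p).
have cpsi' : C1 setT (fun x => 1 + (-1) * psi x).
  apply: C1_add; [exact: openT|exact: C1_cst openT|].
  by apply: C1_mul; [exact: openT|exact: C1_cst openT|].
(* The local part F1 and the part F2 left to the induction hypothesis. *)
pose F1 j x := psi x * F j x.
pose F2 j x := (1 + (-1) * psi x) * F j x.
have t1 : tangential Omega F1.
  apply: (@tangential_scale _ _ _ _ psi (Num.max 1 M)) => //.
    by move=> x; rewrite ger0_norm ?plateau_ge0// le_max plateau_le1.
  by move=> i x; rewrite le_max psiM orbT.
have t2 : tangential Omega F2.
  apply: (@tangential_scale _ _ _ _ (fun x => 1 + (-1) * psi x) (Num.max 1 M)) => //.
    move=> x; rewrite mulN1r ger0_norm ?subr_ge0 ?plateau_le1// le_max.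
    by rewrite gerBl plateau_ge0.
  move=> i x.
  have dpsi : is_derive x (delta_mx 0 i) psi (partial i psi x) by exact: (C1_partial i cpsi).
  have [_ E] := is_deriveD (is_derive_cst (1 : R) x (delta_mx 0 i)) (is_deriveZ (-1) dpsi).
  by rewrite /partial [X in `|X|]E add0r normrZ normrN1 mul1r le_max psiM orbT.
transitivity (\int[mu]_(x in Omega) (divergence F1 x + divergence F2 x)).
  apply: eq_Rintegral => x /set_mem Ox; rewrite /divergence -big_split/=.
  apply: eq_bigr => j _.
  have [c1 _ _] := t1; have [c2 _ _] := t2.
  have [_ <-] := partial_add j (c1 j) (c2 j) Ox.
  by congr ('D__ _ _); apply/funext => y; rewrite /F1 /F2; ring.
rewrite RintegralD//; [|exact: integrable_divergence OL t1|exact: integrable_divergence OL t2].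
rewrite gp//; last by move=> j x Ox xB; rewrite /F1 /psi plateau_eq0 ?mul0r.
rewrite add0r; apply: IH => //.
  by move=> q qs; apply: sO; rewrite in_cons qs orbT.
move=> j x Ox xs; have [xp|xp] := pselect (ball p (r p) x).
  by rewrite /F2 /psi plateau_eq1// mulr1 subrr mul0r.
rewrite /F2 F0 ?mulr0// => q; rewrite in_cons => /orP[/eqP->//|qs].
exact: xs.
Qed.

End global.

(** * Functions extending continuously to the closed cylinder *)

(** Limits in space-time restrict to limits in space at fixed time. *)
Lemma within_slice (S T : topologicalType) (D : set T) (E : set (S * T)) (t : S) (x : T) :
  (forall y, D y -> E (t, y)) ->
  (fun y => (t, y)) @ within D (nbhs x) --> within E (nbhs (t, x)).
Proof.
move=> DE A [[U V] /= [Ut Vx] UVA].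
rewrite /nbhs /= /fmap /=; rewrite /within /=; apply: filterS Vx => y Vy Dy /=.
by apply: (UVA (t, y)); [split => //=; exact: nbhs_singleton|exact: DE].
Qed.

Lemma within_slice_l (S T : topologicalType) (D : set S) (E : set (S * T)) (t : S) (x : T) :
  (forall s, D s -> E (s, x)) ->
  (fun s => (s, x)) @ within D (nbhs t) --> within E (nbhs (t, x)).
Proof.
move=> DE A [[U V] /= [Ut Vx] UVA].
rewrite /nbhs /= /fmap /=; rewrite /within /=; apply: filterS Ut => y Uy Dy /=.
by apply: (UVA (y, x)); [split => //=; exact: nbhs_singleton|exact: DE].
Qed.

Lemma within_continuous_at (S U : topologicalType) (E : set S) (g : S -> U) (x : S) :
  {within E, continuous g} -> E x -> g @ within E (nbhs x) --> g x.
Proof. by move=> cg Ex; have := cg x; rewrite /continuous_at nbhs_subspace_in. Qed.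

Section extendable.
Context (R : realType) (d : nat).
Variables (Omega : set 'rV[R]_d) (T : R).
Hypothesis oO : open Omega.
Hypothesis bO : bounded_set Omega.
Hypothesis T0 : 0 < T.
Implicit Types (u : R -> 'rV[R]_d -> R).

Let mu : {sigma_finite_measure set 'rV[R]_d -> \bar R} := lebesgue_rV R d.
Let lam := @lebesgue_measure R.

Definition closed_cyl : set (R * 'rV[R]_d) := `[0, T]%classic `*` closure Omega.
Definition cyl : set (R * 'rV[R]_d) := `[0, T]%classic `*` Omega.

(** Derivatives of a solution live only inside the cylinder; their extensions to the
compact closed cylinder provide bounds, measurability and integrability. The class
is stable under the algebraic operations from which all integrands are built. *)
Definition extendable u := extends_continuously cyl closed_cyl u.

Lemma cyl_sub : cyl `<=` closed_cyl.
Proof. by move=> [t x] [? ?]; split => //; exact: subset_closure. Qed.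

Lemma compact_closure : compact (closure Omega).
Proof.
have [L OL] := bounded_sub_cube bO.
apply: (@subclosed_compact _ _ (cube d L)).
- exact: closed_closure.
- exact: compact_cube.
- by rewrite closureE; apply: smallest_sub => //; exact: closed_cube.
Qed.

Lemma compact_closed_cyl : compact closed_cyl.
Proof. by apply: compact_setX; [exact: segment_compact|exact: compact_closure]. Qed.

Lemma within_extendable u : {within closed_cyl, continuous (fun p => u p.1 p.2)} -> extendable u.
Proof. by move=> cu; exists (fun p => u p.1 p.2). Qed.

Lemma extendable_eq u1 u2 : (forall t x, 0 <= t <= T -> Omega x -> u1 t x = u2 t x) ->
  extendable u1 -> extendable u2.
Proof.
move=> u12 [g [cg gE]]; exists g; split => // t x tx; rewrite gE//.
by case: tx => /= t0 Ox; apply: u12 => //; move: t0; rewrite in_itv.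
Qed.

Lemma extendable_cst c : extendable (fun _ _ => c).
Proof. by exists (cst c); split => //; exact: cst_continuous. Qed.

Lemma extendable_add u1 u2 : extendable u1 -> extendable u2 -> extendable (fun t x => u1 t x + u2 t x).
Proof.
move=> [g1 [c1 E1]] [g2 [c2 E2]]; exists (fun p => g1 p + g2 p); split.
  by move=> p; apply: continuousD; [exact: c1|exact: c2].
by move=> t x tx; rewrite E1// E2.
Qed.

Lemma extendable_mul u1 u2 : extendable u1 -> extendable u2 -> extendable (fun t x => u1 t x * u2 t x).
Proof.
move=> [g1 [c1 E1]] [g2 [c2 E2]]; exists (fun p => g1 p * g2 p); split.
  by move=> p; apply: continuousM; [exact: c1|exact: c2].
by move=> t x tx; rewrite E1// E2.
Qed.

Lemma extendable_sum I (s : seq I) (u : I -> R -> 'rV[R]_d -> R) : (forall k, extendable (u k)) ->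
  extendable (fun t x => \sum_(k <- s) u k t x).
Proof.
move=> nu; elim: s => [|k s IH].
  by apply: extendable_eq (extendable_cst 0) => t x _ _; rewrite big_nil.
by apply: extendable_eq (extendable_add (nu k) IH) => t x _ _; rewrite big_cons.
Qed.

Lemma within_comp (g : R * 'rV[R]_d -> R) (phi : R -> R) :
  {within closed_cyl, continuous g} ->
  (forall p, closed_cyl p -> {for g p, continuous phi}) ->
  {within closed_cyl, continuous (phi \o g)}.
Proof.
move=> cg cphi; rewrite continuous_subspace_in => p /set_mem Bp.
by apply: (@continuous_comp (subspace closed_cyl) R R g phi); [exact: cg|exact: cphi].
Qed.

Lemma extendable_comp u (phi : R -> R) :
  {within closed_cyl, continuous (fun p => u p.1 p.2)} ->
  (forall t x, 0 <= t <= T -> closure Omega x -> {for u t x, continuous phi}) ->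
  extendable (fun t x => phi (u t x)).
Proof.
move=> cu cphi; apply: within_extendable; apply: (within_comp cu) => -[t x] [/= t0 cx].
by apply: cphi => //; move: t0; rewrite in_itv.
Qed.

Lemma extendable_time (g : R -> R) : continuous g -> extendable (fun t _ => g t).
Proof.
move=> cg; apply: within_extendable; apply: continuous_subspaceT => p.
by apply: (@continuous_comp _ _ _ fst g); [exact: cvg_fst|exact: cg].
Qed.

Lemma extendable_bounded u : extendable u ->
  exists K, forall t x, 0 <= t <= T -> Omega x -> `|u t x| <= K.
Proof.
move=> [g [cg gE]].
have : compact (g @` closed_cyl).
  by apply: continuous_compact compact_closed_cyl.
move=> /compact_bounded[K [_ gK]]; exists (K + 1) => t x t0 Ox.
have tx : cyl (t, x) by split => //=; rewrite in_itv.
rewrite -gE//; apply: (gK (K + 1)); first by rewrite ltrDl.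
by exists (t, x) => //; exact: cyl_sub.
Qed.

Lemma extendable_continuous u t x : extendable u -> 0 <= t <= T -> Omega x ->
  {for x, continuous (u t)}.
Proof.
move=> [g [cg gE]] t0 Ox.
have tB : closed_cyl (t, x) by apply: cyl_sub; split => //=; rewrite in_itv.
have slice : (fun y => (t, y)) @ within Omega (nbhs x) --> within closed_cyl (nbhs (t, x)).
  by apply: within_slice => y Oy; apply: cyl_sub; split => //=; rewrite in_itv.
have := cvg_comp _ _ slice (within_continuous_at cg tB).
rewrite (within_interior (x := x)); last exact: open_nbhs_nbhs.
have Oxn := open_nbhs_nbhs (conj oO Ox).
move=> cgt; apply: (near_eq_continuous (f := fun y => g (t, y))); last exact: cgt.
by apply: filterS Oxn => y Oy; rewrite gE//; split => //=; rewrite in_itv.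
Qed.

Lemma measurable_cylinder : measurable (cylinder T Omega).
Proof. by apply: measurableX => //; exact: open_measurable_rV. Qed.

Lemma extendable_measurable u : extendable u ->
  measurable_fun (cylinder T Omega) (fun p => u p.1 p.2).
Proof.
move=> [g [cg gE]].
have mg := within_continuous_measurable_RrV cyl_sub measurable_cylinder cg.
by apply: eq_measurable_fun mg => -[t x] /set_mem tx; rewrite /= gE.
Qed.

Lemma cylinder_lty : ((lam \x mu) (cylinder T Omega) < +oo)%E.
Proof.
have [L OL] := bounded_sub_cube bO; have mO := open_measurable_rV oO.
rewrite product_measure1E// lte_mul_pinfty//; last exact: measurable_bounded_lty mO OL.
rewrite ge0_fin_numE//; have := @lebesgue_measure_itv R `[0, T].
by move=> /= ->; case: ifP => _; exact: ltry.
Qed.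

Lemma extendable_integrable u : extendable u ->
  (lam \x mu)%E.-integrable (cylinder T Omega) (EFin \o (fun p => u p.1 p.2)).
Proof.
move=> nu; apply: measurable_bounded_integrable.
- exact: measurable_cylinder.
- exact: cylinder_lty.
- exact: extendable_measurable.
- have [K uK] := extendable_bounded nu.
  exists K; split; first exact: num_real.
  by move=> M KM [t x] [/= t0 Ox]; apply: le_trans (ltW KM); apply: uK => //.
Qed.

(** The real value of the space-time integral, finite for the integrands at hand, so
that the estimates become linear arithmetic. *)
Definition cyl_int u : R := \int[(lam \x mu)%E]_(p in cylinder T Omega) u p.1 p.2.

Lemma spacetime_integralE u : extendable u -> spacetime_integral T Omega u = (cyl_int u)%:E.
Proof.
move=> nu; rewrite /spacetime_integral /cyl_int /Rintegral fineK//.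
apply: integrable_fin_num; [exact: measurable_cylinder|exact: extendable_integrable].
Qed.

Lemma eq_cyl_int u1 u2 : (forall t x, 0 <= t <= T -> Omega x -> u1 t x = u2 t x) ->
  cyl_int u1 = cyl_int u2.
Proof.
move=> u12; apply: eq_Rintegral => -[t x] /set_mem[/= t0 Ox].
by apply: u12 => //; move: t0; rewrite in_itv.
Qed.

Lemma cyl_intD u1 u2 : extendable u1 -> extendable u2 ->
  cyl_int (fun t x => u1 t x + u2 t x) = cyl_int u1 + cyl_int u2.
Proof.
by move=> n1 n2; rewrite /cyl_int (RintegralD measurable_cylinder (extendable_integrable n1) (extendable_integrable n2)).
Qed.

Lemma cyl_intZ c u : extendable u -> cyl_int (fun t x => c * u t x) = c * cyl_int u.
Proof.
by move=> nu; rewrite /cyl_int (RintegralZl _ measurable_cylinder (extendable_integrable nu)).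
Qed.

Lemma le_cyl_int u1 u2 : extendable u1 -> extendable u2 ->
  (forall t x, 0 <= t <= T -> Omega x -> u1 t x <= u2 t x) -> cyl_int u1 <= cyl_int u2.
Proof.
move=> n1 n2 u12; apply: (le_Rintegral measurable_cylinder (extendable_integrable n1) (extendable_integrable n2)).
by move=> [t x] [/= t0 Ox]; apply: u12 => //; move: t0; rewrite in_itv.
Qed.

Lemma cyl_int_ge0 u : (forall t x, 0 <= t <= T -> Omega x -> 0 <= u t x) -> 0 <= cyl_int u.
Proof.
move=> u0; apply: Rintegral_ge0 => -[t x] [/= t0 Ox]; by apply: u0.
Qed.

Let patched u : measurableTypeR R * 'rV[R]_d -> \bar R :=
  (EFin \o (fun p => u p.1 p.2)) \_ (cylinder T Omega).

Let patched_integrable u : extendable u -> (lam \x mu)%E.-integrable setT (patched u).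
Proof.
move=> nu; apply: (iffLR (integrable_mkcond _ measurable_cylinder)).
exact: extendable_integrable.
Qed.

Let patched_slice u x : Omega x ->
  (\int[lam]_t patched u (t, x) = \int[lam]_(t in `[0%R, T]) (u t x)%:E)%E.
Proof.
move=> Ox; rewrite [RHS]integral_mkcond; apply: eq_integral => t _.
rewrite /patched !patchE; congr (if _ then _ else _).
by apply/idP/idP => [/set_mem[/= t0 _]|/set_mem t0]; apply/mem_set.
Qed.

Let patched_slice_out u x : ~ Omega x -> (\int[lam]_t patched u (t, x) = 0)%E.
Proof.
move=> Ox; apply: integral0_eq => t _.
by rewrite /patched patchE; case: ifPn => // /set_mem[].
Qed.

Let patched_section u t : 0 <= t <= T ->
  (\int[mu]_x patched u (t, x) = \int[mu]_(x in Omega) (u t x)%:E)%E.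
Proof.
move=> t0; rewrite [RHS]integral_mkcond; apply: eq_integral => x _.
rewrite /patched !patchE; congr (if _ then _ else _).
by apply/idP/idP => [/set_mem[/= _ Ox]|/set_mem Ox]; apply/mem_set => //; split => //=;
  rewrite in_itv.
Qed.

Let patched_section_out u t : ~ (0 <= t <= T) -> (\int[mu]_x patched u (t, x) = 0)%E.
Proof.
move=> t0; apply: integral0_eq => x _.
by rewrite /patched patchE; case: ifPn => // /set_mem[/=]; rewrite in_itv.
Qed.

(** Fubini, integrating in time first: this is where the fundamental theorem of
calculus produces the difference of the integrals at times T and 0. *)
Lemma cyl_int_time u (h : 'rV[R]_d -> R) : extendable u ->
  (forall x, Omega x -> (\int[lam]_(t in `[0%R, T]) (u t x)%:E = (h x)%:E)%E) ->
  cyl_int u = \int[mu]_(x in Omega) h x.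
Proof.
move=> nu uh; rewrite /cyl_int /Rintegral; congr fine.
rewrite integral_mkcond -(integral21_prod_meas1 (patched_integrable nu)).
rewrite [RHS]integral_mkcond; apply: eq_integral => x _.
rewrite /fubini_G patchE; case: ifPn => [/set_mem Ox|/negP nOx].
  by rewrite patched_slice// uh.
by rewrite patched_slice_out//; move: nOx; rewrite inE.
Qed.

Lemma extendable_section_integrable u t : extendable u -> 0 <= t <= T ->
  mu.-integrable Omega (EFin \o u t).
Proof.
move=> nu t0; have [L OL] := bounded_sub_cube bO; have [K uK] := extendable_bounded nu.
apply: (@integrable_bounded_continuous _ _ _ L K) => // x Ox; last exact: uK.
exact: extendable_continuous.
Qed.

(** Fubini, integrating in space first. The equations hold only for 0 < t < T, which
suffices because the two endpoints form a null set of times. *)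
Lemma cyl_int_space0 u : extendable u ->
  (forall t, 0 < t < T -> \int[mu]_(x in Omega) u t x = 0) -> cyl_int u = 0.
Proof.
move=> nu u0; rewrite /cyl_int /Rintegral -[RHS]/(fine 0%E); congr fine.
have ip := patched_integrable nu.
rewrite integral_mkcond -(integral12_prod_meas1 ip).
rewrite -[RHS](@integral0 _ _ _ lam setT); apply: ae_eq_integral => //.
- exact: measurable_fubini_F ip.
- exists [set 0%R; T]; split.
  + exact: measurableU.
  + by apply: countable_lebesgue_measure0; apply: finite_set_countable; exact: finite_set2.
  + move=> t /= nt; apply: contrapT => tT; apply: nt => _.
    rewrite /fubini_F.
    have [tin|tout] := boolP (0 <= t <= T); last by rewrite patched_section_out//; apply/negP.
    rewrite patched_section//.
    have tin' : 0 < t < T.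
      rewrite !lt_neqAle; case/andP: tin => -> ->; rewrite !andbT; apply/andP; split.
        by apply/eqP => t0; apply: tT; left.
      by apply/eqP => t0; apply: tT; right.
    have /fineK <- : (\int[mu]_(x in Omega) (u t x)%:E \is a fin_num)%E.
      apply: integrable_fin_num; first exact: open_measurable_rV.
      exact: extendable_section_integrable.
    by have := u0 t tin'; rewrite /Rintegral => ->.
Qed.

End extendable.

(** * Entropy balances along solutions *)

Lemma partial_lin (R : realType) d (D : set 'rV[R]_d) (f g : 'rV[R]_d -> R) (a b : R) i x :
  C1 D f -> C1 D g -> D x ->
  is_derive x (delta_mx 0 i) (fun y => a * f y + b * g y)
    (a * partial i f x + b * partial i g x).
Proof.
move=> cf cg Dx; have h1 := C1_partial i cf Dx; have h2 := C1_partial i cg Dx.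
exact: (is_deriveD (is_deriveZ a h1) (is_deriveZ b h2)).
Qed.

Lemma C1_lin (R : realType) d (D : set 'rV[R]_d) (f g : 'rV[R]_d -> R) (a b : R) :
  open D -> C1 D f -> C1 D g -> C1 D (fun y => a * f y + b * g y).
Proof.
move=> oD cf cg.
exact: (C1_add oD (C1_mul oD (C1_cst a oD) cf) (C1_mul oD (C1_cst b oD) cg)).
Qed.

Lemma within_continuousD (R : realType) (S : topologicalType) (B : set S) (f g : S -> R) :
  {within B, continuous f} -> {within B, continuous g} ->
  {within B, continuous (fun p => f p + g p)}.
Proof. by move=> cf cg p; apply: (@continuous_atD R (subspace B) f g); [exact: cf|exact: cg]. Qed.

Lemma within_continuousM (R : realType) (S : topologicalType) (B : set S) (f g : S -> R) :
  {within B, continuous f} -> {within B, continuous g} ->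
  {within B, continuous (fun p => f p * g p)}.
Proof. by move=> cf cg p; apply: (@continuous_atM R (subspace B) f g); [exact: cf|exact: cg]. Qed.

Lemma within_continuous_cst (R : realType) (S : topologicalType) (B : set S) (c : R) :
  {within B, continuous (fun _ : S => c)}.
Proof. by move=> p; exact: cst_continuous. Qed.

Lemma within_continuous_lin (R : realType) (S : topologicalType) (B : set S) (f g : S -> R) (a b : R) :
  {within B, continuous f} -> {within B, continuous g} ->
  {within B, continuous (fun p => a * f p + b * g p)}.
Proof.
by move=> cf cg; apply: within_continuousD; apply: within_continuousM => //;
  exact: within_continuous_cst.
Qed.

Section parabolic.
Context (R : realType) (d : nat).
Variables (Omega : set 'rV[R]_d) (T : R).
Hypothesis domO : smooth_bounded_domain Omega.
Hypothesis T0 : 0 < T.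
Implicit Types (u : R -> 'rV[R]_d -> R).

Let mu : {sigma_finite_measure set 'rV[R]_d -> \bar R} := lebesgue_rV R d.
Let lam := @lebesgue_measure R.
Let oO : open Omega. Proof. by case: domO. Qed.
Let bO : bounded_set Omega. Proof. by case: domO. Qed.

Notation extendable := (extendable Omega T).
Notation cyl_int := (cyl_int Omega T).

Lemma within_time_slice (g : R * 'rV[R]_d -> R) x :
  {within closed_cyl Omega T, continuous g} -> closure Omega x ->
  {within `[0, T], continuous (fun t => g (t, x))}.
Proof.
move=> cg cx; rewrite continuous_subspace_in => t /set_mem t0.
have tx : closed_cyl Omega T (t, x) by [].
have sl : (fun s => (s, x)) @ within `[0, T] (nbhs t) --> within (closed_cyl Omega T) (nbhs (t, x)).
  by apply: within_slice_l => s s0; split.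
by have := cvg_comp _ _ sl (within_continuous_at cg tx); rewrite nbhs_subspace_in.
Qed.

Section regular.
Variable u : R -> 'rV[R]_d -> R.
Hypothesis reg : regular_upto_boundary T Omega u.

Lemma regular_within : {within closed_cyl Omega T, continuous (fun p => u p.1 p.2)}.
Proof. by case: reg. Qed.

Lemma regular_extendable : extendable u.
Proof. exact: within_extendable regular_within. Qed.

Lemma regular_extendable_partial i : extendable (fun t => partial i (u t)).
Proof. by case: reg => _ _ /(_ i)[]. Qed.

Lemma regular_extendable_partial2 i j : extendable (fun t => partial j (partial i (u t))).
Proof. by case: reg => _ _ _ /(_ i j)[]. Qed.

Lemma regular_C1 t : 0 <= t <= T -> C1 Omega (u t).
Proof.
move=> t0 x Ox; split => [|i].
  exact: (extendable_continuous oO regular_extendable t0 Ox).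
split; first by case: reg => _ _ /(_ i)[h _] _; exact: h.
exact: (extendable_continuous oO (regular_extendable_partial i) t0 Ox).
Qed.

Lemma regular_C1_partial i t : 0 <= t <= T -> C1 Omega (partial i (u t)).
Proof.
move=> t0 x Ox; split => [|j].
  exact: (extendable_continuous oO (regular_extendable_partial i) t0 Ox).
split; first by case: reg => _ _ _ /(_ i j)[h _]; exact: h.
exact: (extendable_continuous oO (regular_extendable_partial2 i j) t0 Ox).
Qed.

End regular.

Section flux_field.
Variables (w u : R -> 'rV[R]_d -> R) (k dk : R -> R).
Hypothesis regw : regular_upto_boundary T Omega w.
Hypothesis regu : regular_upto_boundary T Omega u.
Hypothesis w0 : forall t x, 0 <= t <= T -> closure Omega x -> 0 < w t x.
Hypothesis k_derive : forall s : R, 0 < s -> is_derive s (1 : R) k (dk s).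
Hypothesis dk_continuous : forall s : R, 0 < s -> {for s, continuous dk}.

Definition flux_field (j : 'I_d) t x := k (w t x) * partial j (u t) x.

Let w0O t x : 0 <= t <= T -> Omega x -> 0 < w t x.
Proof. by move=> t0 Ox; apply: w0 => //; exact: subset_closure. Qed.

Lemma k_continuous (s : R) : 0 < s -> {for s, continuous k}.
Proof.
move=> s0; apply: differentiable_continuous; apply/derivable1_diffP.
by have [] := k_derive s0.
Qed.

Lemma C1_coef t : 0 <= t <= T -> C1 Omega (fun x => k (w t x)).
Proof.
move=> t0; apply: (C1_comp (dphi := dk)) => //.
- exact: regular_C1.
- by move=> x Ox; apply: k_derive; exact: w0O.
- by move=> x Ox; apply: dk_continuous; exact: w0O.
Qed.

Lemma C1_flux_field j t : 0 <= t <= T -> C1 Omega (flux_field j t).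
Proof. by move=> t0; apply: C1_mul => //; [exact: C1_coef|exact: regular_C1_partial]. Qed.

Lemma partial_flux_field j t x : 0 <= t <= T -> Omega x ->
  partial j (flux_field j t) x = k (w t x) * partial j (partial j (u t)) x
    + partial j (u t) x * (dk (w t x) * partial j (w t) x).
Proof.
move=> t0 Ox.
have [_] := partial_mul j (C1_coef t0) (regular_C1_partial regu j t0) Ox.
rewrite /partial => ->; congr (_ + _ * _).
have dkw : is_derive (w t x) (1 : R) k (dk (w t x)) by apply: k_derive; exact: w0O.
by have [_] := partial_comp j (regular_C1 regw t0) Ox dkw.
Qed.

Lemma extendable_coef : extendable (fun t x => k (w t x)).
Proof.
apply: extendable_comp; first exact: regular_within.
by move=> t x t0 cx; apply: k_continuous; exact: w0.
Qed.

Lemma extendable_flux_field j : extendable (flux_field j).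
Proof. by apply: extendable_mul; [exact: extendable_coef|exact: regular_extendable_partial]. Qed.

Lemma extendable_partial_flux_field j : extendable (fun t => partial j (flux_field j t)).
Proof.
apply: (@extendable_eq _ _ _ _ (fun t x => k (w t x) * partial j (partial j (u t)) x
    + partial j (u t) x * (dk (w t x) * partial j (w t) x))).
  by move=> t x t0 Ox; rewrite partial_flux_field.
apply: extendable_add; first by apply: extendable_mul; [exact: extendable_coef|exact: regular_extendable_partial2].
apply: extendable_mul; first exact: regular_extendable_partial.
apply: extendable_mul; last exact: regular_extendable_partial.
apply: extendable_comp; first exact: regular_within.
by move=> t x t0 cx; apply: dk_continuous; exact: w0.
Qed.

Lemma div_flux_field t x : div (fun y => k (w t y) *: grad (u t) y) x =
  \sum_j partial j (flux_field j t) x.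
Proof.
rewrite /div; apply: eq_bigr => j _; congr partial.
by apply/funext => y; rewrite !mxE.
Qed.

(** The boundary condition is a limit in space-time; the divergence theorem is
applied at a fixed time. *)
Lemma flux_field_normal t x n : no_flux T Omega (fun t x => k (w t x)) u ->
  0 <= t <= T -> boundary Omega x -> outer_unit_normal Omega x n ->
  (fun y => \sum_j flux_field j t y * n 0 j) @ within Omega (nbhs x) --> (0 : R).
Proof.
move=> nf t0 bx nx; have h := nf t x n t0 bx nx.
have sl : (fun y => (t, y)) @ within Omega (nbhs x) -->
    within (`[0, T]%classic `*` Omega) (nbhs (t, x)).
  by apply: within_slice => y Oy; split => //=; rewrite in_itv.
have := cvg_comp _ _ sl h.
rewrite (_ : _ \o _ = fun y => \sum_j flux_field j t y * n 0 j)//.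
apply/funext => y /=; rewrite /dot mulr_sumr; apply: eq_bigr => j _.
by rewrite mxE mulrA.
Qed.

End flux_field.

Section energy_identity.
Variables (eta kappa deta dkappa : R -> R) (v w : R -> 'rV[R]_d -> R).
Variables (v0 w0 : 'rV[R]_d -> R) (wlow : R).
Hypothesis sol : smooth_solution eta kappa T Omega v w v0 w0.
Hypothesis wlow0 : 0 < wlow.
Hypothesis w_ge : forall t x, 0 <= t <= T -> Omega x -> wlow <= w t x.
Hypothesis eta_derive : forall s : R, 0 < s -> is_derive s (1 : R) eta (deta s).
Hypothesis deta_continuous : forall s : R, 0 < s -> {for s, continuous deta}.
Hypothesis kappa_derive : forall s : R, 0 < s -> is_derive s (1 : R) kappa (dkappa s).
Hypothesis dkappa_continuous : forall s : R, 0 < s -> {for s, continuous dkappa}.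

Let regv : regular_upto_boundary T Omega v. Proof. by case: sol => -[]. Qed.
Let regw : regular_upto_boundary T Omega w. Proof. by case: sol => -[]. Qed.

(** The lower bound is assumed in Omega; it passes to the closure, where power
functions of w have to be continuous, because Omega is dense there. *)
Lemma w_gt0 t x : 0 <= t <= T -> closure Omega x -> 0 < w t x.
Proof.
move=> t0 cx; apply: (lt_le_trans wlow0); rewrite leNgt; apply/negP => wx.
have tx : closed_cyl Omega T (t, x) by split => //=; rewrite in_itv.
have sl : (fun y => (t, y)) @ within (closure Omega) (nbhs x) -->
    within (closed_cyl Omega T) (nbhs (t, x)).
  by apply: within_slice => y cy; split => //=; rewrite in_itv.
have := cvg_comp _ _ sl (within_continuous_at (regular_within regw) tx).
move=> /cvgr_lt /(_ _ wx) /=; rewrite near_withinE => wy.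
have [y [Oy wyx]] := cx _ wy.
have := w_ge t0 Oy; rewrite leNgt => /negP; apply.
by apply: wyx; exact: subset_closure.
Qed.

Lemma w_gt0_in t x : 0 <= t <= T -> Omega x -> 0 < w t x.
Proof. by move=> t0 Ox; apply: w_gt0 => //; exact: subset_closure. Qed.

Section test_function.
Variables (a b p q : R) (phi dphi ddphi : R -> R).

Definition zcomb t x := a * w t x + b * v t x.

Hypothesis phi_derive : forall t x, 0 <= t <= T -> closure Omega x ->
  is_derive (zcomb t x) (1 : R) phi (dphi (zcomb t x)).
Hypothesis dphi_derive : forall t x, 0 <= t <= T -> closure Omega x ->
  is_derive (zcomb t x) (1 : R) dphi (ddphi (zcomb t x)).
Hypothesis ddphi_continuous : forall t x, 0 <= t <= T -> closure Omega x ->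
  {for zcomb t x, continuous ddphi}.

Let phi_continuous t x : 0 <= t <= T -> closure Omega x -> {for zcomb t x, continuous phi}.
Proof.
move=> t0 cx; apply: differentiable_continuous; apply/derivable1_diffP.
by have [] := phi_derive t0 cx.
Qed.

Let dphi_continuous t x : 0 <= t <= T -> closure Omega x -> {for zcomb t x, continuous dphi}.
Proof.
move=> t0 cx; apply: differentiable_continuous; apply/derivable1_diffP.
by have [] := dphi_derive t0 cx.
Qed.

Let zcomb_within : {within closed_cyl Omega T, continuous (fun p => zcomb p.1 p.2)}.
Proof.
rewrite /zcomb; apply: (@within_continuous_lin R (R * 'rV[R]_d)%type _ (fun p => w p.1 p.2) (fun p => v p.1 p.2)).
  exact: regular_within.
exact: regular_within.
Qed.

Let extendable_phi : extendable (fun t x => phi (zcomb t x)).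
Proof. exact: extendable_comp. Qed.
Let extendable_dphi : extendable (fun t x => dphi (zcomb t x)).
Proof. exact: extendable_comp. Qed.
Let extendable_ddphi : extendable (fun t x => ddphi (zcomb t x)).
Proof. exact: extendable_comp. Qed.

Let C1_z t : 0 <= t <= T -> C1 Omega (zcomb t).
Proof. by move=> t0; apply: C1_lin => //; exact: regular_C1. Qed.

Definition dzcomb j t x := a * partial j (w t) x + b * partial j (v t) x.

Let partial_z j t x : 0 <= t <= T -> Omega x -> partial j (zcomb t) x = dzcomb j t x.
Proof.
by move=> t0 Ox; have [] := partial_lin a b j (regular_C1 regw t0) (regular_C1 regv t0) Ox.
Qed.

Let Kw := flux_field w w kappa.
Let Kv := flux_field w v eta.

Definition flux j t x := a * Kw j t x + b * Kv j t x.

Let C1_Kw j t : 0 <= t <= T -> C1 Omega (Kw j t).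
Proof. exact: (C1_flux_field regw regw w_gt0 kappa_derive dkappa_continuous). Qed.
Let C1_Kv j t : 0 <= t <= T -> C1 Omega (Kv j t).
Proof. exact: (C1_flux_field regw regv w_gt0 eta_derive deta_continuous). Qed.
Let extendable_Kw j : extendable (Kw j).
Proof. exact: (extendable_flux_field regw regw w_gt0 kappa_derive). Qed.
Let extendable_Kv j : extendable (Kv j).
Proof. exact: (extendable_flux_field regw regv w_gt0 eta_derive). Qed.

Let C1_flux j t : 0 <= t <= T -> C1 Omega (flux j t).
Proof. by move=> t0; apply: C1_lin => //; [exact: C1_Kw|exact: C1_Kv]. Qed.

Let extendable_lin (c1 c2 : R) u1 u2 : extendable u1 -> extendable u2 -> extendable (fun t x => c1 * u1 t x + c2 * u2 t x).
Proof.
move=> n1 n2; apply: extendable_add; apply: extendable_mul => //; exact: extendable_cst.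
Qed.

Let extendable_flux j : extendable (flux j).
Proof. by apply: extendable_lin; [exact: extendable_Kw|exact: extendable_Kv]. Qed.

Let dflux j t x := a * partial j (Kw j t) x + b * partial j (Kv j t) x.

Let partial_flux j t x : 0 <= t <= T -> Omega x -> partial j (flux j t) x = dflux j t x.
Proof.
by move=> t0 Ox; have [] := partial_lin a b j (C1_Kw j t0) (C1_Kv j t0) Ox.
Qed.

Let extendable_dflux j : extendable (dflux j).
Proof.
apply: extendable_lin.
  exact: (extendable_partial_flux_field regw regw w_gt0 kappa_derive dkappa_continuous).
exact: (extendable_partial_flux_field regw regv w_gt0 eta_derive deta_continuous).
Qed.

Let extendable_dz j : extendable (dzcomb j).
Proof. by apply: extendable_lin; exact: regular_extendable_partial. Qed.

Let field t j x := dphi (zcomb t x) * flux j t x.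

Let partial_field t j x : 0 <= t <= T -> Omega x -> partial j (field t j) x =
  dphi (zcomb t x) * dflux j t x + flux j t x * (ddphi (zcomb t x) * dzcomb j t x).
Proof.
move=> t0 Ox.
have cx : closure Omega x by exact: subset_closure.
have C1dphi : C1 Omega (fun x => dphi (zcomb t x)).
  apply: (C1_comp (dphi := ddphi) oO (C1_z t0)) => y Oy.
    by apply: dphi_derive => //; exact: subset_closure.
  by apply: ddphi_continuous => //; exact: subset_closure.
have [_] := partial_mul j C1dphi (C1_flux j t0) Ox.
rewrite -[X in X = _ -> _]/(partial j (field t j) x) => ->.
rewrite partial_flux//; congr (_ + _ * _).
have [_] := partial_comp j (C1_z t0) Ox (dphi_derive t0 cx).
by rewrite -/(partial _ _) partial_z.
Qed.

Let tangential_field t : 0 <= t <= T -> tangential Omega (field t).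
Proof.
move=> t0; split.
- move=> j; apply: C1_mul => //; last exact: C1_flux.
  apply: (C1_comp (dphi := ddphi) oO (C1_z t0)) => y Oy.
    by apply: dphi_derive => //; exact: subset_closure.
  by apply: ddphi_continuous => //; exact: subset_closure.
- have nF j : extendable (fun t x => dphi (zcomb t x) * flux j t x) by exact: extendable_mul.
  have nD j : extendable (fun t x => dphi (zcomb t x) * dflux j t x
      + flux j t x * (ddphi (zcomb t x) * dzcomb j t x)).
    by apply: extendable_add; apply: extendable_mul => //; exact: extendable_mul.
  have /choice[K1 K1P] j := extendable_bounded bO (nF j).
  have /choice[K2 K2P] j := extendable_bounded bO (nD j).
  exists (\sum_j (`|K1 j| + `|K2 j|)) => j x Ox.
  have le1 : `|K1 j| + `|K2 j| <= \sum_j (`|K1 j| + `|K2 j|).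
    by rewrite [leRHS](bigD1 j)//= lerDl sumr_ge0// => k _; rewrite addr_ge0.
  split; apply: le_trans le1.
    rewrite (le_trans (K1P j t x t0 Ox))// (le_trans (ler_norm _))// lerDl//.
  rewrite partial_field// (le_trans (K2P j t x t0 Ox))// (le_trans (ler_norm _))// lerDr//.
- move=> x n bx nx.
  have [_ _ _ [nfv nfw] _] := sol.
  have h1 := flux_field_normal nfw t0 bx nx.
  have h2 := flux_field_normal nfv t0 bx nx.
  have [K KP] := extendable_bounded bO extendable_dphi.
  have h3 : (fun y => a * (\sum_j Kw j t y * n 0 j) + b * (\sum_j Kv j t y * n 0 j))
      @ within Omega (nbhs x) --> (0 : R).
    have := cvgD (cvgM (@cvg_cst _ a _ (within Omega (nbhs x)) _) h1)
                 (cvgM (@cvg_cst _ b _ (within Omega (nbhs x)) _) h2).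
    by rewrite !mulr0 addr0; apply.
  have Kn : \forall y \near within Omega (nbhs x), `|dphi (zcomb t y)| <= K.
    by apply: filterS (withinT Omega _) => y Oy; exact: KP.
  have -> : (fun y => \sum_j field t j y * n 0 j) = (fun y => dphi (zcomb t y) *
      (a * (\sum_j Kw j t y * n 0 j) + b * (\sum_j Kv j t y * n 0 j))).
    apply/funext => y; rewrite /field /flux !mulr_sumr -big_split/= mulr_sumr.
    by apply: eq_bigr => j _; ring.
  exact: (cvg_mul_bounded0 _ Kn h3).
Qed.

(** The rate of change of phi(z), without the divergence term: a times the source in
the equation of w, minus the flux paired with the gradient of phi'(z). *)
Definition dissipation t x :=
  a * dphi (zcomb t x) * eta (w t x) * norm2 (grad (v t) x) ^+ 2
  - ddphi (zcomb t x) * \sum_j dzcomb j t x * flux j t x.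

Lemma norm2_sqr (c : 'rV[R]_d) : norm2 c ^+ 2 = \sum_j c 0 j ^+ 2.
Proof.
by rewrite /norm2 sqr_sqrtr; [|apply: sumr_ge0 => j _]; rewrite -?expr2 ?sqr_ge0//.
Qed.

Let eta_extendable : extendable (fun t x => eta (w t x)).
Proof. exact: (extendable_coef regw w_gt0 eta_derive). Qed.

Lemma extendable_grad_sqr : extendable (fun t x => norm2 (grad (v t) x) ^+ 2).
Proof.
apply: (@extendable_eq _ _ _ _ (fun t x => \sum_j partial j (v t) x * partial j (v t) x)).
  by move=> t x _ _; rewrite norm2_sqr; apply: eq_bigr => j _; rewrite mxE expr2.
by apply: extendable_sum => j; apply: extendable_mul; exact: regular_extendable_partial.
Qed.

Let extendable_cross : extendable (fun t x => ddphi (zcomb t x) * \sum_j dzcomb j t x * flux j t x).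
Proof. by apply: extendable_mul => //; apply: extendable_sum => j; exact: extendable_mul. Qed.

Lemma extendable_dissipation : extendable dissipation.
Proof.
apply: extendable_add.
  apply: extendable_mul extendable_grad_sqr; apply: extendable_mul => //.
  by apply: extendable_mul => //; exact: extendable_cst.
apply: (@extendable_eq _ _ _ _ (fun t x => -1 * (ddphi (zcomb t x) * \sum_j dzcomb j t x * flux j t x))).
  by move=> t x _ _; rewrite mulN1r.
by apply: extendable_mul => //; exact: extendable_cst.
Qed.

Let weight t : R := p + q * t.

Let weight_continuous : continuous weight.
Proof.
move=> t; apply: (@continuous_atD R R (cst p) (fun t => q * t)); first exact: cst_continuous.
by apply: mulrl_continuous.
Qed.

Lemma extendable_balance :
  extendable (fun t x => q * phi (zcomb t x) + (p + q * t) * dissipation t x).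
Proof.
apply: extendable_add; first by apply: extendable_mul => //; exact: extendable_cst.
by apply: extendable_mul extendable_dissipation; exact: (@extendable_time R d Omega T weight weight_continuous).
Qed.

Section time_derivatives.
Variables gv gw : R * 'rV[R]_d -> R.
Hypothesis cgv : {within closed_cyl Omega T, continuous gv}.
Hypothesis cgw : {within closed_cyl Omega T, continuous gw}.
Hypothesis gvE : forall t x, (`]0, T[%classic `*` Omega) (t, x) -> gv (t, x) = dt v t x.
Hypothesis gwE : forall t x, (`]0, T[%classic `*` Omega) (t, x) -> gw (t, x) = dt w t x.

Let gz (r : R * 'rV[R]_d) : R := a * gw r + b * gv r.

Let source t x := dphi (zcomb t x) * (gz (t, x) - a * (eta (w t x) * norm2 (grad (v t) x) ^+ 2))
  + ddphi (zcomb t x) * \sum_j dzcomb j t x * flux j t x.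

Let sourceE t x : 0 < t < T -> Omega x -> source t x = divergence (field t) x.
Proof.
move=> /andP[t0 tT] Ox.
have tc : 0 <= t <= T by rewrite !ltW.
have to : (`]0, T[%classic `*` Omega) (t, x) by split => //=; rewrite in_itv/= t0.
have [_ eqv eqw _ _] := sol.
have [hv hw] : dt v t x = \sum_j partial j (Kv j t) x /\
   dt w t x = \sum_j partial j (Kw j t) x + eta (w t x) * norm2 (grad (v t) x) ^+ 2.
  by rewrite eqv ?t0// eqw ?t0// (div_flux_field w v eta) (div_flux_field w w kappa).
transitivity (\sum_j (dphi (zcomb t x) * dflux j t x
    + flux j t x * (ddphi (zcomb t x) * dzcomb j t x))); last first.
  by apply: eq_bigr => j _; rewrite partial_field.
rewrite big_split/= -mulr_sumr /source /gz gvE// gwE// hv hw; congr (_ * _ + _).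
  have -> : \sum_j dflux j t x = a * (\sum_j partial j (Kw j t) x) + b * (\sum_j partial j (Kv j t) x).
    by rewrite mulr_sumr mulr_sumr -big_split.
  have alg (X Y Z : R) : a * (X + Z) + b * Y - a * Z = a * X + b * Y by ring.
  exact: alg.
by rewrite mulr_sumr; apply: eq_bigr => j _; ring.
Qed.

Let cgz : {within closed_cyl Omega T, continuous gz}.
Proof. exact: within_continuous_lin. Qed.

Let extendable_gz : extendable (fun t x => gz (t, x)).
Proof. by exists gz. Qed.

Let extendable_source : extendable source.
Proof.
apply: extendable_add => //; apply: extendable_mul => //; apply: extendable_add => //.
apply: (@extendable_eq _ _ _ _ (fun t x => - a * (eta (w t x) * norm2 (grad (v t) x) ^+ 2))).
  by move=> t x _ _; rewrite mulNr.
by apply: extendable_mul; [exact: extendable_cst|apply: extendable_mul => //; exact: extendable_grad_sqr].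
Qed.

Let source_int0 : cyl_int (fun t x => weight t * source t x) = 0.
Proof.
have nw := @extendable_time R d Omega T weight weight_continuous.
apply: cyl_int_space0 => //; first exact: extendable_mul.
move=> t t0; have tc : 0 <= t <= T by case/andP: t0 => ? ?; rewrite !ltW.
rewrite RintegralZl//; last 2 first.
- exact: open_measurable_rV.
- exact: (extendable_section_integrable oO bO extendable_source).
rewrite (@eq_Rintegral _ _ _ _ _ (divergence (field t))); last first.
  by move=> x /set_mem Ox; rewrite sourceE.
by rewrite divergence_theorem ?mulr0//; exact: tangential_field.
Qed.

Let rate t x := q * phi (zcomb t x) + weight t * (dphi (zcomb t x) * gz (t, x)).

Let weight_phi x t := weight t * phi (zcomb t x).

Let weight_phi_within :
  {within closed_cyl Omega T, continuous (fun r => weight r.1 * phi (zcomb r.1 r.2))}.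
Proof.
apply: within_continuousM.
  apply: continuous_subspaceT => r.
  by apply: (@continuous_comp _ _ _ fst weight); [exact: cvg_fst|exact: weight_continuous].
apply: (within_comp zcomb_within) => -[t x] [/= t0 cx].
by apply: phi_continuous => //; move: t0; rewrite in_itv.
Qed.

Let rate_within : {within closed_cyl Omega T, continuous (fun r => rate r.1 r.2)}.
Proof.
rewrite (_ : (fun r => rate r.1 r.2) = fun r => q * phi (zcomb r.1 r.2)
    + weight r.1 * (dphi (zcomb r.1 r.2) * gz r)); last by apply/funext => -[].
apply: within_continuousD.
  apply: within_continuousM; first exact: within_continuous_cst.
  apply: (within_comp zcomb_within) => -[t x] [/= t0 cx].
  by apply: phi_continuous => //; move: t0; rewrite in_itv.
apply: within_continuousM.
  apply: continuous_subspaceT => r.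
  by apply: (@continuous_comp _ _ _ fst weight); [exact: cvg_fst|exact: weight_continuous].
apply: within_continuousM => //.
apply: (within_comp zcomb_within) => -[t x] [/= t0 cx].
by apply: dphi_continuous => //; move: t0; rewrite in_itv.
Qed.

Let weight_phi_derive x t : 0 < t < T -> Omega x ->
  is_derive t (1 : R) (weight_phi x) (rate t x).
Proof.
move=> tT Ox; have cx : closure Omega x by exact: subset_closure.
have tc : 0 <= t <= T by case/andP: tT => ? ?; rewrite !ltW.
have to : (`]0, T[%classic `*` Omega) (t, x) by split => //=; rewrite in_itv.
have dv : is_derive t (1 : R) (v ^~ x) (gv (t, x)).
  rewrite gvE// /dt derive1E; apply: DeriveDef => //.
  by case: regv => _ [h _] _ _; exact: h.
have dw : is_derive t (1 : R) (w ^~ x) (gw (t, x)).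
  rewrite gwE// /dt derive1E; apply: DeriveDef => //.
  by case: regw => _ [h _] _ _; exact: h.
have dz : is_derive t (1 : R) (zcomb ^~ x) (gz (t, x)).
  exact: (is_deriveD (is_deriveZ a dw) (is_deriveZ b dv)).
have dphiz := @is_derive1_comp R phi (zcomb ^~ x) t _ _ (phi_derive tc cx) dz.
have dweight : is_derive t (1 : R) weight q.
  have := is_deriveD (is_derive_cst p t (1 : R)) (is_deriveZ q (is_derive_id t (1 : R))).
  by rewrite add0r /GRing.scale /= mulr1.
have := is_deriveM dweight dphiz.
rewrite /rate; set e1 := (X in is_derive _ _ _ X); set e2 := (X in _ -> is_derive _ _ _ X).
suff -> : e1 = e2 by [].
by rewrite /e1 /e2 /GRing.scale /=; ring.
Qed.

Let rate_time x : Omega x ->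
  (\int[lam]_(t in `[0%R, T]) (rate t x)%:E = (weight_phi x T - weight_phi x 0)%:E)%E.
Proof.
move=> Ox; have cx : closure Omega x by exact: subset_closure.
have crate : {within `[0, T], continuous (rate ^~ x)}.
  exact: (within_time_slice rate_within cx).
have [_ cF0 cFT] : [/\ {in `]0, T[, continuous (weight_phi x)},
    weight_phi x t @[t --> 0^'+] --> weight_phi x 0 &
    weight_phi x t @[t --> T^'-] --> weight_phi x T].
  by apply/(continuous_within_itvP _ T0); exact: (within_time_slice weight_phi_within cx).
rewrite (@continuous_FTC2 _ (rate^~ x) (weight_phi x))//.
  split => // t; rewrite in_itv/= => tT.
  by have [] := weight_phi_derive tT Ox.
move=> t; rewrite in_itv/= => tT.
by rewrite derive1E; have [] := weight_phi_derive tT Ox.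
Qed.

(** The time derivatives enter through continuous extensions gv and gw to the closed
cylinder, so that the fundamental theorem of calculus applies on the whole of
[0, T] for each x. The spatial part integrates to zero since phi'(z) times the
flux is tangential. *)
Lemma entropy_balance_aux :
  \int[mu]_(x in Omega) ((p + q * T) * phi (zcomb T x) - p * phi (zcomb 0 x))
  = cyl_int (fun t x => q * phi (zcomb t x) + (p + q * t) * dissipation t x).
Proof.
have nrate : extendable rate by exact: within_extendable.
transitivity (cyl_int rate).
  rewrite (cyl_int_time oO bO nrate rate_time).
  by apply: eq_Rintegral => x _; rewrite /weight_phi /weight mulr0 addr0.
rewrite (@eq_cyl_int _ _ _ _ (fun t x => q * phi (zcomb t x) + (p + q * t) * dissipation t x)
  (fun t x => rate t x + (-1) * (weight t * source t x))); last first.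
  move=> t x _ _; rewrite /rate /source /dissipation /weight; ring.
have nws : extendable (fun t x => weight t * source t x).
  by apply: extendable_mul => //; exact: (@extendable_time R d Omega T weight weight_continuous).
rewrite [RHS](cyl_intD oO bO nrate (extendable_mul (extendable_cst _ _ (-1)) nws)).
by rewrite (cyl_intZ oO bO _ nws) source_int0 mulr0 addr0.
Qed.

End time_derivatives.

(** The weight p + q t serves two purposes: (1, 0) gives the plain balance between
times 0 and T, and (T, -1) removes the final time and produces a space-time
integral of phi(z). *)
Lemma entropy_balance :
  \int[mu]_(x in Omega) ((p + q * T) * phi (zcomb T x) - p * phi (zcomb 0 x))
  = cyl_int (fun t x => q * phi (zcomb t x) + (p + q * t) * dissipation t x).
Proof.
have [_ [_ [gv [cgv gvE]]] _ _] := regv.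
have [_ [_ [gw [cgw gwE]]] _ _] := regw.
exact: (entropy_balance_aux cgv cgw gvE gwE).
Qed.

End test_function.
End energy_identity.
End parabolic.

(** * Power functions and a concave test function *)

Section real_functions.
Context (R : realType).
Implicit Types (r s c g : R).

Lemma is_derive_continuous (f df : R -> R) (s : R) :
  is_derive s (1 : R) f (df s) -> {for s, continuous f}.
Proof.
by move=> [dfs _]; apply: differentiable_continuous; exact/derivable1_diffP.
Qed.

Lemma continuous_powR g s : 0 < s -> {for s, continuous (powR (R := R) ^~ g)}.
Proof.
move=> s0; apply: (@is_derive_continuous _ (fun t => g * t `^ (g - 1))).
exact: is_derive1_powR.
Qed.

Lemma continuous_scaled_powR c g s : 0 < s ->
  {for s, continuous (fun t : R => c * t `^ g)}.
Proof.
move=> s0; apply: continuous_atM.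
  exact: cst_continuous.
exact: continuous_powR.
Qed.

Lemma is_derive_scaled_powR c g s : 0 < s ->
  is_derive s (1 : R) (fun t : R => c * t `^ g) (c * g * s `^ (g - 1)).
Proof.
move=> s0; have := is_deriveZ c (is_derive1_powR g s0).
by rewrite /GRing.scale /= mulrA.
Qed.

(** The exponent may be zero, for which the power is 1 also at the origin. *)
Lemma continuous_norm_powR r : 0 <= r -> continuous (fun s : R => `|s| `^ r).
Proof.
rewrite le_eqVlt => /predU1P[<-|r0].
  by under eq_fun do rewrite powRr0; exact: cst_continuous.
move=> s; have [->|s0] := eqVneq s 0; last first.
  have cn : {for s, continuous (fun s : R => `|s|)} by exact: norm_continuous.
  have cp : {for `|s|, continuous (fun t : R => t `^ r)}.
    by apply: continuous_powR; rewrite normr_gt0.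
  exact: (@continuous_comp _ _ _ (fun s : R => `|s|) (fun t : R => t `^ r) s cn cp).
rewrite /continuous_at normr0 powR0 ?gt_eqF//.
apply/cvgr0Pnorm_lt => e e0.
have /cvgr0Pnorm_lt /(_ _ e0) := @powR_cvg0 R r r0.
rewrite /at_right near_withinE => /nbhs_ballP[m /= m0 mP].
apply/nbhs_ballP; exists m => //= t; rewrite /ball /= sub0r normrN => tm.
have [->|t0] := eqVneq t 0; first by rewrite normr0 powR0 ?gt_eqF// normr0.
by apply: mP; rewrite ?normr_gt0// /ball /= sub0r normrN normr_id.
Qed.

(** At the origin the function is s times |s|^(g - 1), whose second factor is
continuous when g >= 1. *)
Lemma is_derive_signed_power g s : 1 <= g ->
  is_derive s (1 : R) (fun t : R => signed_power t g) (g * `|s| `^ (g - 1)).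
Proof.
move=> g1; have g0 : 0 < g by rewrite (lt_le_trans ltr01).
have [s0|s0|->] := ltgtP s 0.
- rewrite ltr0_norm//.
  apply: (@near_eq_is_derive _ _ _ (fun t : R => -1 * (-1 * t + 0) `^ g)).
    have := lt_nbhsl s0; apply: filterS => t t0.
    by rewrite /signed_power ltr0_sg// ltr0_norm// !mulN1r addr0.
  have Ns0 : 0 < -1 * s + 0 by rewrite mulN1r addr0 oppr_gt0.
  have := is_derive_affine_comp (is_derive_scaled_powR (-1) g Ns0).
  set l := (X in is_derive _ _ _ X); suff -> : l = g * (- s) `^ (g - 1) by [].
  by rewrite /l [-1 * s]mulN1r addr0; ring.
- rewrite gtr0_norm//.
  apply: (@near_eq_is_derive _ _ _ (fun t : R => t `^ g)); last exact: is_derive1_powR.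
  have := lt_nbhsr s0; apply: filterS => t t0.
  by rewrite /signed_power gtr0_sg// gtr0_norm// mul1r.
- apply: (@near_eq_is_derive _ _ _ (fun t : R => t * `|t| `^ (g - 1))).
    near=> t; rewrite /signed_power; have [->|t0] := eqVneq t 0.
      by rewrite sgr0 !mul0r.
    by rewrite -(mulr_powRB1 (normr_ge0 t) g0) mulrA -numEsg.
  have -> : g * `|0 : R| `^ (g - 1) = `|0 : R| `^ (g - 1).
    rewrite normr0; have [->|gn1] := eqVneq g 1; first by rewrite mul1r.
    by rewrite powR0 ?mulr0// subr_eq0.
  apply: (@is_derive0_mul_id R (fun t => `|t| `^ (g - 1))).
  by apply: continuous_norm_powR; rewrite subr_ge0.
Unshelve. all: by end_near. Qed.

Section concave_test.
Variable delta : R.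
Hypothesis delta01 : 0 < delta < 1.

Let a := 1 - delta.
Let a0 : 0 < a. Proof. by rewrite subr_gt0; case/andP: delta01. Qed.
Let e := - a^-1.

(** Behaves like s near 0 and like s^a at infinity. The simpler choice s^a has the
right second derivative as well, but exceeds s for small s, which would bring
|Omega| into the estimate. *)
Definition conc s := s * (1 + s `^ a) `^ (e + 1).
Definition dconc s := (1 + s `^ a) `^ e * (1 + a * s `^ a).
Definition ddconc s :=
  - delta * ((1 + s `^ a) `^ (e - 1) * s `^ (a - 1) * (1 + a + a * s `^ a)).

Let u_gt0 s : 0 < 1 + s `^ a.
Proof. by rewrite ltr_pwDl// powR_ge0. Qed.

Let is_derive_u s : 0 < s -> is_derive s (1 : R) (fun t : R => 1 + t `^ a) (a * s `^ (a - 1)).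
Proof.
move=> s0; have := is_deriveD (is_derive_cst (1 : R) s (1 : R)) (is_derive1_powR a s0).
by rewrite add0r.
Qed.

Let is_derive_V r s : 0 < s ->
  is_derive s (1 : R) (fun t : R => (1 + t `^ a) `^ r)
    (r * (1 + s `^ a) `^ (r - 1) * (a * s `^ (a - 1))).
Proof.
move=> s0; have := @is_derive1_comp R (fun t : R => t `^ r) (fun t : R => 1 + t `^ a) s _ _
  (is_derive1_powR r (u_gt0 s)) (is_derive_u s0).
exact.
Qed.

Let ea : e * a = -1.
Proof. by rewrite /e mulNr mulVf// gt_eqF. Qed.

Let Vsucc r s : (1 + s `^ a) `^ (r + 1) = (1 + s `^ a) `^ r * (1 + s `^ a).
Proof.
rewrite (@powRD R _ r 1); last by rewrite (gt_eqF (u_gt0 s)) implybT.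
by rewrite [X in _ * X]powRr1// ltW.
Qed.

Let Vpred s : (1 + s `^ a) `^ e = (1 + s `^ a) `^ (e - 1) * (1 + s `^ a).
Proof. by rewrite -Vsucc subrK. Qed.

Let spow s : 0 < s -> s * s `^ (a - 1) = s `^ a.
Proof. by move=> s0; rewrite mulr_powRB1// ltW. Qed.

Lemma is_derive_conc s : 0 < s -> is_derive s (1 : R) conc (dconc s).
Proof.
move=> s0; have := is_deriveM (is_derive_id s (1 : R)) (is_derive_V (e + 1) s0).
rewrite /GRing.scale /=; set l := (X in is_derive _ _ _ X).
suff -> : l = dconc s by [].
rewrite /l /dconc mulr1 addrK Vsucc.
transitivity ((1 + s `^ a) `^ e * ((e + 1) * a * (s * s `^ (a - 1)) + (1 + s `^ a))); first by ring.
by rewrite spow// mulrDl ea mul1r; ring.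
Qed.

Lemma is_derive_dconc s : 0 < s -> is_derive s (1 : R) dconc (ddconc s).
Proof.
move=> s0; have dw : is_derive s (1 : R) (fun t : R => 1 + a * t `^ a) (a * a * s `^ (a - 1)).
  have := is_deriveD (is_derive_cst (1 : R) s (1 : R)) (is_derive_scaled_powR a a s0).
  by rewrite add0r.
have := is_deriveM (is_derive_V e s0) dw.
rewrite /GRing.scale /=; set l := (X in is_derive _ _ _ X).
suff -> : l = ddconc s by [].
rewrite /l /ddconc Vpred.
transitivity ((1 + s `^ a) `^ (e - 1) * s `^ (a - 1) *
  (a * a * (1 + s `^ a) + (e * a) * (1 + a * s `^ a))); first by ring.
by rewrite ea /a; ring.
Qed.

Lemma continuous_ddconc s : 0 < s -> {for s, continuous ddconc}.
Proof.
move=> s0; apply: continuous_atM; first exact: cst_continuous.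
apply: continuous_atM.
  apply: continuous_atM; last exact: continuous_powR.
  exact: (is_derive_continuous (df := fun s => _) (is_derive_V (e - 1) s0)).
apply: continuous_atD; first exact: cst_continuous.
exact: continuous_scaled_powR.
Qed.

Lemma conc_ge0 s : 0 <= s -> 0 <= conc s.
Proof. by move=> s0; rewrite mulr_ge0// powR_ge0. Qed.

Lemma conc_le s : 0 <= s -> conc s <= s.
Proof.
move=> s0; rewrite /conc -[leRHS]mulr1 ler_wpM2l//.
have e1 : e + 1 <= 0.
  rewrite /e addrC subr_le0 invf_ge1// /a gerBl.
  by case/andP: delta01 => /ltW.
by rewrite -[leRHS](powRr0 (1 + s `^ a)) ler_powR// lerDl powR_ge0.
Qed.

Lemma dconc_ge0 s : 0 <= dconc s.
Proof.
by rewrite mulr_ge0 ?powR_ge0// addr_ge0// mulr_ge0 ?powR_ge0// ltW.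
Qed.

(** Writing V = 1 + s^a, the second derivative is - delta V^(-1/a - 1) s^(- delta)
(1 + a + a s^a), whose last factor is at least a V; and V <= 2 (1 + s)^a gives
V^(-1/a) >= 2^(-1/a) / (1 + s). *)
Lemma ddconc_le s : 0 < s ->
  s `^ (- delta) / (1 + s) * (delta * a / 2 `^ a^-1) <= - ddconc s.
Proof.
move=> s0; have d0 : 0 < delta by case/andP: delta01.
have -> : - ddconc s = delta *
    ((1 + s `^ a) `^ (e - 1) * s `^ (a - 1) * (1 + a + a * s `^ a)).
  by rewrite /ddconc mulNr opprK.
have a1 : a - 1 = - delta by rewrite /a addrAC subrr add0r.
apply: (@le_trans _ _ (delta * (s `^ (- delta) * (a * (1 + s `^ a) `^ e)))); last first.
  rewrite ler_pM2l// Vpred a1.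
  have -> : s `^ (- delta) * (a * ((1 + s `^ a) `^ (e - 1) * (1 + s `^ a))) =
    (1 + s `^ a) `^ (e - 1) * s `^ (- delta) * (a * (1 + s `^ a)) by ring.
  by rewrite ler_wpM2l ?mulr_ge0 ?powR_ge0// [a * _]mulrDr mulr1 lerD2r lerDr.
have -> : s `^ (- delta) / (1 + s) * (delta * a / 2 `^ a^-1) =
  delta * (s `^ (- delta) * (a * (2 `^ a^-1 * (1 + s))^-1)).
  by rewrite invfM; ring.
rewrite ler_pM2l// ler_wpM2l ?powR_ge0// ler_pM2l//.
have s10 : 0 < 1 + s by rewrite addr_gt0.
rewrite /e powRN lef_pV2; last 2 first.
- by rewrite posrE mulr_gt0// powR_gt0.
- by rewrite posrE powR_gt0// u_gt0.
apply: (@le_trans _ _ ((2 * (1 + s) `^ a) `^ a^-1)).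
  rewrite ge0_ler_powR ?nnegrE ?invr_ge0 ?mulr_ge0 ?powR_ge0 ?(ltW a0) ?(ltW (u_gt0 s))//.
  rewrite mulr2n mulrDl mul1r lerD//.
    by rewrite -[leLHS](powRr0 (1 + s)) ler_powR ?(ltW a0)// lerDl ltW.
  by rewrite ge0_ler_powR ?nnegrE ?(ltW a0) ?(ltW s0) ?(ltW s10)// lerDr.
by rewrite powRM ?powR_ge0// -powRrM mulfV ?gt_eqF// powRr1// ltW.
Qed.

End concave_test.
End real_functions.

(** * A priori estimates *)

Lemma grad_comp_sqr (R : realType) d (D : set 'rV[R]_d) (f : 'rV[R]_d -> R)
    (phi : R -> R) (l : R) x : C1 D f -> D x -> is_derive (f x) (1 : R) phi l ->
  norm2 (grad (fun y => phi (f y)) x) ^+ 2 = l ^+ 2 * norm2 (grad f x) ^+ 2.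
Proof.
move=> cf Dx dphi; rewrite !norm2_sqr mulr_sumr; apply: eq_bigr => j _.
rewrite !mxE -exprMn; congr (_ ^+ 2).
by have [] := @partial_comp R d D f phi (fun=> l) j x cf Dx dphi.
Qed.

Lemma powR_sqr (R : realType) (s g : R) : (s `^ g) ^+ 2 = s `^ (2 * g).
Proof. by rewrite mulrC powRrM -powR_mulrn ?powR_ge0. Qed.

Lemma is_derive_negX (R : realType) n (s : R) :
  is_derive s (1 : R) (fun t : R => pos (- t) ^+ n.+2) (- (n.+2%:R * pos (- s) ^+ n.+1)).
Proof.
have := @is_derive_affine_comp R (fun t => pos t ^+ n.+2) (-1) 0 _ s (is_derive_posX n _).
rewrite mulN1r addr0 mulrN1; under eq_fun do rewrite mulN1r addr0.
exact.
Qed.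

Lemma continuous_neg_pos (R : realType) (s : R) : {for s, continuous (fun t : R => pos (- t))}.
Proof.
have cn : {for s, continuous (fun t : R => - t)} by exact: opp_continuous.
exact: (@continuous_comp _ _ _ (fun t : R => - t) (@pos R) s cn (@continuous_pos R _)).
Qed.

Section cylinder_ae.
Context (R : realType) (d : nat) (Omega : set 'rV[R]_d) (T : R).
Hypothesis oO : open Omega.
Hypothesis bO : bounded_set Omega.

(** Comparison outside a null set described by h: a nonnegative h with nonpositive
integral vanishes almost everywhere, and the two functions are compared only where
it does. They must be nonnegative for the almost everywhere monotonicity of the
integral. *)
Lemma le_cyl_int_ae (h u1 u2 : R -> 'rV[R]_d -> R) :
  extendable Omega T h -> extendable Omega T u1 -> extendable Omega T u2 ->
  (forall t x, 0 <= t <= T -> Omega x -> 0 <= h t x) -> cyl_int Omega T h <= 0 ->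
  (forall t x, 0 <= t <= T -> Omega x -> 0 <= u1 t x) ->
  (forall t x, 0 <= t <= T -> Omega x -> 0 <= u2 t x) ->
  (forall t x, 0 <= t <= T -> Omega x -> h t x = 0 -> u1 t x <= u2 t x) ->
  cyl_int Omega T u1 <= cyl_int Omega T u2.
Proof.
move=> nh n1 n2 h0 ih u10 u20 u12.
have mQ := @measurable_cylinder R d Omega T oO.
have inQ (p : R * 'rV[R]_d) : cylinder T Omega p -> 0 <= p.1 <= T /\ Omega p.2.
  by move=> [/= p1 p2]; split => //; move: p1; rewrite in_itv.
have ih0 : (\int[(@lebesgue_measure R \x lebesgue_rV R d)%E]_(p in cylinder T Omega)
    `|(h p.1 p.2)%:E| = 0)%E.
  transitivity (spacetime_integral T Omega h).
    apply: eq_integral => p /set_mem /inQ[p1 p2].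
    by rewrite gee0_abs// lee_fin h0.
  rewrite spacetime_integralE//.
  congr (_%:E); apply/eqP; rewrite eq_le ih/=; exact: cyl_int_ge0.
have mh := extendable_measurable oO nh.
have mhE : measurable_fun (cylinder T Omega) (fun p => (h p.1 p.2)%:E).
  exact/measurable_EFinP.
have aeh := (iffLR (ae_eq_integral_abs _ mQ mhE)) ih0.
have e1 := spacetime_integralE oO bO n1; have e2 := spacetime_integralE oO bO n2.
rewrite -lee_fin -e1 -e2.
apply: ae_ge0_le_integral => //.
- by move=> p /inQ[p1 p2]; rewrite lee_fin u10.
- by apply/measurable_EFinP; exact: extendable_measurable.
- by move=> p /inQ[p1 p2]; rewrite lee_fin u20.
- by apply/measurable_EFinP; exact: extendable_measurable.
- apply: filterS aeh => p hp Qp; have [p1 p2] := inQ p Qp.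
  rewrite lee_fin; apply: u12 => //.
  by have /eqP := hp Qp; rewrite eqe => /eqP.
Qed.

End cylinder_ae.

Section estimates.
Context (R : realType) (d : nat) (Omega : set 'rV[R]_d) (T : R).
Hypothesis domO : smooth_bounded_domain Omega.
Hypothesis T0 : 0 < T.
Variables (alpha beta eta0 kappa0 : R).
Variables (v w : R -> 'rV[R]_d -> R) (v0 w0 : 'rV[R]_d -> R) (wlow : R).
Hypothesis eta0_gt0 : 0 < eta0.
Hypothesis kappa0_gt0 : 0 < kappa0.
Let eta := power_law eta0 alpha.
Let kappa := power_law kappa0 beta.
Hypothesis sol : smooth_solution eta kappa T Omega v w v0 w0.
Hypothesis wlow0 : 0 < wlow.
Hypothesis w_ge : forall t x, 0 <= t <= T -> Omega x -> wlow <= w t x.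

Let mu : {sigma_finite_measure set 'rV[R]_d -> \bar R} := lebesgue_rV R d.
Let oO : open Omega. Proof. by case: domO. Qed.
Let bO : bounded_set Omega. Proof. by case: domO. Qed.
Let mO : measurable Omega. Proof. exact: open_measurable_rV. Qed.
Let regv : regular_upto_boundary T Omega v. Proof. by case: sol => -[]. Qed.
Let regw : regular_upto_boundary T Omega w. Proof. by case: sol => -[]. Qed.
Let T_in : 0 <= T <= T. Proof. by rewrite lexx ltW. Qed.
Let O_in : 0 <= (0 : R) <= T. Proof. by rewrite lexx ltW. Qed.

Local Notation extendable := (extendable Omega T).
Local Notation cyl_int := (cyl_int Omega T).

Let deta (s : R) : R := eta0 * alpha * s `^ (alpha - 1).
Let dkappa (s : R) : R := kappa0 * beta * s `^ (beta - 1).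

Let eta_derive (s : R) : 0 < s -> is_derive s (1 : R) eta (deta s).
Proof. by move=> s0; exact: is_derive_scaled_powR. Qed.
Let kappa_derive (s : R) : 0 < s -> is_derive s (1 : R) kappa (dkappa s).
Proof. by move=> s0; exact: is_derive_scaled_powR. Qed.
Let deta_continuous (s : R) : 0 < s -> {for s, continuous deta}.
Proof. by move=> s0; exact: continuous_scaled_powR. Qed.
Let dkappa_continuous (s : R) : 0 < s -> {for s, continuous dkappa}.
Proof. by move=> s0; exact: continuous_scaled_powR. Qed.

Let w_pos t x : 0 <= t <= T -> closure Omega x -> 0 < w t x.
Proof. exact: (w_gt0 sol wlow0 w_ge). Qed.
Let w_posO t x : 0 <= t <= T -> Omega x -> 0 < w t x.
Proof. exact: (w_gt0_in sol wlow0 w_ge). Qed.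

Definition vsqr t x := norm2 (grad (v t) x) ^+ 2.
Definition wsqr t x := norm2 (grad (w t) x) ^+ 2.

Let vsqr_ge0 t x : 0 <= vsqr t x. Proof. exact: sqr_ge0. Qed.
Let wsqr_ge0 t x : 0 <= wsqr t x. Proof. exact: sqr_ge0. Qed.

Let extendable_vsqr : extendable vsqr.
Proof. exact: (extendable_grad_sqr sol). Qed.

Let extendable_w_comp (phi : R -> R) : (forall s : R, 0 < s -> {for s, continuous phi}) ->
  extendable (fun t x => phi (w t x)).
Proof.
move=> cphi; apply: extendable_comp; first exact: regular_within.
by move=> t x t0 cx; apply: cphi; exact: w_pos.
Qed.

Let extendable_wsqr : extendable wsqr.
Proof.
apply: (@extendable_eq _ _ _ _ (fun t x => \sum_j partial j (w t) x * partial j (w t) x)).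
  by move=> t x _ _; rewrite /wsqr norm2_sqr; apply: eq_bigr => j _; rewrite mxE expr2.
by apply: extendable_sum => j; apply: extendable_mul; exact: regular_extendable_partial.
Qed.

Let eta_gt0 (s : R) : 0 < s -> 0 < eta s.
Proof. by move=> s0; rewrite mulr_gt0// powR_gt0. Qed.
Let kappa_gt0 (s : R) : 0 < s -> 0 < kappa s.
Proof. by move=> s0; rewrite mulr_gt0// powR_gt0. Qed.

(** The dissipation for z = w. Both terms are nonnegative when phi is increasing and
concave. *)
Definition production (dphi ddphi : R -> R) t x :=
  dphi (w t x) * (eta (w t x) * vsqr t x) - ddphi (w t x) * (kappa (w t x) * wsqr t x).

Section w_test.
Variables (phi dphi ddphi : R -> R).
Hypothesis phi_derive : forall s : R, 0 < s -> is_derive s (1 : R) phi (dphi s).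
Hypothesis dphi_derive : forall s : R, 0 < s -> is_derive s (1 : R) dphi (ddphi s).
Hypothesis ddphi_continuous : forall s : R, 0 < s -> {for s, continuous ddphi}.

Let zE t x : zcomb v w 1 0 t x = w t x.
Proof. by rewrite /zcomb mul1r mul0r addr0. Qed.

Let dissipationE t x :
  0 * phi (zcomb v w 1 0 t x) + (1 + 0 * t) * dissipation eta kappa v w 1 0 dphi ddphi t x
  = production dphi ddphi t x.
Proof.
rewrite /dissipation /production zE !mul0r add0r addr0 !mul1r mulrA; congr (_ - _ * _).
rewrite /wsqr norm2_sqr mulr_sumr; apply: eq_bigr => j _.
by rewrite /dzcomb /flux /flux_field !mul1r !mul0r !addr0 mxE; ring.
Qed.

Let z_phi t x : 0 <= t <= T -> closure Omega x ->
  is_derive (zcomb v w 1 0 t x) (1 : R) phi (dphi (zcomb v w 1 0 t x)).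
Proof. by move=> t0 cx; rewrite zE; apply: phi_derive; exact: w_pos. Qed.
Let z_dphi t x : 0 <= t <= T -> closure Omega x ->
  is_derive (zcomb v w 1 0 t x) (1 : R) dphi (ddphi (zcomb v w 1 0 t x)).
Proof. by move=> t0 cx; rewrite zE; apply: dphi_derive; exact: w_pos. Qed.
Let z_ddphi t x : 0 <= t <= T -> closure Omega x ->
  {for zcomb v w 1 0 t x, continuous ddphi}.
Proof. by move=> t0 cx; rewrite zE; apply: ddphi_continuous; exact: w_pos. Qed.

Lemma extendable_production : extendable (production dphi ddphi).
Proof.
apply: extendable_eq (extendable_balance sol wlow0 w_ge eta_derive kappa_derive 1 0
  z_phi z_dphi z_ddphi).
by move=> t x _ _; exact: dissipationE.
Qed.

Let extendable_phi : extendable (fun t x => phi (w t x)).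
Proof.
by apply: extendable_w_comp => s s0; apply: is_derive_continuous; exact: phi_derive.
Qed.

Lemma w_balance : \int[mu]_(x in Omega) phi (w T x) - \int[mu]_(x in Omega) phi (w 0 x)
  = cyl_int (production dphi ddphi).
Proof.
have phiE := entropy_balance domO T0 sol wlow0 w_ge eta_derive deta_continuous kappa_derive
  dkappa_continuous 1 0 z_phi z_dphi z_ddphi.
rewrite -RintegralB//.
- transitivity (\int[mu]_(x in Omega) ((1 + 0 * T) * phi (zcomb v w 1 0 T x)
      - 1 * phi (zcomb v w 1 0 0 x))).
    by apply: eq_Rintegral => x _; rewrite mul0r addr0 !mul1r !zE.
  by rewrite phiE; apply: eq_cyl_int => t x _ _; exact: dissipationE.
- exact: (extendable_section_integrable oO bO extendable_phi T_in).
- exact: (extendable_section_integrable oO bO extendable_phi O_in).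
Qed.

End w_test.

Lemma eta_vsqr_extendable : extendable (fun t x => eta (w t x) * vsqr t x).
Proof.
apply: extendable_mul extendable_vsqr; apply: extendable_w_comp => s s0.
by apply: is_derive_continuous; exact: eta_derive.
Qed.

Lemma w_mass_balance : \int[mu]_(x in Omega) w T x - \int[mu]_(x in Omega) w 0 x
  = cyl_int (fun t x => eta (w t x) * vsqr t x).
Proof.
rewrite (@w_balance id (cst 1) (cst 0)).
- by apply: eq_cyl_int => t x _ _; rewrite /production /cst mul1r mul0r subr0.
- by move=> s _; exact: cst_continuous.
Qed.

Let extendable_v0sqr : extendable (fun t x => 2^-1 * v t x ^+ 2).
Proof.
apply: extendable_mul; first exact: extendable_cst.
have nv := regular_extendable regv.
by apply: extendable_eq (extendable_mul nv nv) => t x _ _; rewrite expr2.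
Qed.

Lemma v_energy_balance : \int[mu]_(x in Omega) (2^-1 * v T x ^+ 2)
   - \int[mu]_(x in Omega) (2^-1 * v 0 x ^+ 2)
  = - cyl_int (fun t x => eta (w t x) * vsqr t x).
Proof.
have zE t x : zcomb v w 0 1 t x = v t x by rewrite /zcomb mul0r mul1r add0r.
have d1 s : is_derive s (1 : R) (fun s : R => 2^-1 * s ^+ 2) s.
  have := is_deriveZ 2^-1 (@is_deriveX _ _ (id : R -> R) 2 s 1 1 (is_derive_id _ _)).
  rewrite exprfctE /GRing.scale /= mulr1 expr1 mulrA mulVf ?mul1r//.
have := entropy_balance domO T0 sol wlow0 w_ge eta_derive deta_continuous kappa_derive
  dkappa_continuous 1 0 (a := 0) (b := 1) (phi := fun s => 2^-1 * s ^+ 2) (dphi := id)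
  (ddphi := cst 1) (fun t x _ _ => d1 _) (fun t x _ _ => is_derive_id _ _)
  (fun t x _ _ => @cst_continuous _ _ _ _).
move=> E; rewrite -RintegralB//.
- transitivity (\int[mu]_(x in Omega) ((1 + 0 * T) * (2^-1 * zcomb v w 0 1 T x ^+ 2)
      - 1 * (2^-1 * zcomb v w 0 1 0 x ^+ 2))).
    by apply: eq_Rintegral => x _; rewrite mul0r addr0 !mul1r !zE.
  rewrite E -mulN1r -cyl_intZ//; last exact: eta_vsqr_extendable.
  apply: eq_cyl_int => t x _ _; rewrite /dissipation !mul0r !add0r addr0 /cst !mul1r mulN1r.
  congr (- _); rewrite /vsqr norm2_sqr mulr_sumr; apply: eq_bigr => j _.
  by rewrite /dzcomb /flux /flux_field !mul1r !mul0r !add0r mxE; ring.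
- exact: (extendable_section_integrable oO bO extendable_v0sqr T_in).
- exact: (extendable_section_integrable oO bO extendable_v0sqr O_in).
Qed.

Definition total_energy := \int[mu]_(x in Omega) (2^-1 * v 0 x ^+ 2 + w 0 x).

Let extendable_w : extendable w. Proof. exact: regular_extendable. Qed.

Let mu_fin : (mu Omega < +oo)%E.
Proof.
have [L OL] := bounded_sub_cube bO.
exact: measurable_bounded_lty mO OL.
Qed.

Lemma energyE : energy Omega v0 w0 = total_energy%:E.
Proof.
rewrite /energy /space_integral /total_energy.
transitivity (\int[mu]_(x in Omega) (2^-1 * v 0 x ^+ 2 + w 0 x)%:E)%E.
  apply: eq_integral => x /set_mem Ox.
  by case: sol => _ _ _ _ /(_ x Ox)[-> ->].
rewrite /Rintegral fineK//; apply: integrable_fin_num => //.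
exact: (extendable_section_integrable oO bO (extendable_add extendable_v0sqr extendable_w) O_in).
Qed.

Lemma volumeE : lebesgue_rV R d Omega = (fine (mu Omega))%:E.
Proof. by rewrite fineK// ge0_fin_numE. Qed.

Let total_energyE : total_energy =
  \int[mu]_(x in Omega) (2^-1 * v 0 x ^+ 2) + \int[mu]_(x in Omega) w 0 x.
Proof.
rewrite /total_energy RintegralD//.
- exact: (extendable_section_integrable oO bO extendable_v0sqr O_in).
- exact: (extendable_section_integrable oO bO extendable_w O_in).
Qed.

Lemma total_energy_ge0 : 0 <= total_energy.
Proof.
apply: Rintegral_ge0 => x Ox; apply: addr_ge0; last exact/ltW/w_posO.
by rewrite mulr_ge0// sqr_ge0.
Qed.

Lemma eta_vsqr_le : cyl_int (fun t x => eta (w t x) * vsqr t x) <= total_energy.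
Proof.
have vT : 0 <= \int[mu]_(x in Omega) (2^-1 * v T x ^+ 2).
  by apply: Rintegral_ge0 => x _; rewrite mulr_ge0// sqr_ge0.
have w00 : 0 <= \int[mu]_(x in Omega) w 0 x.
  by apply: Rintegral_ge0 => x Ox; exact/ltW/w_posO.
have := v_energy_balance; rewrite total_energyE.
move: vT w00; set A := \int[mu]_(x in Omega) (2^-1 * v T x ^+ 2).
set B := \int[mu]_(x in Omega) w 0 x; set D := \int[mu]_(x in Omega) (2^-1 * v 0 x ^+ 2).
by set C := cyl_int _ => *; lra.
Qed.

(** What the temperature gains is exactly what the kinetic energy loses. *)
Lemma w_final_le : \int[mu]_(x in Omega) w T x <= total_energy.
Proof.
have vT : 0 <= \int[mu]_(x in Omega) (2^-1 * v T x ^+ 2).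
  by apply: Rintegral_ge0 => x _; rewrite mulr_ge0// sqr_ge0.
have := v_energy_balance; have := w_mass_balance; rewrite total_energyE.
move: vT; set A := \int[mu]_(x in Omega) (2^-1 * v T x ^+ 2).
set B := \int[mu]_(x in Omega) w 0 x; set D := \int[mu]_(x in Omega) (2^-1 * v 0 x ^+ 2).
by set C := cyl_int _; set F := \int[mu]_(x in Omega) w T x => *; lra.
Qed.

(** The production is the gain of int phi(w), at most int phi(w(T)); linear growth of
phi and the bound on int w(T) conclude. *)
Lemma production_le (phi dphi ddphi : R -> R) (c1 c2 : R) :
  (forall s : R, 0 < s -> is_derive s (1 : R) phi (dphi s)) ->
  (forall s : R, 0 < s -> is_derive s (1 : R) dphi (ddphi s)) ->
  (forall s : R, 0 < s -> {for s, continuous ddphi}) ->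
  0 <= c2 -> (forall s : R, 0 < s -> 0 <= phi s <= c1 + c2 * s) ->
  cyl_int (production dphi ddphi) <= c1 * fine (mu Omega) + c2 * total_energy.
Proof.
move=> dp ddp cddp c20 phi_le; rewrite -(w_balance dp ddp cddp).
have nphi : extendable (fun t x => phi (w t x)).
  by apply: extendable_w_comp => s s0; apply: is_derive_continuous; exact: dp.
have p0 : 0 <= \int[mu]_(x in Omega) phi (w 0 x).
  by apply: Rintegral_ge0 => x Ox; have /andP[] := phi_le _ (w_posO O_in Ox).
rewrite lerBlDr (le_trans _ (_ : c1 * fine (mu Omega) + c2 * \int[mu]_(x in Omega) w T x <= _))//.
- have nlin : extendable (fun t x => c1 + c2 * w t x).
    by apply: extendable_add; [exact: extendable_cst|apply: extendable_mul => //; exact: extendable_cst].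
  have -> : c1 * fine (mu Omega) + c2 * \int[mu]_(x in Omega) w T x =
      \int[mu]_(x in Omega) (c1 + c2 * w T x).
    rewrite RintegralD//; last 2 first.
    + exact: (extendable_section_integrable oO bO (extendable_cst Omega T c1) T_in).
    + have nc : extendable (fun t x => c2 * w t x) by apply: extendable_mul => //; exact: extendable_cst.
      exact: (extendable_section_integrable oO bO nc T_in).
    rewrite Rintegral_cst// RintegralZl//.
    exact: (extendable_section_integrable oO bO extendable_w T_in).
  apply: le_Rintegral => //.
  + exact: (extendable_section_integrable oO bO nphi T_in).
  + exact: (extendable_section_integrable oO bO nlin T_in).
  + by move=> x Ox; have /andP[] := phi_le _ (w_posO T_in Ox).
- by rewrite ler_wpDr// lerD2l ler_wpM2l//; exact: w_final_le.
Qed.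

Lemma spacetime_le (u : R -> 'rV[R]_d -> R) (phi dphi ddphi : R -> R) (c1 c2 C : R) :
  (forall s : R, 0 < s -> is_derive s (1 : R) phi (dphi s)) ->
  (forall s : R, 0 < s -> is_derive s (1 : R) dphi (ddphi s)) ->
  (forall s : R, 0 < s -> {for s, continuous ddphi}) ->
  0 <= c2 -> (forall s : R, 0 < s -> 0 <= phi s <= c1 + c2 * s) ->
  extendable u -> 0 <= C ->
  (forall t x, 0 <= t <= T -> Omega x -> u t x <= C * production dphi ddphi t x) ->
  (spacetime_integral T Omega u <= (C * (c1 * fine (mu Omega) + c2 * total_energy))%:E)%E.
Proof.
move=> dp ddp cddp c20 phi_le nu C0 uC; rewrite spacetime_integralE// lee_fin.
have np := extendable_production dp ddp cddp.
apply: (@le_trans _ _ (C * cyl_int (production dphi ddphi))).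
  rewrite -cyl_intZ//; apply: le_cyl_int => //.
  by apply: extendable_mul => //; exact: extendable_cst.
by rewrite ler_wpM2l//; exact: production_le dp ddp cddp c20 phi_le.
Qed.

Let prod_ge_w (dphi ddphi : R -> R) t x : 0 <= t <= T -> Omega x ->
  (forall s : R, 0 < s -> 0 <= dphi s) ->
  - ddphi (w t x) * (kappa (w t x) * wsqr t x) <= production dphi ddphi t x.
Proof.
move=> t0 Ox d0; rewrite /production mulNr lerDr mulr_ge0 ?d0 ?w_posO//.
by rewrite mulr_ge0// ltW// eta_gt0// w_posO.
Qed.

Let prod_ge_v (dphi ddphi : R -> R) t x : 0 <= t <= T -> Omega x ->
  (forall s : R, 0 < s -> ddphi s <= 0) ->
  dphi (w t x) * (eta (w t x) * vsqr t x) <= production dphi ddphi t x.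
Proof.
move=> t0 Ox d0; rewrite /production lerDl -mulNr mulr_ge0//.
  by rewrite oppr_ge0 d0// w_posO.
by rewrite mulr_ge0// ltW// kappa_gt0// w_posO.
Qed.

Let grad_powR_sqr g t x : 0 <= t <= T -> Omega x ->
  norm2 (grad (fun y => w t y `^ g) x) ^+ 2 = g ^+ 2 * w t x `^ (2 * (g - 1)) * wsqr t x.
Proof.
move=> t0 Ox.
rewrite (grad_comp_sqr (regular_C1 domO regw t0) Ox (is_derive1_powR g (w_posO t0 Ox))).
by rewrite exprMn powR_sqr.
Qed.

Let extendable_grad_powR_sqr g : extendable (fun t x => norm2 (grad (fun y => w t y `^ g) x) ^+ 2).
Proof.
apply: (@extendable_eq _ _ _ _ (fun t x => g ^+ 2 * w t x `^ (2 * (g - 1)) * wsqr t x)).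
  by move=> t x t0 Ox; rewrite grad_powR_sqr.
apply: extendable_mul => //; apply: extendable_mul; first exact: extendable_cst.
by apply: (extendable_w_comp (phi := fun s => s `^ (2 * (g - 1)))) => s s0; exact: continuous_powR.
Qed.

(** The integrand is a multiple of w^(- delta) / (1 + w) * kappa(w) |grad w|^2, which
[ddconc_le] bounds by the second term of the production of conc. *)
Lemma weighted_grad_powR_le delta : 0 < delta < 1 ->
  (spacetime_integral T Omega (fun t x => (1 + w t x)^-1
      * norm2 (grad (fun y => w t y `^ (1 + (beta - delta) / 2)) x) ^+ 2)%R <=
   ((1 + (beta - delta) / 2) ^+ 2 /
      (delta * (1 - delta) / 2 `^ (1 - delta)^-1 * kappa0) * total_energy)%:E)%E.
Proof.
move=> delta01; have [d0 d1] := andP delta01.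
set g := 1 + (beta - delta) / 2.
set K := delta * (1 - delta) / 2 `^ (1 - delta)^-1.
have K0 : 0 < K by rewrite divr_gt0 ?powR_gt0// mulr_gt0// subr_gt0.
have CK0 : 0 <= g ^+ 2 / (K * kappa0).
  exact: divr_ge0 (sqr_ge0 _) (mulr_ge0 (ltW K0) (ltW kappa0_gt0)).
have -> : total_energy = 0 * fine (mu Omega) + 1 * total_energy by rewrite mul0r add0r mul1r.
apply: (@spacetime_le _ (conc delta) (dconc delta) (ddconc delta)) => //.
- by move=> s s0; exact: is_derive_conc.
- by move=> s s0; exact: is_derive_dconc.
- by move=> s s0; exact: continuous_ddconc.
- by move=> s s0; rewrite add0r mul1r conc_ge0 ?conc_le ?ltW.
- apply: extendable_mul; last exact: extendable_grad_powR_sqr.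
  apply: (extendable_w_comp (phi := fun s => (1 + s)^-1)) => s s0.
  apply: (@continuousV R R (fun s : R => 1 + s)); first by rewrite gt_eqF// addr_gt0.
  by apply: continuous_atD; [exact: cst_continuous|move=> ?; exact].
move=> t x t0 Ox; have wp := w_posO t0 Ox.
rewrite grad_powR_sqr//.
apply: le_trans (_ : _ <= g ^+ 2 / (K * kappa0) *
    (- ddconc delta (w t x) * (kappa (w t x) * wsqr t x))) _; last first.
  rewrite (ler_wpM2l CK0)//.
  by apply: (@prod_ge_w (dconc delta) (ddconc delta)) => // s s0; exact: dconc_ge0.
have -> : 2 * (g - 1) = - delta + beta by rewrite /g; field.
rewrite powRD ?(gt_eqF wp) ?implybT// /kappa /power_law.
have -> : (1 + w t x)^-1 * (g ^+ 2 * (w t x `^ (- delta) * w t x `^ beta) * wsqr t x)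
  = g ^+ 2 / (K * kappa0) * (w t x `^ (- delta) / (1 + w t x) * K * (kappa0 * w t x `^ beta * wsqr t x)).
  by field; rewrite !gt_eqF// addr_gt0.
rewrite (ler_wpM2l CK0)// ler_wpM2r//; last exact: ddconc_le.
by rewrite mulr_ge0// mulr_ge0 ?powR_ge0// ltW.
Qed.

Section power_test.
Variable p : R.
Hypothesis p01 : 0 < p < 1.

Let phi (s : R) : R := s `^ p.
Let dphi (s : R) : R := p * s `^ (p - 1).
Let ddphi (s : R) : R := p * (p - 1) * s `^ (p - 1 - 1).

Let dphi_ge0 s : 0 < s -> 0 <= dphi s.
Proof. by move=> _; rewrite mulr_ge0 ?powR_ge0//; case/andP: p01 => /ltW. Qed.

Let ddphi_le0 s : 0 < s -> ddphi s <= 0.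
Proof.
move=> _; have [p0 p1] := andP p01.
by rewrite mulr_le0_ge0 ?powR_ge0// pmulr_rle0// subr_le0 ltW.
Qed.

(** The test function s^p is at most 1 + s. Either of the two nonnegative terms of its
production may serve as the upper bound: the first controls gradients of v, the
second gradients of w. *)
Lemma spacetime_le_powR (u : R -> 'rV[R]_d -> R) (C : R) :
  extendable u -> 0 <= C ->
  (forall t x, 0 <= t <= T -> Omega x ->
     u t x <= C * (p * w t x `^ (p - 1) * (eta (w t x) * vsqr t x)) \/
     u t x <= C * (p * (1 - p) * w t x `^ (p - 1 - 1) * (kappa (w t x) * wsqr t x))) ->
  (spacetime_integral T Omega u <= (C * (fine (mu Omega) + total_energy))%:E)%E.
Proof.
move=> nu C0 uC; have [p0 p1] := andP p01.
rewrite -[fine _]mul1r -[total_energy]mul1r.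
apply: (@spacetime_le u phi dphi ddphi) => //.
- by move=> s s0; exact: is_derive_scaled_powR.
- by move=> s s0; exact: continuous_scaled_powR.
- move=> s s0; rewrite powR_ge0/= mul1r; have [s1|/ltW s1] := leP s 1.
    rewrite ler_wpDr ?(ltW s0)//.
    have := @ge0_ler_powR R p (ltW p0) s 1.
    by rewrite !nnegrE (ltW s0) ler01 powR1; apply.
  by rewrite ler_wpDl// ler1_powR// ltW.
move=> t x t0 Ox; case: (uC t x t0 Ox) => /le_trans; apply; rewrite ler_wpM2l//.
  exact: (@prod_ge_v dphi ddphi).
apply: le_trans (@prod_ge_w dphi ddphi t x t0 Ox dphi_ge0).
by rewrite /ddphi -mulNr -mulrN opprB.
Qed.

End power_test.

(** The squared gradient is a multiple of w^(delta - 2) kappa(w) |grad w|^2, the second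
production term of s^delta. *)
Lemma grad_powR_le delta : 0 < delta < 1 ->
  (spacetime_integral T Omega (fun t x =>
      norm2 (grad (fun y => w t y `^ ((beta + delta) / 2)) x) ^+ 2)%R <=
   (((beta + delta) / 2) ^+ 2 / (delta * (1 - delta) * kappa0)
      * (fine (mu Omega) + total_energy))%:E)%E.
Proof.
move=> delta01; have [d0 d1] := andP delta01; have d1' : 0 < 1 - delta by rewrite subr_gt0.
set g := (beta + delta) / 2.
apply: (spacetime_le_powR delta01); first exact: extendable_grad_powR_sqr.
  by rewrite divr_ge0 ?sqr_ge0// !mulr_ge0// ltW.
move=> t x t0 Ox; right; have wp := w_posO t0 Ox; rewrite grad_powR_sqr//.
have -> : 2 * (g - 1) = (delta - 1 - 1) + beta by rewrite /g; field.
rewrite (@powRD R (w t x) (delta - 1 - 1) beta) ?(gt_eqF wp) ?implybT//.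
rewrite /kappa /power_law le_eqVlt; apply/orP; left; apply/eqP.
by field; rewrite !gt_eqF.
Qed.

(** For the test function s^(1 - alpha) the factor phi'(w) eta(w) is the constant
(1 - alpha) eta0. *)
Lemma grad_v_le : 0 < alpha < 1 ->
  (spacetime_integral T Omega (fun t x => norm2 (grad (v t) x) ^+ 2)%R <=
   (((1 - alpha) * eta0)^-1 * (fine (mu Omega) + total_energy))%:E)%E.
Proof.
move=> alpha01; have [a0 a1] := andP alpha01; have a1' : 0 < 1 - alpha by rewrite subr_gt0.
have p01 : 0 < 1 - alpha < 1 by rewrite a1' gtrBl.
apply: (spacetime_le_powR p01); first exact: extendable_vsqr.
  by rewrite invr_ge0 mulr_ge0// ltW.
move=> t x t0 Ox; left; have wp := w_posO t0 Ox.
have -> : 1 - alpha - 1 = - alpha by rewrite addrAC subrr add0r.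
rewrite /eta /power_law powRN -/(vsqr t x).
have wa : w t x `^ alpha != 0 by rewrite gt_eqF// powR_gt0.
rewrite le_eqVlt; apply/orP; left; apply/eqP.
by field; rewrite wa !gt_eqF.
Qed.

Section equal_coefficients.
Hypothesis kappa_eta : forall s, kappa s = eta s.
Variable M : R.
Hypothesis M_gt0 : 0 < M.
Hypothesis v0_le : forall x, Omega x -> `|v 0 x| <= M * w 0 x.

(** The cube of the negative part of M w + b v: convex, nonincreasing and twice
continuously differentiable as a function of M w + b v, and zero exactly where the
comparison holds. *)
Definition defect b t x := pos (- zcomb v w M b t x) ^+ 3.

Let dphi (s : R) : R := (-3) * pos (- s) ^+ 2.
Let ddphi (s : R) : R := 6 * pos (- s).

Let is_derive_phi s : is_derive s (1 : R) (fun t : R => pos (- t) ^+ 3) (dphi s).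
Proof. by have := is_derive_negX 1 s; rewrite /dphi -mulNr. Qed.

Let is_derive_dphi s : is_derive s (1 : R) dphi (ddphi s).
Proof.
have := is_deriveZ (-3) (is_derive_negX 0 s).
rewrite /GRing.scale /= expr1; set l := (X in is_derive _ _ _ X).
by suff -> : l = ddphi s by []; rewrite /l /ddphi; ring.
Qed.

Let continuous_ddphi s : {for s, continuous ddphi}.
Proof.
apply: continuous_atM; first exact: cst_continuous.
exact: continuous_neg_pos.
Qed.

Let zcomb_within b : {within closed_cyl Omega T, continuous (fun p => zcomb v w M b p.1 p.2)}.
Proof.
rewrite /zcomb; apply: (@within_continuous_lin R (R * 'rV[R]_d)%type _ (fun p => w p.1 p.2) (fun p => v p.1 p.2)).
  exact: regular_within.
exact: regular_within.
Qed.

Lemma extendable_defect b : extendable (defect b).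
Proof.
apply: (extendable_comp (u := zcomb v w M b) (phi := fun t : R => pos (- t) ^+ 3)).
  exact: zcomb_within.
by move=> t x _ _; apply: is_derive_continuous; exact: is_derive_phi.
Qed.

Lemma defect_ge0 b t x : 0 <= defect b t x.
Proof. by rewrite exprn_ge0// pos_ge0. Qed.

(** When kappa = eta the flux of z = M w + b v is eta(w) grad z, so the dissipation of
a convex nonincreasing function of z is nonpositive. The weight T - t vanishes at
the final time and the defect vanishes at the initial one; what is left is that the
space-time integral of the defect equals that of (T - t) times the dissipation. *)
Lemma defect_int_le0 b : `|b| = 1 -> cyl_int (defect b) <= 0.
Proof.
move=> b1.
have z_phi t x : 0 <= t <= T -> closure Omega x ->
    is_derive (zcomb v w M b t x) (1 : R) (fun t : R => pos (- t) ^+ 3) (dphi (zcomb v w M b t x)).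
  by move=> _ _; exact: is_derive_phi.
have z_dphi t x : 0 <= t <= T -> closure Omega x ->
    is_derive (zcomb v w M b t x) (1 : R) dphi (ddphi (zcomb v w M b t x)).
  by move=> _ _; exact: is_derive_dphi.
have z_ddphi t x : 0 <= t <= T -> closure Omega x ->
    {for zcomb v w M b t x, continuous ddphi}.
  by move=> _ _; exact: continuous_ddphi.
have E := entropy_balance domO T0 sol wlow0 w_ge eta_derive deta_continuous kappa_derive
  dkappa_continuous T (-1) z_phi z_dphi z_ddphi.
have nE := extendable_balance sol wlow0 w_ge eta_derive kappa_derive T (-1) z_phi z_dphi z_ddphi.
have diss_le0 t x : 0 <= t <= T -> Omega x ->
    dissipation eta kappa v w M b dphi ddphi t x <= 0.
  move=> t0 Ox; have ep := eta_gt0 (w_posO t0 Ox).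
  rewrite /dissipation subr_le0; apply: (@le_trans _ _ 0).
    rewrite mulr_le0_ge0 ?sqr_ge0// mulr_le0_ge0 ?(ltW ep)// mulr_ge0_le0 ?(ltW M_gt0)//.
    by rewrite /dphi mulNr oppr_le0 mulr_ge0// sqr_ge0.
  rewrite mulr_ge0//; first by rewrite mulr_ge0// pos_ge0.
  apply: sumr_ge0 => j _.
  have -> : flux eta kappa v w M b j t x = eta (w t x) * dzcomb v w M b j t x.
    by rewrite /flux /flux_field /dzcomb kappa_eta; ring.
  by rewrite mulrCA mulr_ge0 ?(ltW ep)// -expr2 sqr_ge0.
have E0 : cyl_int (fun t x => -1 * pos (- zcomb v w M b t x) ^+ 3
    + (T + -1 * t) * dissipation eta kappa v w M b dphi ddphi t x) = 0.
  rewrite -E (@eq_Rintegral _ _ _ _ _ (cst 0)) ?Rintegral_cst ?mul0r// => x /set_mem Ox.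
  rewrite mulN1r subrr mul0r sub0r [pos _]pos_eq0 ?expr0n ?mulr0 ?oppr0//.
  rewrite oppr_le0 /zcomb -[b * _]opprK subr_ge0 (le_trans _ (v0_le Ox))//.
  by rewrite (le_trans (ler_norm _))// normrN normrM b1 mul1r.
rewrite -[leRHS](mulr0 (-1)) -[X in _ <= _ * X]E0 -(cyl_intZ oO bO _ nE).
apply: (le_cyl_int oO bO (extendable_defect b) (extendable_mul (extendable_cst _ _ (-1)) nE)).
move=> t x t0 Ox; rewrite mulN1r opprD mulN1r opprK lerDl oppr_ge0.
rewrite mulr_ge0_le0 ?diss_le0// mulN1r subr_ge0.
by case/andP: t0.
Qed.

Let grad_signed_power_sqr g t x : 1 <= g -> 0 <= t <= T -> Omega x ->
  norm2 (grad (fun y => signed_power (v t y) g) x) ^+ 2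
  = (g * `|v t x| `^ (g - 1)) ^+ 2 * vsqr t x.
Proof.
move=> g1 t0 Ox.
by rewrite (grad_comp_sqr (phi := fun s => signed_power s g) (regular_C1 domO regv t0) Ox
  (is_derive_signed_power (v t x) g1)).
Qed.

Let extendable_grad_signed_power g : 1 <= g ->
  extendable (fun t x => norm2 (grad (fun y => signed_power (v t y) g) x) ^+ 2).
Proof.
move=> g1.
apply: (@extendable_eq _ _ _ _ (fun t x => (g * `|v t x| `^ (g - 1)) ^+ 2 * vsqr t x)).
  by move=> t x t0 Ox; rewrite grad_signed_power_sqr.
have ng : extendable (fun t x => g * `|v t x| `^ (g - 1)).
  apply: extendable_mul; first exact: extendable_cst.
  apply: (extendable_comp (u := v) (phi := fun s : R => `|s| `^ (g - 1))).
    exact: regular_within.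
  by move=> t x _ _; apply: continuous_norm_powR; rewrite subr_ge0.
apply: extendable_mul; last exact: extendable_vsqr.
by apply: extendable_eq (extendable_mul ng ng) => t x _ _; rewrite expr2.
Qed.

(** The squared gradient of the g-th signed power of v after |v| has been replaced by
M w. *)
Definition power_bound g t x := (g * M `^ (g - 1)) ^+ 2 * w t x `^ (2 * (g - 1)) * vsqr t x.

Lemma extendable_power_bound g : extendable (power_bound g).
Proof.
apply: extendable_mul; last exact: extendable_vsqr.
apply: extendable_mul; first exact: extendable_cst.
by apply: (extendable_w_comp (phi := fun s => s `^ (2 * (g - 1)))) => s s0; exact: continuous_powR.
Qed.

(** Outside a null set both defects vanish, which means |v| <= M w. *)
Lemma signed_power_le g : 1 <= g ->
  (spacetime_integral T Omega (fun t x =>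
     norm2 (grad (fun y => signed_power (v t y) g) x) ^+ 2)%R
   <= (cyl_int (power_bound g))%:E)%E.
Proof.
move=> g1; have ng := extendable_grad_signed_power g1.
rewrite spacetime_integralE// lee_fin.
have nd : extendable (fun t x => defect 1 t x + defect (-1) t x).
  by apply: extendable_add; exact: extendable_defect.
apply: (le_cyl_int_ae oO bO nd) => //.
- exact: extendable_power_bound.
- by move=> t x _ _; rewrite addr_ge0// defect_ge0.
- rewrite cyl_intD//; [|exact: extendable_defect|exact: extendable_defect].
  by rewrite -[leRHS]addr0 lerD// defect_int_le0// ?normrN normr1.
- by move=> t x _ _; exact: sqr_ge0.
- move=> t x _ _; rewrite /power_bound mulr_ge0 ?vsqr_ge0//.
  by rewrite mulr_ge0 ?powR_ge0//; exact: sqr_ge0.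
move=> t x t0 Ox /eqP; rewrite paddr_eq0 ?defect_ge0// => /andP[/eqP h1 /eqP h2].
have wp := w_posO t0 Ox.
have z_ge0 b : defect b t x = 0 -> 0 <= zcomb v w M b t x.
  move=> /eqP; rewrite expf_eq0/= => /eqP h; rewrite leNgt; apply/negP => zb.
  by move: h; rewrite pos_id ?oppr_ge0 ?(ltW zb)// => /eqP; rewrite oppr_eq0 (lt_eqF zb).
have vw : `|v t x| <= M * w t x.
  move: (z_ge0 _ h1) (z_ge0 _ h2); rewrite /zcomb mul1r mulN1r subr_ge0 => k1 k2.
  by rewrite ler_norml k2 andbT -subr_ge0 opprK addrC.
rewrite grad_signed_power_sqr// /power_bound ler_wpM2r// -powR_sqr -exprMn -mulrA.
rewrite -powRM ?(ltW M_gt0) ?(ltW wp)//.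
have g0 : 0 <= g by rewrite (le_trans ler01).
rewrite ler_sqr ?nnegrE ?mulr_ge0 ?powR_ge0// ler_wpM2l//.
by rewrite ge0_ler_powR ?nnegrE ?subr_ge0 ?mulr_ge0 ?(ltW M_gt0) ?(ltW wp).
Qed.

(** With g = 1 + alpha / 2 the power of w in the bound is w^alpha, so the right-hand
side is a multiple of eta(w) |grad v|^2. *)
Lemma grad_signed_power_v_le : 0 < alpha ->
  (spacetime_integral T Omega (fun t x =>
     norm2 (grad (fun y => signed_power (v t y) (1 + alpha / 2)) x) ^+ 2)%R
   <= (((1 + alpha / 2) * M `^ (alpha / 2)) ^+ 2 / eta0 * total_energy)%:E)%E.
Proof.
move=> a0; set g := 1 + alpha / 2.
have g1 : 1 <= g by rewrite lerDl divr_ge0// ltW.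
apply: (le_trans (signed_power_le g1)); rewrite lee_fin.
have gE : g - 1 = alpha / 2 by rewrite /g addrAC subrr add0r.
apply: (@le_trans _ _ ((g * M `^ (alpha / 2)) ^+ 2 / eta0 *
    cyl_int (fun t x => eta (w t x) * vsqr t x))); last first.
  by rewrite ler_wpM2l ?eta_vsqr_le// divr_ge0 ?sqr_ge0// ltW.
rewrite -cyl_intZ//; last exact: eta_vsqr_extendable.
rewrite le_eqVlt; apply/orP; left; apply/eqP; apply: eq_cyl_int => t x t0 Ox.
have gE2 : 2 * (g - 1) = alpha by rewrite gE mulrC divfK.
rewrite /power_bound gE2 gE /eta /power_law.
by field; rewrite gt_eqF.
Qed.

(** Here the bound is w^(delta - 1) w^alpha |grad v|^2, the first production term of
s^delta. The condition on alpha is g >= 1, needed to differentiate the signed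
power at zero. *)
Lemma grad_signed_power_v_le_volume delta : 0 < delta < 1 -> 1 - delta <= alpha ->
  (spacetime_integral T Omega (fun t x =>
     norm2 (grad (fun y => signed_power (v t y) ((1 + alpha + delta) / 2)) x) ^+ 2)%R
   <= (((1 + alpha + delta) / 2 * M `^ ((1 + alpha + delta) / 2 - 1)) ^+ 2
        / (delta * eta0) * (fine (mu Omega) + total_energy))%:E)%E.
Proof.
move=> delta01 da; have [d0 d1] := andP delta01; set g := (1 + alpha + delta) / 2.
have g1 : 1 <= g by rewrite /g ler_pdivlMr//; lra.
apply: (le_trans (signed_power_le g1)).
have npb := extendable_power_bound g.
rewrite -(spacetime_integralE oO bO npb).
apply: (spacetime_le_powR delta01 npb).
  by rewrite divr_ge0 ?sqr_ge0// mulr_ge0// ltW.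
move=> t x t0 Ox; left; have wp := w_posO t0 Ox.
have gE : 2 * (g - 1) = (delta - 1) + alpha by rewrite /g; field.
rewrite /power_bound gE (@powRD R (w t x) (delta - 1) alpha) ?(gt_eqF wp) ?implybT//.
rewrite /eta /power_law le_eqVlt; apply/orP; left; apply/eqP.
by field; rewrite !gt_eqF.
Qed.

End equal_coefficients.
End estimates.

Lemma lee_fin_scale (R : realType) (x : \bar R) (C C' a : R) :
  C <= C' -> 0 <= a -> (x <= (C * a)%:E)%E -> (x <= C'%:E * a%:E)%E.
Proof.
by move=> CC' a0 /le_trans; apply; rewrite -EFinM lee_fin ler_wpM2r.
Qed.

Theorem proposition5p5 (R : realType) :
  (forall (d : nat) (Omega : set 'rV[R]_d) (alpha beta eta0 kappa0 T : R),
     (0 < d)%N -> smooth_bounded_domain Omega ->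
     0 < alpha -> 0 < beta -> 0 < eta0 -> 0 < kappa0 -> 0 < T ->
   forall delta : R, 0 < delta < 1 ->
   exists2 C : R, 0 < C &
   forall (v w : R -> 'rV[R]_d -> R) (v0 w0 : 'rV[R]_d -> R) (wlow : R),
     smooth_solution (power_law eta0 alpha) (power_law kappa0 beta)
       T Omega v w v0 w0 ->
     0 < wlow ->
     (forall t x, 0 <= t <= T -> Omega x -> wlow <= w t x) ->
   [/\ (spacetime_integral T Omega (fun t x =>
          (1 + w t x)^-1
          * norm2 (grad (fun y => w t y `^ (1 + (beta - delta) / 2)) x) ^+ 2)%R
        <= C%:E * energy Omega v0 w0)%E,
       (spacetime_integral T Omega (fun t x =>
          norm2 (grad (fun y => w t y `^ ((beta + delta) / 2)) x) ^+ 2)%R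
        <= C%:E * (lebesgue_rV R d Omega + energy Omega v0 w0))%E &
       alpha < 1 ->
       (spacetime_integral T Omega (fun t x => norm2 (grad (v t) x) ^+ 2)%R
        <= C%:E * (lebesgue_rV R d Omega + energy Omega v0 w0))%E])
  /\
  (forall alpha eta0 delta M : R,
     0 < alpha -> 0 < eta0 -> 0 < delta < 1 ->
   exists2 C : R, 0 < C &
   forall (d : nat) (Omega : set 'rV[R]_d) (T : R),
     (0 < d)%N -> smooth_bounded_domain Omega -> 0 < T ->
   forall (v w : R -> 'rV[R]_d -> R) (v0 w0 : 'rV[R]_d -> R) (wlow : R),
     smooth_solution (power_law eta0 alpha) (power_law eta0 alpha)
       T Omega v w v0 w0 ->
     0 < wlow ->
     (forall t x, 0 <= t <= T -> Omega x -> wlow <= w t x) ->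
     (forall x, Omega x -> `|v0 x| <= M * w0 x) ->
   (spacetime_integral T Omega (fun t x =>
      norm2 (grad (fun y => signed_power (v t y) (1 + alpha / 2)) x) ^+ 2)%R
    <= C%:E * energy Omega v0 w0)%E /\
   (1 - delta <= alpha ->
    (spacetime_integral T Omega (fun t x =>
       norm2 (grad (fun y =>
         signed_power (v t y) ((1 + alpha + delta) / 2)) x) ^+ 2)%R
     <= C%:E * (lebesgue_rV R d Omega + energy Omega v0 w0))%E)).

Proof.
split.
  move=> d Omega alpha beta eta0 kappa0 T d_gt0 domO alpha0 beta0 eta00 kappa00 T0 delta delta01.
  pose Ca : R := (1 + (beta - delta) / 2) ^+ 2 /
      (delta * (1 - delta) / 2 `^ (1 - delta)^-1 * kappa0).
  pose Cb : R := ((beta + delta) / 2) ^+ 2 / (delta * (1 - delta) * kappa0).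
  pose Cc : R := ((1 - alpha) * eta0)^-1.
  have na := normr_ge0 Ca; have nb := normr_ge0 Cb; have nc := normr_ge0 Cc.
  have la := ler_norm Ca; have lb := ler_norm Cb; have lc := ler_norm Cc.
  (* Absolute values, because Cc is negative when alpha > 1. *)
  exists (`|Ca| + `|Cb| + `|Cc| + 1); first lra.
  move=> v w v0 w0 wlow sol wlow0 w_ge.
  have E0 := total_energy_ge0 T0 sol wlow0 w_ge.
  have V0 : 0 <= fine (lebesgue_rV R d Omega) by rewrite fine_ge0.
  rewrite (energyE domO T0 sol) (volumeE domO) -EFinD; split.
  - apply: (@lee_fin_scale _ _ Ca) => //; first lra.
    exact: (weighted_grad_powR_le domO T0 eta00 kappa00 sol wlow0 w_ge delta01).
  - apply: (@lee_fin_scale _ _ Cb); [lra|exact: addr_ge0|].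
    exact: (grad_powR_le domO T0 eta00 kappa00 sol wlow0 w_ge delta01).
  - move=> alpha1; apply: (@lee_fin_scale _ _ Cc); [lra|exact: addr_ge0|].
    apply: (grad_v_le domO T0 eta00 kappa00 sol wlow0 w_ge).
    by rewrite alpha0.
move=> alpha eta0 delta M alpha0 eta00 delta01.
(* The comparison argument uses a positive constant, whatever the sign of M. *)
pose M1 : R := `|M| + 1.
have M1_gt0 : 0 < M1 by rewrite ltr_wpDl.
pose Cd : R := ((1 + alpha / 2) * M1 `^ (alpha / 2)) ^+ 2 / eta0.
pose Ce : R := ((1 + alpha + delta) / 2 * M1 `^ ((1 + alpha + delta) / 2 - 1)) ^+ 2
        / (delta * eta0).
have nd := normr_ge0 Cd; have ne := normr_ge0 Ce.
have ld := ler_norm Cd; have le := ler_norm Ce.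
exists (`|Cd| + `|Ce| + 1); first lra.
move=> d Omega T d_gt0 domO T0 v w v0 w0 wlow sol wlow0 w_ge v0_le.
have E0 := total_energy_ge0 T0 sol wlow0 w_ge.
have V0 : 0 <= fine (lebesgue_rV R d Omega) by rewrite fine_ge0.
have v0_le1 x : Omega x -> `|v 0 x| <= M1 * w 0 x.
  move=> Ox; have [_ _ _ _ /(_ x Ox)[-> w0E]] := sol.
  apply: (le_trans (v0_le x Ox)); rewrite -w0E ler_wpM2r//.
    by apply: ltW; apply: lt_le_trans wlow0 _; apply: w_ge; rewrite ?lexx ?ltW.
  by rewrite (le_trans (ler_norm M))// lerDl.
rewrite (energyE domO T0 sol) (volumeE domO) -EFinD; split.
  apply: (@lee_fin_scale _ _ Cd) => //; first lra.
  exact: (grad_signed_power_v_le domO T0 eta00 sol wlow0 w_ge (fun=> erefl) M1_gt0 v0_le1 alpha0).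
move=> da; apply: (@lee_fin_scale _ _ Ce); [lra|exact: addr_ge0|].
exact: (grad_signed_power_v_le_volume domO T0 eta00 eta00 sol wlow0 w_ge (fun=> erefl) M1_gt0 v0_le1 delta01 da).
Qed.
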